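(* Let $n$ balls in the Euclidean space $\mathbb{R}^3$ be given (by their centers and radii), with $k$ different types of radii (i.e., $k$ distinct radius values), such that the ball centers are contained on $r$ planes that are all perpendicular to a single different plane. Then a maximum clique in the corresponding ball graph can be computed in $O(n^{2rk}(f(n)+n^2r))$ time, where $f(n)$ is the time to compute a maximum matching in an $n$-vertex bipartite graph.
   Context: The ball graph corresponding to a set of balls in $\mathbb{R}^3$ has one vertex per ball, and two vertices are adjacent if and only if the corresponding balls intersect (i.e., the distance between their centers is at most the sum of their radii). A maximum clique is a maximum-cardinality subset of pairwise adjacent vertices. The geometric representation (the balls themselves) is given as input. *)

(* Defs.v *)
From mathcomp Require Import all_boot all_order all_algebra.
From mathcomp Require Import reals.

Set Implicit Arguments.
Unset Strict Implicit.
Unset Printing Implicit Defensive.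

Import Order.TTheory GRing.Theory Num.Theory.

(** * Real RAM

   A program uses finitely many unbounded arrays of natural numbers and
   finitely many unbounded arrays of exact real numbers, both named by
   literals; a scalar variable is cell 0 of an array.  Every constant,
   arithmetic operation, comparison, memory access and control step costs one
   time unit.

   The model is kept free of the features that make unit-cost machines
   unrealistically strong: integers have addition and truncated subtraction
   only, there is no rounding or other conversion from reals to integers, and
   the only real constants are the natural numbers. *)

Inductive iexp : Type :=
| IConst of nat
| IGet of nat & iexp
| IAdd of iexp & iexp
| ISub of iexp & iexp.

Inductive rexp : Type :=
| RConst of nat
| RGet of nat & iexp
| RAdd of rexp & rexp
| RSub of rexp & rexp
| RMul of rexp & rexp
| RDiv of rexp & rexp.

Inductive test : Type :=
| TILe of iexp & iexp
| TRLe of rexp & rexp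
| TNot of test
| TAnd of test & test.

(* [ISet a e v] and [RSet a e v] store [v] in cell [e] of the integer, resp.
   real, array [a]. *)
Inductive com : Type :=
| Skip
| ISet of nat & iexp & iexp
| RSet of nat & iexp & rexp
| Seq of com & com
| If of test & com & com
| While of test & com.

Record state (R : Type) := State {
  iarr : nat -> nat -> nat;
  rarr : nat -> nat -> R
}.

Definition set_cell (T : Type) (m : nat -> nat -> T) (a i : nat) (v : T) :
    nat -> nat -> T :=
  fun a' i' => if (a' == a) && (i' == i) then v else m a' i'.

Definition iset (R : Type) (s : state R) (a i v : nat) : state R :=
  State (set_cell (iarr s) a i v) (rarr s).

Definition rset (R : Type) (s : state R) (a i : nat) (v : R) : state R :=
  State (iarr s) (set_cell (rarr s) a i v).

Fixpoint ieval (R : Type) (s : state R) (e : iexp) : nat :=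
  match e with
  | IConst c => c
  | IGet a e => iarr s a (ieval s e)
  | IAdd e1 e2 => (ieval s e1 + ieval s e2)
  | ISub e1 e2 => (ieval s e1 - ieval s e2)
  end.

Fixpoint reval (R : realType) (s : state R) (e : rexp) : R :=
  match e with
  | RConst c => c%:R%R
  | RGet a e => rarr s a (ieval s e)
  | RAdd e1 e2 => (reval s e1 + reval s e2)%R
  | RSub e1 e2 => (reval s e1 - reval s e2)%R
  | RMul e1 e2 => (reval s e1 * reval s e2)%R
  | RDiv e1 e2 => (reval s e1 / reval s e2)%R
  end.

Fixpoint teval (R : realType) (s : state R) (b : test) : bool :=
  match b with
  | TILe e1 e2 => (ieval s e1 <= ieval s e2)
  | TRLe e1 e2 => (reval s e1 <= reval s e2)%R
  | TNot b => ~~ teval s b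
  | TAnd b1 b2 => teval s b1 && teval s b2
  end.

Fixpoint icost (e : iexp) : nat :=
  match e with
  | IConst _ => 1
  | IGet _ e => (icost e).+1
  | IAdd e1 e2 | ISub e1 e2 => (icost e1 + icost e2).+1
  end.

Fixpoint rcost (e : rexp) : nat :=
  match e with
  | RConst _ => 1
  | RGet _ e => (icost e).+1
  | RAdd e1 e2 | RSub e1 e2 | RMul e1 e2 | RDiv e1 e2 =>
      (rcost e1 + rcost e2).+1
  end.

Fixpoint tcost (b : test) : nat :=
  match b with
  | TILe e1 e2 => (icost e1 + icost e2).+1
  | TRLe e1 e2 => (rcost e1 + rcost e2).+1
  | TNot b => (tcost b).+1
  | TAnd b1 b2 => (tcost b1 + tcost b2).+1
  end.

(* [exec p s t s']: started in [s], [p] halts in [s'] after exactly [t] time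
   units. *)
Inductive exec (R : realType) : com -> state R -> nat -> state R -> Prop :=
| ExecSkip s : exec Skip s 1 s
| ExecISet a e v s :
    exec (ISet a e v) s (icost e + icost v).+1
         (iset s a (ieval s e) (ieval s v))
| ExecRSet a e v s :
    exec (RSet a e v) s (icost e + rcost v).+1
         (rset s a (ieval s e) (reval s v))
| ExecSeq p q s t1 s1 t2 s2 :
    exec p s t1 s1 -> exec q s1 t2 s2 -> exec (Seq p q) s (t1 + t2).+1 s2
| ExecIfTrue b p q s t s1 :
    teval s b -> exec p s t s1 -> exec (If b p q) s (tcost b + t).+1 s1
| ExecIfFalse b p q s t s1 :
    ~~ teval s b -> exec q s t s1 -> exec (If b p q) s (tcost b + t).+1 s1
| ExecWhileFalse b p s :
    ~~ teval s b -> exec (While b p) s (tcost b).+1 s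
| ExecWhileTrue b p s t1 s1 t2 s2 :
    teval s b -> exec p s t1 s1 -> exec (While b p) s1 t2 s2 ->
    exec (While b p) s (tcost b + t1 + t2).+1 s2.

(* Memory is uninitialised: [input] only constrains the cells holding the
   input, and the program must be correct whatever the other cells contain. *)
Definition computes_within (R : realType) (p : com)
    (input output : state R -> Prop) (time : nat) : Prop :=
  forall s, input s ->
    exists t s', [/\ exec p s t s', (t <= time) & output s'].

(** * Graphs *)

Definition maximum_set (T : finType) (P : {set T} -> Prop) (A : {set T}) :
    Prop :=
  P A /\ forall A', P A' -> (#|A'| <= #|A|).

Definition clique (V : finType) (e : rel V) (K : {set V}) : Prop :=
  {in K &, forall x y, x != y -> e x y}.

Definition maximum_clique (V : finType) (e : rel V) : {set V} -> Prop :=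
  maximum_set (clique e).

Definition matching (V : finType) (e : rel V) (M : {set {set V}}) : Prop :=
  (forall E, E \in M -> exists x y, e x y /\ E = [set x; y]) /\ trivIset M.

Definition maximum_matching (V : finType) (e : rel V) :
    {set {set V}} -> Prop :=
  maximum_set (matching e).

Definition bipartite_graph (V : finType) (e : rel V) : Prop :=
  [/\ symmetric e, irreflexive e
    & exists c : V -> bool, forall x y, e x y -> c x != c y].

(** * Computing a maximum matching of a bipartite graph *)

(* The number of vertices, and the adjacency matrix in row-major order. *)
Definition graph_input (R : realType) (n : nat) (e : rel 'I_n) (s : state R) :
    Prop :=
  iarr s 0 0 = n /\
  forall i j : 'I_n, iarr s 1 (i * n + j) = nat_of_bool (e i j).

(* Cell [i] of array 2 holds the partner of vertex [i]; it holds a value that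
   is not a vertex when [i] is unmatched (no edge is of the form
   [[set i; i]]). *)
Definition matching_output (R : realType) (n : nat) (e : rel 'I_n)
    (s : state R) : Prop :=
  exists M : {set {set 'I_n}}, maximum_matching e M /\
    forall i j : 'I_n, (iarr s 2 i == j) = ([set i; j] \in M).

(* Some program computes a maximum matching of every bipartite graph on [n]
   vertices in time at most [f n], for all [n]. *)
Definition bipartite_matching_time (R : realType) (f : nat -> nat) : Prop :=
  exists p : com, forall (n : nat) (e : rel 'I_n), bipartite_graph e ->
    computes_within (R := R) p (graph_input e) (matching_output e) (f n).

(** * Balls and planes in Euclidean space *)

Definition dotv (R : realType) (u v : 'rV[R]_3) : R :=
  (\sum_(j < 3) u 0 j * v 0 j)%R.

(* The norm MathComp-Analysis puts on matrices is the max norm. *)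
Definition edist (R : realType) (u v : 'rV[R]_3) : R :=
  Num.sqrt (dotv (u - v)%R (u - v)%R).

Record ball (R : realType) := Ball {
  center : 'rV[R]_3;
  radius : R;
  radius_ge0 : (0 <= radius)%R
}.

Definition ball_graph (R : realType) (n : nat) (B : 'I_n -> ball R) :
    rel 'I_n :=
  fun i j => (i != j) &&
    (edist (center (B i)) (center (B j)) <= radius (B i) + radius (B j))%R.

Definition nb_radii (R : realType) (n : nat) (B : 'I_n -> ball R) : nat :=
  size (undup [seq radius (B i) | i : 'I_n]).

(* The plane of all [x] such that [dotv normal x = offset]. *)
Record plane (R : realType) := Plane {
  normal : 'rV[R]_3;
  offset : R;
  normal_neq0 : normal != 0%R
}.

Definition on_plane (R : realType) (x : 'rV[R]_3) (P : plane R) : Prop :=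
  dotv (normal P) x = offset P.

Definition perpendicular (R : realType) (P Q : plane R) : Prop :=
  dotv (normal P) (normal Q) = 0%R.

Definition centers_on_perpendicular_planes (R : realType) (n : nat)
    (B : 'I_n -> ball R) (r : nat) : Prop :=
  exists (P0 : plane R) (P : 'I_r -> plane R),
    (forall l, perpendicular (P l) P0) /\
    (forall i, exists l, on_plane (center (B i)) (P l)).

(** * Computing a maximum clique of a ball graph *)

(* The number of balls; the coordinates of the centers in the real arrays
   0, 1, 2; the radii in the real array 3. *)
Definition balls_input (R : realType) (n : nat) (B : 'I_n -> ball R)
    (s : state R) : Prop :=
  [/\ iarr s 0 0 = n,
      forall (i : 'I_n) (j : 'I_3), rarr s j i = center (B i) 0%R j
    & forall i : 'I_n, rarr s 3 i = radius (B i)].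

(* Integer array 1 holds the characteristic vector of the clique. *)
Definition clique_output (R : realType) (n : nat) (B : 'I_n -> ball R)
    (s : state R) : Prop :=
  maximum_clique (ball_graph B) [set i : 'I_n | iarr s 1 i != 0].

(* Main.v *)
(* Let v be a common direction of the planes, thought of as vertical. Split the
   balls of a maximum clique by plane and by radius, and in each of the at most
   r k classes guess the two clique centers p, q that are extreme in the
   horizontal direction of the plane. The remaining candidates of the class lie
   above or below the segment pq, in the strip over it, and are adjacent to every
   guessed ball. Two candidates x, y on the same side, say above, are adjacent:
   if x is at least as high as y, then y is at most as far from x as the point of
   the segment of y vertically below y, and that point is close to x because both
   ends of the segment are. So the candidates induce a cobipartite graph, and
   Koenig's construction turns a maximum matching of its complement into a maximum
   clique. There are at most n^(2rk) guesses.

   The planes are not part of the input, but only v and their number matter.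
   For m = 1, 2, ..., each of the n^(2m) choices of m pairs of points is tried:
   the l-th pair and some point not covered so far span the l-th plane. If they
   are collinear they span a line, which imposes no condition on v. The first
   choice that covers all centers and whose normals have a common orthogonal
   direction yields v, and this happens for some m at most r. *)

Require Import Defs.
From mathcomp Require Import all_boot all_order all_algebra.
From mathcomp Require Import reals.
From mathcomp Require Import zify ring lra.
From mathcomp Require boolp.

Set Implicit Arguments.
Unset Strict Implicit.
Unset Printing Implicit Defensive.

Import Order.TTheory GRing.Theory Num.Theory.

(** * Total correctness with running times *)

(** The planes found need not be the given ones. Some choice of pairs succeeds by [m = r] for a
    greedy reason: the pivot is an uncovered center, so the given plane assigned to it has not been
    treated before, and two suitable centers of that plane make the step cover all the others. A
    center [y] is described by [(cross v y, dot v y)], four polynomial coordinates in which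
    distances are multiplied by the length of [v]. [f] is an arbitrary function, so a graph on the
    candidates alone could be more expensive than one on [n] vertices. The matching program is
    always called on all [n] vertices, where the other balls are isolated. Neither [r] nor [k] is
    input. [k] is counted; [r] can be capped at [n], since one plane per center suffices. With
    [r <= n], the at most [r] rounds of the direction search, each of order [n ^ (2 * r) * (n * r)],
    fit into [n ^ (2 * r) * (n ^ 2 * r)]. *)

Definition wp (R : realType) (c : com) (T : nat) (Q : state R -> Prop)
    (s : state R) : Prop :=
  exists t s', [/\ exec c s t s', t <= T & Q s'].

Fixpoint wri (c : com) (a : nat) : bool :=
  match c with
  | Skip => false
  | ISet b _ _ => a == b
  | RSet _ _ _ => false
  | Seq p q | If _ p q => wri p a || wri q a
  | While _ p => wri p a
  end.

Fixpoint wrr (c : com) (a : nat) : bool :=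
  match c with
  | Skip => false
  | ISet _ _ _ => false
  | RSet b _ _ => a == b
  | Seq p q | If _ p q => wrr p a || wrr q a
  | While _ p => wrr p a
  end.

(** Framing works at the level of whole arrays: arrays are named by literals, so the set of arrays a
    program may write is syntactic. *)
Definition unch (R : Type) (c : com) (s s' : state R) : Prop :=
  (forall a, wri c a = false -> iarr s' a = iarr s a) /\
  (forall a, wrr c a = false -> rarr s' a = rarr s a).

Fixpoint loopfree (c : com) : bool :=
  match c with
  | While _ _ => false
  | Seq p q | If _ p q => loopfree p && loopfree q
  | _ => true
  end.

Fixpoint run (R : realType) (c : com) (s : state R) : state R :=
  match c with
  | ISet a e v => iset s a (ieval s e) (ieval s v)
  | RSet a e v => rset s a (ieval s e) (reval s v)
  | Seq p q => run q (run p s)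
  | If b p q => if teval s b then run p s else run q s
  | _ => s
  end.

(** The branches of [If] are added instead of maximised, which keeps the bound a plain sum for
    linear arithmetic. The value at [While] is a dummy; as a time bound it is used for loop-free
    code. *)
Fixpoint maxcost (c : com) : nat :=
  match c with
  | Skip => 1
  | ISet a e v => (icost e + icost v).+1
  | RSet a e v => (icost e + rcost v).+1
  | Seq p q => (maxcost p + maxcost q).+1
  | If b p q => (tcost b + (maxcost p + maxcost q)).+1
  | While _ _ => 0
  end.

Section Logic.
Variable R : realType.
Implicit Types (c : com) (s : state R) (Q : state R -> Prop).

Lemma unch_trans c s1 s2 s3 : unch c s1 s2 -> unch c s2 s3 -> unch c s1 s3.
Proof.
by move=> [i1 r1] [i2 r2]; split=> a h; rewrite ?i2 ?i1 ?r2 ?r1.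
Qed.

Lemma unch_sub c c' s s' :
  (forall a, wri c' a = false -> wri c a = false) ->
  (forall a, wrr c' a = false -> wrr c a = false) ->
  unch c s s' -> unch c' s s'.
Proof. by move=> hi hr [i r]; split=> a h; [apply/i/hi|apply/r/hr]. Qed.

Lemma unch_seql c c' s s' : unch c s s' -> unch (Seq c c') s s'.
Proof. by apply: unch_sub => a /= /negbT /norP[/negbTE]. Qed.

Lemma unch_seqr c c' s s' : unch c' s s' -> unch (Seq c c') s s'.
Proof. by apply: unch_sub => a /= /negbT /norP[_ /negbTE]. Qed.

Lemma exec_unch c s t s' : exec c s t s' -> unch c s s'.
Proof.
elim=> {c s t s'}.
- by [].
- move=> a e v s; split=> //= b ba; apply: boolp.funext => i.
  by rewrite /set_cell ba.
- move=> a e v s; split=> //= b ba; apply: boolp.funext => i.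
  by rewrite /set_cell ba.
- move=> p q s t1 s1 t2 s2 _ u1 _ u2.
  exact: unch_trans (unch_seql _ u1) (unch_seqr _ u2).
- by move=> b p q s t s1 _ _; apply: unch_sub => a /= /negbT /norP[/negbTE].
- by move=> b p q s t s1 _ _; apply: unch_sub => a /= /negbT /norP[_ /negbTE].
- by [].
- move=> b p s t1 s1 t2 s2 _ _ u1 _ u2.
  exact: unch_trans u1 u2.
Qed.

Lemma wp_frame c T Q Q' s :
  wp c T Q' s -> (forall s', unch c s s' -> Q' s' -> Q s') -> wp c T Q s.
Proof.
move=> [t [s' [e tT q]]] h; exists t, s'; split=> //.
by apply: h => //; apply: exec_unch e.
Qed.

Lemma wp_le c T T' Q s : T' <= T -> wp c T' Q s -> wp c T Q s.
Proof.
by move=> le [t [s' [e tT q]]]; exists t, s'; split=> //; apply: leq_trans le.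
Qed.

Lemma wp_seq c1 c2 T1 T2 Q s :
  wp c1 T1 (wp c2 T2 Q) s -> wp (Seq c1 c2) (T1 + T2).+1 Q s.
Proof.
move=> [t1 [s1 [e1 l1 [t2 [s2 [e2 l2 q]]]]]].
exists (t1 + t2).+1, s2; split=> //; first exact: ExecSeq e1 e2.
by rewrite ltnS leq_add.
Qed.

Lemma wp_bind c1 c2 T1 T2 Q1 Q s :
  wp c1 T1 Q1 s ->
  (forall s', unch c1 s s' -> Q1 s' -> wp c2 T2 Q s') ->
  wp (Seq c1 c2) (T1 + T2).+1 Q s.
Proof. by move=> h1 h2; apply: wp_seq; apply: wp_frame h1 h2. Qed.

Lemma wp_run c Q s : loopfree c -> Q (run c s) -> wp c (maxcost c) Q s.
Proof.
elim: c Q s => [|a e v|a e v|p IHp q IHq|b p IHp q IHq|] //= Q s.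
- by move=> _ h; exists 1, s; split=> //; constructor.
- by move=> _ h; eexists _, _; split; [constructor| |].
- by move=> _ h; eexists _, _; split; [constructor| |].
- move=> /andP[lp lq] h; apply: wp_seq; apply: IHp => //; exact: IHq.
- case/andP=> lp lq; case: ifPn => tb h.
    have [t [s' [e l q']]] := IHp _ _ lp h.
    exists (tcost b + t).+1, s'; split=> //; first exact: ExecIfTrue.
    by rewrite ltnS leq_add2l (leq_trans l) // leq_addr.
  have [t [s' [e l q']]] := IHq _ _ lq h.
  exists (tcost b + t).+1, s'; split=> //; first exact: ExecIfFalse.
  by rewrite ltnS leq_add2l (leq_trans l) // leq_addl.
Qed.

Lemma wp_if b p q T Q s :
  (teval s b -> wp p T Q s) -> (~~ teval s b -> wp q T Q s) ->
  wp (If b p q) (tcost b + T).+1 Q s.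
Proof.
case: (boolP (teval s b)) => tb hp hq.
  have [t [s' [e l q']]] := hp isT.
  exists (tcost b + t).+1, s'; split=> //; first exact: ExecIfTrue.
  by rewrite ltnS leq_add2l.
have [t [s' [e l q']]] := hq isT.
exists (tcost b + t).+1, s'; split=> //; first exact: ExecIfFalse.
by rewrite ltnS leq_add2l.
Qed.

(** Termination is read off the invariant, which counts iterations: a true test at [i = N] would
    produce a state satisfying [I N.+1]. *)
Lemma wp_while b body (N T : nat) (I : nat -> state R -> Prop) Q s :
  I 0 s ->
  (forall i s', I i s' -> i <= N) ->
  (forall i s', unch body s s' -> I i s' -> ~~ teval s' b -> Q s') ->
  (forall i s', unch body s s' -> I i s' -> teval s' b -> wp body T (I i.+1) s') ->
  wp (While b body) (N * (T + (tcost b).+1) + (tcost b).+1) Q s.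
Proof.
move=> I0 IN IQ IS.
suff: forall d i s', i + d = N -> unch body s s' -> I i s' ->
    wp (While b body) (d * (T + (tcost b).+1) + (tcost b).+1) Q s'.
  by move=> h; exact: (h N 0 s).
elim=> [|d IHd] i s' idN us Ii.
  case: (boolP (teval s' b)) => tb; last first.
    exists (tcost b).+1, s'; split; [exact: ExecWhileFalse|lia|exact: IQ Ii tb].
  by have [t [s'' [_ _ /IN]]] := IS _ _ us Ii tb; lia.
case: (boolP (teval s' b)) => tb; last first.
  exists (tcost b).+1, s'; split; [exact: ExecWhileFalse|lia|exact: IQ Ii tb].
have [t [s'' [e l Ii']]] := IS _ _ us Ii tb.
have us'' := unch_trans us (exec_unch e).
have [t2 [s2 [e2 l2 q2]]] := IHd i.+1 s'' ltac:(lia) us'' Ii'.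
exists (tcost b + t + t2).+1, s2; split=> //; first exact: ExecWhileTrue e e2.
move: l l2; rewrite mulSn; lia.
Qed.

End Logic.

(** * Counted loops *)

Definition var (a : nat) : iexp := IGet a (IConst 0).
Definition asg (a : nat) (e : iexp) : com := ISet a (IConst 0) e.
Definition tlt (e1 e2 : iexp) : test := TNot (TILe e2 e1).

Definition For (x b : nat) (body : com) : com :=
  Seq (asg x (IConst 0))
      (While (tlt (var x) (var b)) (Seq body (asg x (IAdd (var x) (IConst 1))))).

Section ForLogic.
Variable R : realType.
Implicit Types (c : com) (s : state R) (Q : state R -> Prop).

Lemma unch_for x b body s s' : unch body s s' -> unch (For x b body) s s'.
Proof.
apply: unch_sub => a /= /negbT; first by move=> /norP[_ /norP[/negbTE]].
by move=> /norP[/negbTE].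
Qed.

(** The invariant is re-established after the counter update, hence the [iset] in the premise for
    the body. The constant 20 absorbs the test, the increment and the sequencing. *)
Lemma wp_for x b body (N T : nat) (I : nat -> state R -> Prop) s :
  [&& x != b, ~~ wri body x & ~~ wri body b] ->
  iarr s b 0 = N ->
  I 0 (iset s x 0 0) ->
  (forall i s', i < N -> unch (For x b body) s s' -> iarr s' x 0 = i ->
     I i s' -> wp body T (fun s'' => I i.+1 (iset s'' x 0 i.+1)) s') ->
  wp (For x b body) (N * (T + 20) + 20) (I N) s.
Proof.
move=> /and3P[xb /negbTE wx /negbTE wb] sb I0 IS.
rewrite /For; set wbody := Seq body _.
apply: (@wp_le _ _ _ ((maxcost (asg x (IConst 0))) +
    (N * ((T + 7) + (tcost (tlt (var x) (var b))).+1) +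
    (tcost (tlt (var x) (var b))).+1)).+1).
  by rewrite /=; lia.
have seqx0 : unch (For x b body) s (iset s x 0 0).
  split=> // a /= ha; apply: boolp.funext => i.
  by rewrite /set_cell; case: (a == x) ha.
apply: wp_seq; apply: wp_run => //=.
pose J i (s' : state R) := [/\ i <= N, iarr s' x 0 = i, iarr s' b 0 = N,
  unch (For x b body) s s' & I i s'].
apply: (@wp_while _ _ _ _ _ J).
- split=> //; first by rewrite /= /set_cell eqxx.
  by rewrite /= /set_cell eq_sym (negbTE xb).
- by move=> i s' [].
- move=> i s' _ [iN six sib _ Ii]; rewrite /= six sib negbK => Ni.
  by have -> : N = i by lia.
- move=> i s' _ [iN six sib us Ii]; rewrite /= six sib -ltnNge => ltiN.
  apply: (@wp_le _ _ _ (T + maxcost (asg x (IAdd (var x) (IConst 1)))).+1).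
    by rewrite /=; lia.
  apply: (wp_bind (IS i s' ltiN us six Ii)) => s1 u1 I1.
  apply: wp_run => //=.
  have e1 : iarr s1 x 0 = i by rewrite (u1.1 x wx).
  rewrite e1 addn1; split=> //=.
  + by rewrite /set_cell !eqxx.
  + rewrite /set_cell eq_sym (negbTE xb) /=.
    by rewrite (u1.1 b wb).
  + apply: (unch_trans us).
    have u1' : unch (For x b body) s' s1.
      apply: unch_sub u1 => a /=.
        by move=> /negbT /norP[_ /norP[/negbTE]].
      by move=> /negbT /norP[/negbTE].
    apply: (unch_trans u1'); split=> // a /= ha; apply: boolp.funext => j.
    rewrite /set_cell; move: ha; case: (a == x) => //=.
Qed.

End ForLogic.

(** * Calling a program as a subroutine on relocated arrays *)

Fixpoint shift_i (e : iexp) : iexp :=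
  match e with
  | IConst c => IConst c
  | IGet a e => IGet (40 + a) (shift_i e)
  | IAdd e1 e2 => IAdd (shift_i e1) (shift_i e2)
  | ISub e1 e2 => ISub (shift_i e1) (shift_i e2)
  end.

Fixpoint shift_r (e : rexp) : rexp :=
  match e with
  | RConst c => RConst c
  | RGet a e => RGet (40 + a) (shift_i e)
  | RAdd e1 e2 => RAdd (shift_r e1) (shift_r e2)
  | RSub e1 e2 => RSub (shift_r e1) (shift_r e2)
  | RMul e1 e2 => RMul (shift_r e1) (shift_r e2)
  | RDiv e1 e2 => RDiv (shift_r e1) (shift_r e2)
  end.

Fixpoint shift_t (b : test) : test :=
  match b with
  | TILe e1 e2 => TILe (shift_i e1) (shift_i e2)
  | TRLe e1 e2 => TRLe (shift_r e1) (shift_r e2)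
  | TNot b => TNot (shift_t b)
  | TAnd b1 b2 => TAnd (shift_t b1) (shift_t b2)
  end.

(* The same program acting on arrays 40, 41, ..., so that it can be called as
   a subroutine without clobbering arrays 0, ..., 39. *)
Fixpoint shift (c : com) : com :=
  match c with
  | Skip => Skip
  | ISet a e v => ISet (40 + a) (shift_i e) (shift_i v)
  | RSet a e v => RSet (40 + a) (shift_i e) (shift_r v)
  | Seq p q => Seq (shift p) (shift q)
  | If b p q => If (shift_t b) (shift p) (shift q)
  | While b p => While (shift_t b) (shift p)
  end.

Definition unshift (R : Type) (s : state R) : state R :=
  State (fun a => iarr s (40 + a)) (fun a => rarr s (40 + a)).

Section Shift.
Variable R : realType.
Implicit Type s : state R.

Lemma ieval_shift s e : ieval s (shift_i e) = ieval (unshift s) e.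
Proof. by elim: e => //= [a e -> |e1 -> e2 ->|e1 -> e2 ->]. Qed.

Lemma reval_shift s e : reval s (shift_r e) = reval (unshift s) e.
Proof.
by elim: e => //= [a e|e1 -> e2 ->|e1 -> e2 ->|e1 -> e2 ->|e1 -> e2 ->] //;
  rewrite ieval_shift.
Qed.

Lemma teval_shift s b : teval s (shift_t b) = teval (unshift s) b.
Proof.
elim: b => //= [e1 e2|e1 e2|b ->|b -> b' ->] //.
  by rewrite !ieval_shift.
by rewrite !reval_shift.
Qed.

Lemma icost_shift e : icost (shift_i e) = icost e.
Proof. by elim: e => //= [a e ->|e1 -> e2 ->|e1 -> e2 ->]. Qed.

Lemma rcost_shift e : rcost (shift_r e) = rcost e.
Proof.
by elim: e => //= [a e|e1 -> e2 ->|e1 -> e2 ->|e1 -> e2 ->|e1 -> e2 ->] //;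
  rewrite icost_shift.
Qed.

Lemma tcost_shift b : tcost (shift_t b) = tcost b.
Proof.
elim: b => //= [e1 e2|e1 e2|b ->|b -> b' ->] //.
  by rewrite !icost_shift.
by rewrite !rcost_shift.
Qed.

Lemma exec_shift c s t u :
  exec c (unshift s) t u -> exists2 s', exec (shift c) s t s' & unshift s' = u.
Proof.
move e0: (unshift s) => s0 ex.
move: s e0; elim: ex => {c s0 t u} /=.
- by move=> _ s <-; exists s => //; constructor.
- move=> a e v _ s <-.
  exists (iset s (40 + a) (ieval (unshift s) e) (ieval (unshift s) v)) => //.
  by rewrite -(icost_shift e) -(icost_shift v) -!ieval_shift; constructor.
- move=> a e v _ s <-.
  exists (rset s (40 + a) (ieval (unshift s) e) (reval (unshift s) v)) => //.
  by rewrite -(icost_shift e) -(rcost_shift v) -ieval_shift -reval_shift; constructor.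
- move=> p q u0 t1 s1 t2 s2 _ IH1 _ IH2 s /IH1[s1' e1 /IH2[s2' e2 <-]].
  by exists s2' => //; exact: ExecSeq e1 e2.
- move=> b p q u0 t s1 tb _ IH s es; subst; have [s1' e1 <-] := IH _ erefl.
  exists s1' => //; rewrite -tcost_shift; apply: ExecIfTrue => //.
  by rewrite teval_shift.
- move=> b p q u0 t s1 tb _ IH s es; subst; have [s1' e1 <-] := IH _ erefl.
  exists s1' => //; rewrite -tcost_shift; apply: ExecIfFalse => //.
  by rewrite teval_shift.
- move=> b p u0 tb s es; subst; exists s => //.
  by rewrite -tcost_shift; apply: ExecWhileFalse; rewrite teval_shift.
- move=> b p u0 t1 s1 t2 s2 tb _ IH1 _ IH2 s es; subst.
  have [s1' e1 /IH2[s2' e2 <-]] := IH1 _ erefl.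
  exists s2' => //; rewrite -tcost_shift; apply: ExecWhileTrue e1 e2.
  by rewrite teval_shift.
Qed.

Lemma wri_shift c a : a < 40 -> wri (shift c) a = false.
Proof.
move=> a40; elim: c => //= [b _ _|p -> q ->|b p -> q ->] //.
by apply/negbTE; rewrite neq_ltn (leq_trans a40) // leq_addr.
Qed.

Lemma wrr_shift c a : a < 40 -> wrr (shift c) a = false.
Proof.
move=> a40; elim: c => //= [b _ _|p -> q ->|b p -> q ->] //.
by apply/negbTE; rewrite neq_ltn (leq_trans a40) // leq_addr.
Qed.

End Shift.

(** * Enumeration of tuples *)

(** Tuples are numerals in base [n]. The machine has no division, so this formula is only a
    specification; the program maintains the digits with an odometer. *)
Definition digit (n tau j : nat) : nat := (tau %/ n ^ j) %% n.

Lemma ltn_digit n tau j : 0 < n -> digit n tau j < n.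
Proof. exact: ltn_pmod. Qed.

(** A carry reaches position [j] exactly when [n ^ j] divides the successor; this divisibility is
    what the carry flag of the odometer stores. *)
Lemma digit_succ n tau j : 0 < n ->
  digit n tau.+1 j =
    if n ^ j %| tau.+1 then
      (if (digit n tau j).+1 < n then (digit n tau j).+1 else 0)
    else digit n tau j.
Proof.
move=> n0; rewrite /digit divnS ?expn_gt0 ?n0 //.
case: (n ^ j %| tau.+1) => //=; rewrite add1n.
set q := tau %/ _; have lt := ltn_pmod q n0; rewrite -addn1 -modnDml addn1.
case: ltnP => h; first by rewrite modn_small.
by have -> : (q %% n).+1 = n; [by apply/eqP; rewrite eqn_leq lt h|rewrite modnn].
Qed.

Lemma dvdn_expS_succ n tau j : 0 < n ->
  (n ^ j.+1 %| tau.+1) = (n ^ j %| tau.+1) && ((digit n tau j).+1 == n).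
Proof.
move=> n0; rewrite /digit; have nj0 : 0 < n ^ j by rewrite expn_gt0 n0.
case: (boolP (n ^ j %| tau.+1)) => [dv|ndv] /=; last first.
  by apply/negbTE; apply: contra ndv; apply: dvdn_trans; exact: dvdn_exp2l.
have e : tau.+1 %/ n ^ j = (tau %/ n ^ j).+1 by rewrite divnS // dv.
rewrite -{1}(divnK dv) e expnS dvdn_pmul2r //.
set q := tau %/ _; have lt := ltn_pmod q n0.
rewrite /dvdn -addn1 -modnDml addn1.
apply/eqP/eqP => h; last by rewrite h modnn.
by case: (ltngtP (q %% n).+1 n) lt => // lt2 _; rewrite modn_small in h.
Qed.

Lemma digit_surj n L (t : nat -> nat) : (forall j, j < L -> t j < n) ->
  exists2 tau, tau < n ^ L & forall j, j < L -> digit n tau j = t j.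
Proof.
elim: L => [|L IH] tn; first by exists 0.
have [|tau ltau dtau] := IH; first by move=> j jL; apply: tn; lia.
have tL := tn L (ltnSn L).
have n0 : 0 < n by lia.
have nL0 : 0 < n ^ L by rewrite expn_gt0 n0.
exists (t L * n ^ L + tau).
  rewrite expnS; apply: (@leq_trans ((t L).+1 * n ^ L)); last by rewrite leq_mul2r tL orbT.
  by rewrite mulSn addnC ltn_add2r.
move=> j; rewrite ltnS leq_eqVlt => /orP[/eqP ->|jL]; rewrite /digit.
  by rewrite divnMDl // divn_small // addn0 modn_small.
have -> : n ^ L = n ^ (L - j.+1) * n * n ^ j.
  by rewrite -expnSr -expnD; congr expn; lia.
rewrite mulnA divnMDl ?expn_gt0 ?n0 // mulnA modnMDl.
exact: dtau.
Qed.

Ltac cells := rewrite /= /set_cell /=.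

Section ForRun.
Variable R : realType.

Definition forcost (body : com) : nat := maxcost body + 40.

Lemma wp_for_run x b body (N : nat) (I : nat -> state R -> Prop) s :
  [&& loopfree body, x != b, ~~ wri body x & ~~ wri body b] ->
  iarr s b 0 = N ->
  I 0 (iset s x 0 0) ->
  (forall i s', i < N -> unch (For x b body) s s' -> iarr s' x 0 = i ->
     I i s' -> I i.+1 (iset (run body s') x 0 i.+1)) ->
  wp (For x b body) (forcost body * N.+1) (I N) s.
Proof.
move=> /andP[lf w] sb I0 IS.
apply: (@wp_le _ _ _ (N * (maxcost body + 20) + 20)).
  by rewrite /forcost; nia.
apply: wp_for => // i s' iN u e Ii; apply: wp_run => //; exact: IS.
Qed.

End ForRun.

(* Array 10 holds the digits, in base [n], of the current tuple; their number
   is in variable 12. *)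
Definition odo_body : com :=
  If (TILe (IConst 1) (var 11))
     (If (tlt (IAdd (IGet 10 (var 3)) (IConst 1)) (var 0))
         (Seq (ISet 10 (var 3) (IAdd (IGet 10 (var 3)) (IConst 1)))
              (asg 11 (IConst 0)))
         (ISet 10 (var 3) (IConst 0)))
     Skip.
Definition odo : com := Seq (asg 11 (IConst 1)) (For 3 12 odo_body).

(** Integers cannot be multiplied, so each factor [n] of the number of tuples costs [n]
    additions. *)
Definition pow_body : com :=
  Seq (asg 17 (IConst 0))
  (Seq (For 2 0 (asg 17 (IAdd (var 17) (var 8)))) (asg 8 (var 17))).
Definition pow : com := Seq (asg 8 (IConst 1)) (For 3 12 pow_body).

Definition zero_digits : com := For 3 12 (ISet 10 (var 3) (IConst 0)).

Definition enum_tuples (body : com) : com :=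
  Seq pow (Seq zero_digits (For 9 8 (Seq body odo))).

Section Enum.
Variable R : realType.
Implicit Type s : state R.

Lemma wp_odo n L tau s : 0 < n -> iarr s 0 0 = n -> iarr s 12 0 = L ->
  (forall j, j < L -> iarr s 10 j = digit n tau j) ->
  wp odo ((forcost odo_body).+4 * L.+1)
    (fun s' => forall j, j < L -> iarr s' 10 j = digit n tau.+1 j) s.
Proof.
move=> n0 sn sL sd.
apply: (@wp_le _ _ _ (maxcost (asg 11 (IConst 1)) + forcost odo_body * L.+1).+1).
  by rewrite /=; lia.
apply: wp_seq; apply: wp_run => //.
pose I i (s' : state R) := [/\ forall j, j < i -> iarr s' 10 j = digit n tau.+1 j,
  forall j, i <= j < L -> iarr s' 10 j = digit n tau j &
  iarr s' 11 0 = (n ^ i %| tau.+1)].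
apply: (@wp_frame _ _ _ _ (I L)); last by move=> s' _ [].
apply: wp_for_run => //.
  by split=> [//|j /andP[_ jL]|]; [rewrite -sd|rewrite expn0 dvd1n].
move=> i s' iL [u _] si [I1 I2 I3]; have sn' : iarr s' 0 0 = n by rewrite u.
rewrite /odo_body /= si I3 sn' (I2 i) ?leqnn //.
have -> : (0 < (n ^ i %| tau.+1)) = (n ^ i %| tau.+1) by case: (_ %| _).
have dS := digit_succ tau i n0; have pS := dvdn_expS_succ tau i n0.
case: (boolP (n ^ i %| tau.+1)) dS pS => dv dS pS; last first.
  rewrite /I; cells; split.
  - move=> j; rewrite ltnS leq_eqVlt => /orP[/eqP ->|/I1 //]. by rewrite I2 ?leqnn // dS.
  - by move=> j /andP[ij jL]; apply: I2; rewrite jL ltnW.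
  - by rewrite I3 pS (negbTE dv).
rewrite -ltnNge addn1.
have ld := ltn_digit tau i n0.
case: ltnP dS pS => h dS pS; rewrite /I; cells; rewrite ?si; split.
- move=> j; rewrite ltnS leq_eqVlt => /orP[/eqP ->|ji]; first by rewrite eqxx dS.
  by rewrite ltn_eqF // I1.
- by move=> j /andP[ij jL]; rewrite gtn_eqF // I2 // jL ltnW.
- by rewrite pS ltn_eqF.
- move=> j; rewrite ltnS leq_eqVlt => /orP[/eqP ->|ji]; first by rewrite eqxx dS.
  by rewrite ltn_eqF // I1.
- by move=> j /andP[ij jL]; rewrite gtn_eqF // I2 // jL ltnW.
- rewrite I3 dv pS; have -> : (digit n tau i).+1 = n; [by apply/eqP; rewrite eqn_leq ld h|by rewrite eqxx].
Qed.

Lemma wp_pow n L s : 0 < n -> iarr s 0 0 = n -> iarr s 12 0 = L ->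
  wp pow ((forcost (asg 17 (IAdd (var 17) (var 8))) + 100) * (n.+1 * L.+1))
    (fun s' => iarr s' 8 0 = n ^ L) s.
Proof.
move=> n0 sn sL; set c := forcost _.
apply: (@wp_le _ _ _ (maxcost (asg 8 (IConst 1)) +
    (L * ((maxcost (asg 17 (IConst 0)) + (c * n.+1 + maxcost (asg 8 (var 17))).+1).+1
      + 20) + 20)).+1).
  by rewrite /=; nia.
apply: wp_seq; apply: wp_run => //.
apply: (@wp_for _ _ _ _ _ _ (fun i s' => iarr s' 8 0 = n ^ i)) => //.
move=> i s' iL [u _] si I1; have sn' : iarr s' 0 0 = n by rewrite u.
apply: wp_seq; apply: wp_run => //.
apply: (@wp_bind _ _ _ _ _ (fun s'' => iarr s'' 17 0 = n * n ^ i)).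
  apply: (@wp_for_run _ _ _ _ _ (fun j s'' => iarr s'' 17 0 = j * n ^ i)) => //.
  move=> j s'' jn [u' _] sj I2; cells; rewrite I2 (u' 8) // [iarr _ 8 0]I1; lia.
move=> s'' [u' _] I2; apply: wp_run => //; cells.
by rewrite I2 expnS.
Qed.

Lemma wp_zero_digits n L s : 0 < n -> iarr s 12 0 = L ->
  wp zero_digits (forcost (ISet 10 (var 3) (IConst 0)) * L.+1)
    (fun s' => forall j, j < L -> iarr s' 10 j = digit n 0 j) s.
Proof.
move=> n0 sL.
apply: (@wp_for_run _ _ _ _ _ (fun i s' => forall j, j < i -> iarr s' 10 j = digit n 0 j)) => //.
move=> i s' iL u si I1 j; rewrite ltnS leq_eqVlt /digit div0n mod0n; cells.
by rewrite si; case: (j == i) => //= /I1 ->; rewrite /digit div0n mod0n.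
Qed.

Definition enum_vars : seq nat := [:: 2; 3; 8; 9; 10; 11; 17].

Definition enum_cost : nat :=
  (forcost odo_body).+4 + forcost (ISet 10 (var 3) (IConst 0)) +
  forcost (asg 17 (IAdd (var 17) (var 8))) + 200.

(** [J] has to be insensitive to the arrays in [enum_vars], because the odometer and the counter
    rewrite them between two executions of [body]. *)
Lemma wp_enum body n L T (J : nat -> state R -> Prop) s :
  0 < n -> iarr s 0 0 = n -> iarr s 12 0 = L ->
  [&& ~~ wri body 0, ~~ wri body 8, ~~ wri body 9, ~~ wri body 10
    & ~~ wri body 12] ->
  (forall tau s1 s2, (forall a, a \notin enum_vars -> iarr s2 a = iarr s1 a) ->
     rarr s2 = rarr s1 -> J tau s1 -> J tau s2) ->
  J 0 s ->
  (forall tau s', tau < n ^ L -> unch (enum_tuples body) s s' ->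
     (forall j, j < L -> iarr s' 10 j = digit n tau j) -> J tau s' ->
     wp body T (J tau.+1) s') ->
  wp (enum_tuples body) (n ^ L * (T + enum_cost * L.+1) + enum_cost * (n.+1 * L.+1))
    (J (n ^ L)) s.
Proof.
move=> n0 sn sL /and5P[/negbTE w0 /negbTE w8 /negbTE w9 /negbTE w10 /negbTE w12] Jst J0 Jbody.
set c1 := (forcost odo_body).+4; set c2 := forcost (ISet 10 (var 3) (IConst 0)).
set c3 := forcost (asg 17 (IAdd (var 17) (var 8))).
apply: (@wp_le _ _ _ ((c3 + 100) * (n.+1 * L.+1) + (c2 * L.+1 +
   (n ^ L * ((T + c1 * L.+1).+1 + 20) + 20)).+1).+1).
  rewrite /enum_cost -/c1 -/c2 -/c3; move: (n ^ L) => N; nia.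
have rodo a : wrr odo a = false by [].
apply: (wp_bind (wp_pow n0 sn sL)) => s1 [u1 v1] e8.
have J1 : J 0 s1.
  apply: Jst J0 => [a|]; last by apply: boolp.funext => a; rewrite v1.
  by rewrite !inE !negb_or => /and5P[h2 h3 h8 h9 /and3P[h10 h11 h17]];
    rewrite u1 //= ?(negbTE h2) ?(negbTE h3) ?(negbTE h8) ?(negbTE h17).
apply: (wp_bind (wp_zero_digits n0 _)); first by rewrite u1.
move=> s2 [u2 v2] d2.
have J2 : J 0 s2.
  apply: Jst J1 => [a|]; last by apply: boolp.funext => a; rewrite v2.
  by rewrite !inE !negb_or => /and5P[h2 h3 h8 h9 /and3P[h10 h11 h17]];
    rewrite u2 //= ?(negbTE h3) ?(negbTE h10).
pose I i (s' : state R) := J i s' /\ forall j, j < L -> iarr s' 10 j = digit n i j.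
have stepI i s' : I i s' -> I i (iset s' 9 0 i).
  move=> [h1 h2]; split=> //; apply: Jst h1 => // a.
  rewrite !inE !negb_or => /and5P[_ _ _ h9 _]; apply: boolp.funext => j; cells.
  by rewrite (negbTE h9).
apply: (@wp_frame _ _ _ _ (I (n ^ L))); last by move=> s' _ [].
apply: wp_for => //=.
- by rewrite w8 w9.
- by rewrite u2 // e8.
- exact: stepI.
move=> i s' iN u si [Ji di].
have [ui ur] := u.
have s2n a : a \in [:: 0; 12] -> iarr s' a = iarr s a.
  by rewrite !inE => /orP[]/eqP ->; rewrite ui ?u2 ?u1 //= ?w0 ?w12.
apply: (@wp_bind _ _ _ _ _ (J i.+1)).
  apply: Jbody => //; split=> a /= /negbT; last first.
    rewrite !orbF => /negbTE h.
    by rewrite ur ?v2 ?v1 //= h.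
  by rewrite !negb_or -!andbA => h; rewrite ui ?u2 ?u1 //=; move: h;
    case: (wri body a) => //; do ?[case: (a == _) => //].
move=> s3 [u3 v3] J3.
apply: (@wp_frame _ _ _ _ (fun s' => forall j, j < L -> iarr s' 10 j = digit n i.+1 j)).
  apply: wp_odo => //; first by rewrite u3 // s2n.
    by rewrite u3 // s2n.
  by move=> j jL; rewrite u3 // di.
move=> s4 [u4 v4] d4; apply: stepI; split=> //.
apply: Jst J3 => [a|]; last by apply: boolp.funext => a; rewrite v4.
by rewrite !inE !negb_or => /and5P[h2 h3 h8 h9 /and3P[h10 h11 h17]];
  rewrite u4 //= ?(negbTE h3) ?(negbTE h10) ?(negbTE h11).
Qed.

End Enum.

(** * Geometry of segments and strips *)

Section Vectors.
Local Open Scope ring_scope.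
Variable R : realType.

Definition vec := (R * R * R)%type.
Implicit Types a b c u v w N : vec.

Definition dot a b : R := a.1.1 * b.1.1 + a.1.2 * b.1.2 + a.2 * b.2.
Definition vadd a b : vec := (a.1.1 + b.1.1, a.1.2 + b.1.2, a.2 + b.2).
Definition vsub a b : vec := (a.1.1 - b.1.1, a.1.2 - b.1.2, a.2 - b.2).
Definition vscale (s : R) a : vec := (s * a.1.1, s * a.1.2, s * a.2).
Definition cross a b : vec :=
  (a.1.2 * b.2 - a.2 * b.1.2, a.2 * b.1.1 - a.1.1 * b.2,
   a.1.1 * b.1.2 - a.1.2 * b.1.1).
Definition vzero : vec := (0, 0, 0).

Lemma vecP a b : a.1.1 = b.1.1 -> a.1.2 = b.1.2 -> a.2 = b.2 -> a = b.
Proof. by case: a b => [[a1 a2] a3] [[b1 b2] b3] /= -> -> ->. Qed.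

Lemma dot_ge0 a : 0 <= dot a a.
Proof. by rewrite /dot -!expr2 !addr_ge0 ?sqr_ge0. Qed.

Lemma dot_le0 a : (dot a a <= 0) = (a == vzero).
Proof.
apply/idP/eqP => [|->]; last by rewrite /dot /= !mulr0 !addr0.
case: a => [[x y] z]; rewrite /dot /= => h.
by congr (_, _, _); apply/eqP; rewrite -sqrf_eq0; apply/eqP; nra.
Qed.

Lemma dotC a b : dot a b = dot b a.
Proof. rewrite /dot; ring. Qed.

Lemma dot0v a : dot vzero a = 0.
Proof. rewrite /dot /=; ring. Qed.

Lemma dotv0 a : dot a vzero = 0.
Proof. rewrite /dot /=; ring. Qed.

Lemma dot_vscalel s a b : dot (vscale s a) b = s * dot a b.
Proof. rewrite /dot /=; ring. Qed.

Lemma dot_vscaler s a b : dot a (vscale s b) = s * dot a b.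
Proof. rewrite /dot /=; ring. Qed.

Lemma crossv0 a : cross a vzero = vzero.
Proof. by apply: vecP => /=; ring. Qed.

Lemma vsubK a b : vadd b (vsub a b) = a.
Proof. by apply: vecP => /=; ring. Qed.

Lemma vsub_eq0 a b : (vsub a b == vzero) = (a == b).
Proof.
apply/eqP/eqP => [h|->]; last by apply: vecP => /=; ring.
by rewrite -(vsubK a b) h; apply: vecP => /=; ring.
Qed.

Lemma dot_cross_r a b : dot (cross a b) b = 0.
Proof. rewrite /dot /=; ring. Qed.

(** Coordinatewise this is the triple product identity [(a.a) b - (a.b) a = - a x (a x b)]. *)
Lemma cross_eq0_parallel a b : a != vzero -> cross a b = vzero ->
  b = vscale (dot a b / dot a a) a.
Proof.
rewrite -dot_le0 -ltNge => a0 [h1 h2 h3].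
have an0 : dot a a != 0 by rewrite gt_eqF.
have aux (s t : R) : s * dot a a = t * dot a b -> s = dot a b / dot a a * t.
  by move=> e; apply: (mulIf an0); rewrite e; field.
apply: vecP => /=; apply: aux; apply/eqP; rewrite -subr_eq0; apply/eqP.
- rewrite (_ : _ - _ = a.2 * (a.2 * b.1.1 - a.1.1 * b.2)
    - a.1.2 * (a.1.1 * b.1.2 - a.1.2 * b.1.1)); last by rewrite /dot; ring.
  by rewrite h2 h3 !mulr0 subr0.
- rewrite (_ : _ - _ = a.1.1 * (a.1.1 * b.1.2 - a.1.2 * b.1.1)
    - a.2 * (a.1.2 * b.2 - a.2 * b.1.2)); last by rewrite /dot; ring.
  by rewrite h1 h3 !mulr0 subr0.
- rewrite (_ : _ - _ = a.1.2 * (a.1.2 * b.2 - a.2 * b.1.2)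
    - a.1.1 * (a.2 * b.1.1 - a.1.1 * b.2)); last by rewrite /dot; ring.
  by rewrite h1 h2 !mulr0 subr0.
Qed.

Lemma cross_crossE a b c :
  cross a (cross b c) = vsub (vscale (dot a c) b) (vscale (dot a b) c).
Proof. by apply: vecP; rewrite /dot /=; ring. Qed.

Lemma vscale0 a : vscale 0 a = vzero.
Proof. by apply: vecP => /=; ring. Qed.

Lemma vsub0 : vsub vzero vzero = vzero.
Proof. by apply: vecP => /=; ring. Qed.

Lemma cross_parallel_normal a b v : v != vzero -> dot a v = 0 -> dot b v = 0 ->
  exists s, cross a b = vscale s v.
Proof.
move=> v0 av bv; exists (dot v (cross a b) / dot v v).
apply: cross_eq0_parallel => //.
by rewrite cross_crossE (dotC v a) (dotC v b) av bv !vscale0 vsub0.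
Qed.

(** Lagrange's identity, applied to [v] and [a - b]: it splits a distance into a horizontal and a
    vertical part, both scaled by the length of [v]. *)
Lemma dist_cross_dot v a b :
  dot v v * dot (vsub a b) (vsub a b) =
  dot (vsub (cross v a) (cross v b)) (vsub (cross v a) (cross v b)) +
  (dot v a - dot v b) ^+ 2.
Proof. rewrite /dot /=; ring. Qed.

(** Both [v] and [x - a] are orthogonal to [N], so their cross product is parallel to [N]. The line
    has direction [N] because [cross v] also rotates horizontal vectors by a quarter turn. *)
Lemma plane_projection_line N v a x : N != vzero -> dot N v = 0 ->
  dot N (vsub x a) = 0 ->
  exists s, cross v x = vadd (cross v a) (vscale s N).
Proof.
move=> N0 Nv Nx.
exists (dot N (cross v (vsub x a)) / dot N N).
rewrite -(cross_eq0_parallel N0); first by apply: vecP => /=; ring.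
by rewrite cross_crossE Nv Nx !vscale0 vsub0.
Qed.

Lemma line_projection_line v a b x : b != a ->
  cross (vsub x a) (vsub b a) = vzero ->
  exists s, cross v x = vadd (cross v a) (vscale s (cross v (vsub b a))).
Proof.
rewrite -vsub_eq0 => ba h.
have h' : cross (vsub b a) (vsub x a) = vzero.
  by move: h => [h1 h2 h3]; apply: vecP => /=; lra.
exists (dot (vsub b a) (vsub x a) / dot (vsub b a) (vsub b a)).
rewrite -{1}(vsubK x a) {1}(cross_eq0_parallel ba h').
set s := _ / _; by apply: vecP => /=; ring.
Qed.

End Vectors.

Section Segments.
Local Open Scope ring_scope.
Variables (R : realType) (x : nat -> vec R) (rho : nat -> R) (v : vec R).
Implicit Types p q i j : nat.

Let X i := cross v (x i).
Let z i := dot v (x i).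

Definition adj i j : bool :=
  dot (vsub (x i) (x j)) (vsub (x i) (x j)) <= (rho i + rho j) ^+ 2.

Lemma adj_refl i : adj i i.
Proof.
rewrite /adj (_ : dot _ _ = 0) ?sqr_ge0 // /dot /=; ring.
Qed.

Lemma adj_sym i j : adj i j = adj j i.
Proof. by rewrite /adj; congr (_ <= _); rewrite /dot /=; ring. Qed.

(** For [Y = P + l (Q - P)] the second conjunct says that [l (1 - l) |Q - P|^2] is nonnegative; for
    [P = Q] it forces [Y = P]. Both conjuncts are polynomial tests that a program can evaluate. *)
Definition on_segment (P Q Y : vec R) : bool :=
  (dot (cross (vsub Y P) (vsub Q P)) (cross (vsub Y P) (vsub Q P)) <= 0) &&
  (0 <= dot (vsub Y P) (vsub Q Y)).

(* [0] when [P = Q], by the convention [a / 0 = 0]. *)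
Definition ratio (P Q Y : vec R) : R :=
  dot (vsub Y P) (vsub Q P) / dot (vsub Q P) (vsub Q P).

(** The radii are compared by [<=], which is what the distance estimate uses; for the members of a
    clique class they are equal. *)
Definition in_strip p q i : bool :=
  [&& rho p <= rho i, rho q <= rho i & on_segment (X p) (X q) (X i)].

(** The height of [x i] is compared with that of the segment at the same projection. If [p] and [q]
    have the same projection, the ratio is 0 and the reference height is that of [p]. *)
Definition above p q i : bool :=
  0 <= z i - z p - ratio (X p) (X q) (X i) * (z q - z p).

Lemma on_segment_ratio (P Q Y : vec R) : on_segment P Q Y ->
  0 <= ratio P Q Y <= 1 /\ Y = vadd P (vscale (ratio P Q Y) (vsub Q P)).
Proof.
rewrite /on_segment /ratio dot_le0 => /andP[/eqP cr dt].
have [D0|D0] := eqVneq (vsub Q P) (vzero R).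
  rewrite D0 dotv0 mul0r lexx ler01; split=> //.
  have : vsub Y P == vzero R.
    rewrite -dot_le0; move: D0 dt => [d1 d2 d3]; rewrite /dot /=; nra.
  by rewrite vsub_eq0 => /eqP ->; apply: vecP => /=; ring.
have cr' : cross (vsub Q P) (vsub Y P) = vzero R.
  by move: cr => [h1 h2 h3]; apply: vecP => /=; lra.
have eY := cross_eq0_parallel D0 cr'.
rewrite (dotC (vsub Y P)); set l := _ / _ in eY *.
have DD : 0 < dot (vsub Q P) (vsub Q P) by rewrite ltNge dot_le0.
split; last by rewrite -eY vsubK.
have e : dot (vsub Y P) (vsub Q Y) = (l - l ^+ 2) * dot (vsub Q P) (vsub Q P).
  have -> : vsub Q Y = vsub (vsub Q P) (vsub Y P) by apply: vecP => /=; ring.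
  rewrite eY /dot /=; ring.
move: dt; rewrite e pmulr_lge0 // => dt.
by apply/andP; split; nra.
Qed.

(* Four coordinates: a center [y] is described by [(cross v y, dot v y)]. *)
Lemma dist_segment (l a1 a2 a3 a4 b1 b2 b3 b4 y1 y2 y3 y4 D : R) : 0 <= l <= 1 ->
  (y1 - a1) ^+ 2 + (y2 - a2) ^+ 2 + (y3 - a3) ^+ 2 + (y4 - a4) ^+ 2 <= D ->
  (y1 - b1) ^+ 2 + (y2 - b2) ^+ 2 + (y3 - b3) ^+ 2 + (y4 - b4) ^+ 2 <= D ->
  (y1 - (a1 + l * (b1 - a1))) ^+ 2 + (y2 - (a2 + l * (b2 - a2))) ^+ 2 +
  (y3 - (a3 + l * (b3 - a3))) ^+ 2 + (y4 - (a4 + l * (b4 - a4))) ^+ 2 <= D.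
Proof.
move=> /andP[l0 l1] hA hB.
pose S := (b1 - a1) ^+ 2 + (b2 - a2) ^+ 2 + (b3 - a3) ^+ 2 + (b4 - a4) ^+ 2.
have S0 : 0 <= S by rewrite /S !addr_ge0 ?sqr_ge0.
have h := mulr_ge0 (mulr_ge0 l0 (_ : 0 <= 1 - l)) S0.
have {}h := h ltac:(lra).
have hA' := ler_wpM2l (_ : 0 <= 1 - l) hA.
have {}hA' := hA' ltac:(lra).
have hB' := ler_wpM2l l0 hB.
rewrite /S in h; nra.
Qed.

(** The point of the segment over the projection of [x i] is a convex combination of the two ends,
    and squared distance to a fixed point is convex. *)
Lemma strip_shadow p q i (Y : vec R) (h D : R) : v != vzero R ->
  on_segment (X p) (X q) (X i) ->
  dot (vsub Y (X p)) (vsub Y (X p)) + (h - z p) ^+ 2 <= D ->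
  dot (vsub Y (X q)) (vsub Y (X q)) + (h - z q) ^+ 2 <= D ->
  dot (vsub Y (X i)) (vsub Y (X i)) +
    (h - (z p + ratio (X p) (X q) (X i) * (z q - z p))) ^+ 2 <= D.
Proof.
move=> v0 /on_segment_ratio[l01 eX]; set l := ratio _ _ _ in l01 eX *.
rewrite eX; move: (X p) (X q) (z p) (z q) => P Q zp zq.
rewrite /dot /= -!expr2 => hP hQ; exact: dist_segment.
Qed.

(** The two strips may come from different planes and radii, so each ball is compared with the ends
    of the other ball's segment. Those ends are no larger than the ball over them, hence all four
    distances obey the one bound [rho i + rho j]. *)
Lemma same_side_adj p q i p' q' j : v != vzero R ->
  0 <= rho i -> 0 <= rho j ->
  0 <= rho p -> 0 <= rho q -> 0 <= rho p' -> 0 <= rho q' ->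
  in_strip p q i -> in_strip p' q' j -> above p q i = above p' q' j ->
  adj i p' -> adj i q' -> adj j p -> adj j q -> adj i j.
Proof.
move=> v0 ri0 rj0 rp0 rq0 rp0' rq0' /and3P[rp rq si] /and3P[rp' rq' sj] ab
  aip aiq ajp ajq.
have vv : 0 < dot v v by rewrite ltNge dot_le0.
pose D := dot v v * (rho i + rho j) ^+ 2.
have bound a b : rho a + rho b <= rho i + rho j -> 0 <= rho a -> 0 <= rho b -> adj a b ->
    dot (vsub (X a) (X b)) (vsub (X a) (X b)) + (z a - z b) ^+ 2 <= D.
  move=> h ra rb hab; rewrite -dist_cross_dot /D ler_pM2l //.
  by apply: (le_trans hab); rewrite ler_sqr ?nnegrE ?addr_ge0.
have hi := strip_shadow v0 si (bound j p _ _ _ ajp) (bound j q _ _ _ ajq).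
have {}hi := hi ltac:(lra) rj0 rp0 ltac:(lra) rj0 rq0.
have hj := strip_shadow v0 sj (bound i p' _ _ _ aip) (bound i q' _ _ _ aiq).
have {}hj := hj ltac:(lra) ri0 rp0' ltac:(lra) ri0 rq0'.
rewrite /adj -(ler_pM2l vv) dist_cross_dot -/(X i) -/(X j) -/(z i) -/(z j) -/D.
have eXX : dot (vsub (X j) (X i)) (vsub (X j) (X i)) =
    dot (vsub (X i) (X j)) (vsub (X i) (X j)) by rewrite /dot /=; ring.
move: hi hj ab; rewrite eXX /above.
set s := z p + _; set s' := z p' + _; set E := dot _ _ => hi hj.
have -> : z i - z p - ratio (X p) (X q) (X i) * (z q - z p) = z i - s by rewrite /s; ring.
have -> : z j - z p' - ratio (X p') (X q') (X j) * (z q' - z p') = z j - s'.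
  by rewrite /s'; ring.
clear bound; clearbody D s s'; move: hi hj; move: E (z i) (z j) => E a b hi hj.
(* When both balls are above, replacing the smaller of the heights [a], [b] by the height of its own
   segment can only widen the gap; when both are below, the same holds for the larger one. *)
case: (lerP 0 (a - s)) => h1; case: (lerP 0 (b - s')) => h2 // _;
  case: (lerP a b) => h3; nra.
Qed.

Lemma in_strip_of_param (B d : vec R) (s : nat -> R) p q i :
  (forall j, j \in [:: p; q; i] -> X j = vadd B (vscale (s j) d)) ->
  rho p = rho i -> rho q = rho i -> s p <= s i <= s q -> in_strip p q i.
Proof.
move=> h rp rq /andP[s1 s2]; rewrite /in_strip rp rq lexx /=.
rewrite (h p) ?(h q) ?(h i) ?inE ?eqxx ?orbT // /on_segment; apply/andP; split.
  by rewrite dot_le0; apply/eqP; apply: vecP => /=; ring.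
rewrite (_ : dot _ _ = (s i - s p) * (s q - s i) * dot d d).
  by rewrite !mulr_ge0 ?dot_ge0 ?subr_ge0.
rewrite /dot /=; ring.
Qed.

End Segments.

(** * Greedy covers by planes with a common direction *)

(** The largest index failing [C], which is what an ascending loop with overwriting leaves behind.
    The default 0 is unambiguous: a returned index that satisfies [C] means that every index below
    [n] does. *)
Fixpoint last_uncovered (C : nat -> bool) (n : nat) : nat :=
  if n is m.+1 then (if C m then last_uncovered C m else m) else 0.

Lemma last_uncovered_lt C n : 0 < n -> last_uncovered C n < n.
Proof.
elim: n => // n IH _ /=; case: (C n) => //; case: n IH => // n IH.
exact: leqW (IH isT).
Qed.

Lemma last_uncoveredP C n : C (last_uncovered C n) -> forall i, i < n -> C i.
Proof.
elim: n => //= n IH; case: (boolP (C n)) => [Cn /IH h i|/negP //].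
by rewrite ltnS leq_eqVlt => /orP[/eqP ->|/h].
Qed.

Section Directions.
Local Open Scope ring_scope.
Variables (R : realType) (x : nat -> vec R) (n : nat).
Local Notation zero := (vzero R).
Implicit Types (a b c i : nat) (t : nat -> nat).

Definition tri_normal a b c : vec R := cross (vsub (x b) (x a)) (vsub (x c) (x a)).

(* [i] lies on the plane through [a] with normal [N]; when [N = 0], on the line
   [ab], or at [a] if [a] and [b] coincide. *)
Definition on_flat a b (N : vec R) i : bool :=
  let u := vsub (x i) (x a) in
  let w := vsub (x b) (x a) in
  if dot N N <= 0 then
    if dot w w <= 0 then dot u u <= 0 else dot (cross u w) (cross u w) <= 0
  else dot N u * dot N u <= 0.

(* [gA] is the first nonzero normal met so far, and [gW] the first nonzero
   cross product of [gA] with a normal: the only possible common direction. *)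
Record greedy := Greedy {
  covered : nat -> bool; gA : vec R; gW : vec R; gok : bool }.

Definition greedy0 := Greedy (fun=> false) zero zero true.

Definition pivot (g : greedy) : nat := last_uncovered (covered g) n.

Definition greedy_step b c (g : greedy) : greedy :=
  let a := pivot g in
  let N := tri_normal a b c in
  let A := gA g in
  let W := gW g in
  Greedy (fun i => covered g i || on_flat a b N i)
    (if dot A A <= 0 then N else A)
    (if dot A A <= 0 then W else if dot W W <= 0 then cross A N else W)
    (if dot A A <= 0 then gok g else if dot W W <= 0 then gok g
     else gok g && (dot W N * dot W N <= 0)).

Fixpoint greedy_run t l : greedy :=
  if l is m.+1 then greedy_step (t (m + m)%N) (t (m + m).+1) (greedy_run t m)
  else greedy0.

(** If all normals are parallel, any vector orthogonal to them is a common direction; this one is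
    nonzero even for [A = 0]. The form [0 - y] mirrors the program, whose expressions have no
    negation. *)
Definition perp (A : vec R) : vec R :=
  if A.1.2 * A.1.2 + A.2 * A.2 <= 0 then (0, 0, 1) else (0, A.2, 0 - A.1.2).

Definition direction (g : greedy) : vec R :=
  if dot (gW g) (gW g) <= 0 then perp (gA g) else gW g.

Definition accepting (g : greedy) : Prop :=
  gok g /\ forall i, (i < n)%N -> covered g i.

(** All that the clique search retains of the planes. The function [s] records positions along a
    line, and [d] may vanish, in which case the line is a point. *)
Definition on_lines (v : vec R) (m : nat) : Prop :=
  exists lab : nat -> nat, (forall i, (i < n)%N -> (lab i < m)%N) /\
    forall l, (l < m)%N -> exists (B d : vec R) (s : nat -> R),
      forall i, (i < n)%N -> lab i = l -> cross v (x i) = vadd B (vscale (s i) d).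

Lemma perp_neq0 A : perp A != zero.
Proof.
rewrite /perp; case: lerP => h; apply/eqP => - [].
  by move/eqP; rewrite oner_eq0.
move=> h1 h2; move: h; rewrite h1; have -> : A.1.2 = 0 by lra.
by rewrite !mulr0 addr0 ltxx.
Qed.

Lemma dot_perp A : dot (perp A) A = 0.
Proof.
rewrite /perp; case: lerP => h; rewrite /dot /=; last by ring.
have : A.2 ^+ 2 = 0 by rewrite expr2; nra.
by move/eqP; rewrite sqrf_eq0 => /eqP ->; ring.
Qed.

Lemma direction_neq0 g : direction g != zero.
Proof.
by rewrite /direction; case: ifP => [_|/negbT]; [exact: perp_neq0|rewrite dot_le0].
Qed.

Definition normal_at t l : vec R :=
  tri_normal (pivot (greedy_run t l)) (t (l + l)%N) (t (l + l).+1).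

Lemma sqr_le0 (y : R) : (y * y <= 0) = (y == 0).
Proof. by rewrite -expr2 -sqrf_eq0 eq_le sqr_ge0 andbT. Qed.

(** As long as [gW] is zero, all normals met are multiples of [gA], hence automatically orthogonal
    to the cross product that [gW] becomes. So [gok] only has to test the normals that come after
    it. *)
Lemma greedy_invariant t l (g := greedy_run t l) :
  [/\ gA g = zero -> gW g = zero,
      gA g = zero -> forall j, (j < l)%N -> normal_at t j = zero,
      gW g = zero -> forall j, (j < l)%N -> cross (gA g) (normal_at t j) = zero &
      gW g != zero -> gok g -> forall j, (j < l)%N -> dot (gW g) (normal_at t j) = 0].
Proof.
rewrite /g {g}; elim: l => [|l] //=.
have S (P : nat -> Prop) : (forall j, (j < l)%N -> P j) -> P l -> forall j, (j < l.+1)%N -> P j.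
  by move=> h hl j; rewrite ltnS leq_eqVlt => /orP[/eqP ->|/h].
rewrite -/(normal_at t l); move: (greedy_run t l) (normal_at t) S.
move=> [C A W ok] N S /= [I1 I2 I3 I4]; rewrite !dot_le0.
have crN u : cross u u = zero by apply: vecP => /=; ring.
have [A0|A0] := eqVneq A zero.
  have W0 := I1 A0; subst A W; split=> //.
  - by move=> N0; apply: S => // j jl; exact: I2.
  - by move=> _; apply: S => // j jl; rewrite (I2 erefl j jl) crossv0.
  - by rewrite eqxx.
have [W0|W0] := eqVneq W zero.
  subst W; split=> //.
  - by move/eqP; rewrite (negbTE A0).
  - by move/eqP; rewrite (negbTE A0).
  - by move=> h; apply: S => // j jl; exact: I3.
  - move=> _ _; apply: S => [j jl|]; last by rewrite dot_cross_r.
    rewrite (cross_eq0_parallel A0 (I3 erefl j jl)); set s := _ / _.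
    by rewrite /dot /=; ring.
split=> //.
- by move/eqP; rewrite (negbTE A0).
- by move/eqP; rewrite (negbTE W0).
- move=> _ /andP[okk]; rewrite sqr_le0 => /eqP WN.
  by apply: S => // j jl; apply: I4.
Qed.

Lemma direction_orthogonal t l j : gok (greedy_run t l) -> (j < l)%N ->
  dot (normal_at t j) (direction (greedy_run t l)) = 0.
Proof.
have [I1 I2 I3 I4] := greedy_invariant t l; move=> ok jl.
rewrite /direction dot_le0 dotC; have [W0|W0] := eqVneq (gW _) zero; last exact: I4.
have [A0|A0] := eqVneq (gA (greedy_run t l)) zero; first by rewrite I2 ?dotv0.
rewrite (cross_eq0_parallel A0 (I3 W0 j jl)); set s := _ / _.
by rewrite dot_vscaler dot_perp mulr0.
Qed.

Lemma covered_run t l i : covered (greedy_run t l) i ->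
  exists2 j, (j < l)%N & on_flat (pivot (greedy_run t j)) (t (j + j)%N) (normal_at t j) i.
Proof.
elim: l => //= l IH /orP[/IH[j jl h]|h]; first by exists j => //; exact: leqW.
by exists l.
Qed.

Lemma on_flat_line a b N v : dot N v = 0 -> exists B d : vec R,
  exists s : nat -> R, forall i, on_flat a b N i -> cross v (x i) = vadd B (vscale (s i) d).
Proof.
move=> Nv; exists (cross v (x a)).
suff [d hd] : exists d, forall i, exists s, on_flat a b N i ->
    cross v (x i) = vadd (cross v (x a)) (vscale s d).
  by have [s hs] := boolp.choice hd; exists d, s.
rewrite /on_flat !dot_le0; have [N0|N0] := eqVneq N zero; last first.
  exists N => i; have [h|h] := boolp.pselect (on_flat a b N i); last first.
    by exists 0 => h'; case: h; rewrite /on_flat dot_le0 (negbTE N0).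
  move: h; rewrite /on_flat dot_le0 (negbTE N0) sqr_le0 => /eqP h.
  by have [s hs] := plane_projection_line N0 Nv h; exists s.
rewrite vsub_eq0; have [ba|ba] := eqVneq (x b) (x a).
  exists zero => i; exists 0; rewrite dot_le0 vsub_eq0 => /eqP ->.
  by apply: vecP => /=; ring.
exists (cross v (vsub (x b) (x a))) => i; rewrite dot_le0.
have [h|h] := eqVneq (cross (vsub (x i) (x a)) (vsub (x b) (x a))) zero; last by exists 0.
by have [s hs] := line_projection_line v ba h; exists s.
Qed.

Lemma accepting_on_lines t m : accepting (greedy_run t m) ->
  on_lines (direction (greedy_run t m)) m.
Proof.
move=> [ok cov]; set v := direction _.
have /boolp.choice[lab hlab] : forall i, exists j, (i < n)%N ->
    (j < m)%N /\ on_flat (pivot (greedy_run t j)) (t (j + j)%N) (normal_at t j) i.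
  move=> i; case: (ltnP i n) => [/cov/covered_run[j jm h]|_]; last by exists 0%N.
  by exists j.
exists lab; split=> [i /hlab[]//|l lm].
have [B [d [s hs]]] := on_flat_line (pivot (greedy_run t l)) (t (l + l)%N)
  (direction_orthogonal ok lm).
by exists B, d, s => i /hlab[_ h] e; apply: hs; rewrite -e.
Qed.

Lemma eq_greedy_run t t' l : (forall j, (j < l + l)%N -> t j = t' j) ->
  greedy_run t l = greedy_run t' l.
Proof.
elim: l => //= l IH h; rewrite !h ?IH //; try lia.
by move=> j jl; apply: h; lia.
Qed.

Section Completeness.
Variables (r : nat) (lab : nat -> nat) (nr : nat -> vec R) (ofs : nat -> R) (v0 : vec R).
Hypotheses (n0 : (0 < n)%N) (v0_neq0 : v0 != zero)
  (lab_lt : forall i, (i < n)%N -> (lab i < r)%N)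
  (nr_neq0 : forall l, (l < r)%N -> nr l != zero)
  (nr_v0 : forall l, (l < r)%N -> dot (nr l) v0 = 0)
  (nr_ofs : forall i, (i < n)%N -> dot (nr (lab i)) (x i) = ofs (lab i)).

Lemma pivot_lt g : (pivot g < n)%N.
Proof. exact: last_uncovered_lt. Qed.

(** The class of [a] need not span its plane. Two points spanning it with [a] are taken if they
    exist; otherwise one point different from [a], used twice so that the normal vanishes and
    [on_flat] means a line; otherwise [a] itself. *)
Lemma greedy_choice a : (a < n)%N -> exists b c, [/\ (b < n)%N, (c < n)%N,
  dot (tri_normal a b c) v0 = 0 &
  forall i, (i < n)%N -> lab i = lab a -> on_flat a b (tri_normal a b c) i].
Proof.
move=> an; pose L i := (i < n)%N /\ lab i = lab a.
have La : L a by [].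
have nru i : L i -> dot (vsub (x i) (x a)) (nr (lab a)) = 0.
  move=> [ni li]; have := nr_ofs ni; rewrite li -(nr_ofs an).
  rewrite /dot /=; lra.
case: (boolp.pselect (exists b c, [/\ L b, L c & tri_normal a b c != zero])).
  move=> [b [c [Lb Lc N0]]]; exists b, c; case: (Lb) (Lc) => bn _ [cn _].
  have [s es] := cross_parallel_normal (nr_neq0 (lab_lt an)) (nru _ Lb) (nru _ Lc).
  split=> //.
    by rewrite /tri_normal es dot_vscalel nr_v0 ?mulr0 // lab_lt.
  move=> i ni li; rewrite /on_flat dot_le0 (negbTE N0) sqr_le0; apply/eqP.
  by rewrite /tri_normal es dot_vscalel dotC nru ?mulr0.
move=> nospan.
have spn b c : L b -> L c -> tri_normal a b c = zero.
  by move=> Lb Lc; apply/eqP; case: eqP => // /eqP h; case: nospan; exists b, c.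
case: (boolp.pselect (exists b, L b /\ x b != x a)).
  move=> [b [Lb ba]]; exists b, b; case: (Lb) => bn _.
  rewrite spn // dot0v; split=> // i ni li.
  rewrite /on_flat !dot_le0 eqxx vsub_eq0 (negbTE ba).
  by apply/eqP; apply: (spn i b).
move=> noneq; exists a, a; rewrite spn // dot0v; split=> // i ni li.
rewrite /on_flat !dot_le0 eqxx !vsub_eq0 eqxx.
by case: eqP => // /eqP h; case: noneq; exists i.
Qed.

(** [S] collects the labels whose classes are completely covered. The label of an uncovered pivot is
    not in [S], so [S] grows by one at each step until nothing is left. *)
Lemma greedy_choices l : exists t, [/\ forall j, (t j < n)%N,
  forall j, (j < l)%N -> dot (normal_at t j) v0 = 0 &
  (forall i, (i < n)%N -> covered (greedy_run t l) i) \/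
  exists S : seq nat, [/\ uniq S, size S = l, {subset S <= iota 0 r} &
    forall i, (i < n)%N -> lab i \in S -> covered (greedy_run t l) i]].
Proof.
elim: l => [|l [t [tn tv tc]]].
  exists (fun=> 0%N); split=> //; right; exists [::]; split=> //.
set g := greedy_run t l in tc; have an := pivot_lt g; set a := pivot g in an.
have [b [c [bn cn bcv bcc]]] := greedy_choice an.
(* The next pair depends on the pivot and so on the run so far; changing [t] only at these two
   positions leaves the first [l] steps as they were. *)
pose t' j := if j == (l + l)%N then b else if j == (l + l).+1 then c else t j.
have tt' k : (k <= l)%N -> greedy_run t' k = greedy_run t k.
  by move=> kl; apply: eq_greedy_run => j jl; rewrite /t' !ltn_eqF //; lia.
have e1 : t' (l + l)%N = b by rewrite /t' eqxx.
have e2 : t' (l + l).+1 = c by rewrite /t' eqxx gtn_eqF.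
have eN : normal_at t' l = tri_normal a b c by rewrite /normal_at tt' // e1 e2.
exists t'; split.
- by move=> j; rewrite /t'; case: eqP => // _; case: eqP.
- move=> j; rewrite ltnS leq_eqVlt => /orP[/eqP ->|jl]; first by rewrite eN.
  rewrite /normal_at tt' 1?ltnW // -(tv j jl) /normal_at /t' !ltn_eqF //; lia.
rewrite /= e1 e2 tt' // -/g.
case: tc => [h|[S [uS sS subS h]]]; first by left=> i ni; rewrite h.
case: (boolP (covered g a)) => ca.
  by left=> i ni; rewrite (last_uncoveredP ca).
right; exists (lab a :: S); split=> //=.
- rewrite uS andbT; apply: contra ca; exact: h.
- by rewrite sS.
- by move=> y; rewrite inE => /orP[/eqP ->|/subS //]; rewrite mem_iota /= add0n lab_lt.
- move=> i ni; rewrite inE -/a => /orP[/eqP li|li].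
    by rewrite bcc ?orbT.
  by rewrite h.
Qed.

(** The cross product of two vectors orthogonal to [v0] is a multiple of [v0]. Hence [gW] recovers
    [v0] up to a factor, and later normals pass the test. *)
Lemma greedy_ok t l : (forall j, (j < l)%N -> dot (normal_at t j) v0 = 0) ->
  [/\ gok (greedy_run t l), dot (gA (greedy_run t l)) v0 = 0
    & exists s, gW (greedy_run t l) = vscale s v0].
Proof.
elim: l => [_|l IH h] /=; first by rewrite dot0v; split=> //; exists 0; rewrite vscale0.
have {}IH := IH (fun j jl => h j (leqW jl)).
move: IH.
have Nv := h l (ltnSn l); rewrite /= -/(normal_at t l).
move: (greedy_run t l) (normal_at t l) Nv => [C A W ok] N Nv /= [okk Av Wv].
rewrite !dot_le0; have [A0|A0] := eqVneq A zero; first by split.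
have [W0|W0] := eqVneq W zero; first by split=> //; exact: cross_parallel_normal.
split=> //; rewrite okk /= sqr_le0; apply/eqP; case: Wv => s ->.
by rewrite dot_vscalel dotC Nv mulr0.
Qed.

Lemma accepting_exists : exists2 t : nat -> nat, (forall j, (t j < n)%N) &
  accepting (greedy_run t r).
Proof.
have [t [tn tv tc]] := greedy_choices r; exists t => //.
have [ok _ _] := greedy_ok tv; split=> //.
case: tc => // -[S [uS sS subS h]] i ni; apply: h => //.
have le : (size (iota 0 r) <= size S)%N by rewrite size_iota sS.
by have [_ ->] := uniq_min_size uS subS le; rewrite mem_iota /= add0n lab_lt.
Qed.

End Completeness.
End Directions.

(** * Maximum independent sets of bipartite graphs *)

Section Koenig.
Variables (V : finType) (e : rel V) (c : V -> bool).
Hypotheses (e_sym : symmetric e) (e_col : forall x y, e x y -> c x != c y).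
Implicit Types (M : {set {set V}}) (u w x y : V).

Definition unmatched M x : Prop := forall y, [set x; y] \notin M.

Lemma matching_edge M x y : matching e M -> [set x; y] \in M -> e x y.
Proof.
move=> [hM _] /[dup] hxy /hM[a [b [eab exy]]].
have : x \in [set a; b] by rewrite -exy set21.
have : y \in [set a; b] by rewrite -exy set22.
have : a \in [set x; y] by rewrite exy set21.
have : b \in [set x; y] by rewrite exy set22.
have ab : a != b by apply/eqP => ab; move: (e_col eab); rewrite ab eqxx.
rewrite !inE => h1 h2 /orP[]/eqP ey /orP[]/eqP ex; subst x y => //.
- by move: h1; rewrite orbb eq_sym (negbTE ab).
- by rewrite e_sym.
- by move: h2; rewrite orbb (negbTE ab).
Qed.

Lemma matching_uniq M x y z : matching e M ->
  [set x; y] \in M -> [set x; z] \in M -> y = z.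
Proof.
move=> [hM tM] hy hz; have ey := matching_edge (conj hM tM) hy.
have eyz : [set x; y] = [set x; z].
  apply/eqP; case: eqP => // /eqP ne.
  have /trivIsetP/(_ _ _ hy hz ne) := tM.
  by move=> /disjointFr/(_ (set21 x y)); rewrite set21.
have : y \in [set x; z] by rewrite -eyz set22.
rewrite !inE => /orP[/eqP yx|/eqP //].
by move: (e_col ey); rewrite yx eqxx.
Qed.

Lemma unmatched_notin M x A : matching e M -> unmatched M x -> A \in M -> x \notin A.
Proof.
move=> [hM _] ux /[dup] AM /hM[a [b [_ eA]]]; apply/negP.
rewrite eA !inE => /orP[]/eqP xe; subst x.
  by move: (ux b); rewrite -eA AM.
by move: (ux a); rewrite setUC -eA AM.
Qed.

Lemma matching_sub M F : matching e M -> matching e (M :\ F).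
Proof.
move=> [hM tM]; split; first by move=> E /setD1P[_ /hM].
exact: trivIsetS (subD1set _ _) tM.
Qed.

Lemma matching_add M u w : matching e M -> e u w ->
  (forall A, A \in M -> u \notin A /\ w \notin A) ->
  matching e ([set u; w] |: M) /\ #|[set u; w] |: M| = #|M|.+1.
Proof.
move=> [hM tM] euw out; have nM : [set u; w] \notin M.
  by apply/negP => /out; rewrite set21; case.
split; last by rewrite cardsU1 nM.
have dis A : A \in M -> [disjoint [set u; w] & A].
  by move=> /out[uA wA]; rewrite disjoints_subset subUset !sub1set !inE uA wA.
split; first by move=> E /setU1P[->|/hM //]; exists u, w.
apply/trivIsetP => A B /setU1P[->|AM] /setU1P[->|BM] AB.
- by rewrite eqxx in AB.
- exact: dis.
- by rewrite disjoint_sym dis.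
- by move/trivIsetP: tM; apply.
Qed.

(** An augmenting walk from [u], recorded by its vertices at odd distance from [u]; their partners
    are determined by the matching. Repeated vertices are allowed. *)
Fixpoint alternating M u (ws : seq V) : Prop :=
  match ws with
  | [::] => False
  | [:: w] => e u w /\ unmatched M w
  | w :: ws' => e u w /\ exists u', [set w; u'] \in M /\ alternating M u' ws'
  end.

Lemma alternating_cons M u w ws : ws <> [::] ->
  alternating M u (w :: ws) <->
  (e u w /\ exists u', [set w; u'] \in M /\ alternating M u' ws).
Proof. by case: ws. Qed.

(** Loop erasure at one vertex: if the walk visits [w], the part after the last visit is a shorter
    walk that starts at the partner [u']. *)
Lemma alternating_cut M u ws w u' : matching e M -> [set w; u'] \in M ->
  alternating M u ws -> exists ws', [/\ size ws' <= size ws, w \notin ws' &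
    (ws' = ws /\ w \notin ws) \/ (size ws' < size ws /\ alternating M u' ws')].
Proof.
move=> mM wu'; elim: ws u => // y ws IH u.
have [->|ws0] := eqVneq ws [::].
  move=> /= [_ uy]; exists [:: y]; split=> //.
    by rewrite inE; apply/eqP => ?; subst; move: (uy u'); rewrite wu'.
  by left; split=> //; rewrite inE; apply/eqP => ?; subst; move: (uy u'); rewrite wu'.
move/eqP in ws0; rewrite alternating_cons // => -[_ [u2 [yu2 alt]]].
have [ws' [sws' nw [[e1 nws]|[lt alt']]]] := IH _ alt; last first.
  by exists ws'; split=> //=; [exact: leqW|right; split=> //; exact: ltnW].
have [ey|ney] := eqVneq w y.
  subst y; exists ws; split=> //=; right; split=> //.
  by rewrite (matching_uniq mM wu' yu2).
by exists (y :: ws); split=> //; [|left; split=> //]; rewrite inE negb_or ney.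
Qed.

(** Only matching edges at [w] are exchanged. The recorded vertices differ from [w] by assumption
    and from [u] and [u'] by their color, so the walk does not notice. *)
Lemma alternating_swap M u w u' v ws (M1 := [set u; w] |: (M :\ [set w; u'])) :
  matching e M -> c u -> c u' -> ~~ c w -> w \notin ws -> c v ->
  alternating M v ws -> alternating M1 v ws.
Proof.
move=> mM cu cu' cw; elim: ws v => // y ws IH v; rewrite inE negb_or => /andP[wy nw] cv.
have keep : e v y -> forall z, [set y; z] \in M -> [set y; z] \in M1.
  move=> evy z hz; rewrite !inE hz andbT; apply/orP; right; apply/eqP => h.
  have : y \in [set w; u'] by rewrite -h set21.
  rewrite !inE eq_sym (negbTE wy) => /eqP yu'.
  by move: (e_col evy); rewrite yu' cu' cv.
have [->|ws0] := eqVneq ws [::].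
  move=> /= [evy uy]; split=> // z; rewrite !inE negb_or negb_and (uy z) orbT andbT.
  apply/eqP => h; have : y \in [set u; w] by rewrite -h set21.
  rewrite !inE [y == w]eq_sym (negbTE wy) orbF => /eqP yu.
  by move: (e_col evy); rewrite yu cu cv.
move/eqP in ws0; rewrite !alternating_cons // => -[evy [u2 [yu2 alt]]].
split=> //; exists u2; split; first exact: keep.
apply: IH => //; move: (e_col evy) (e_col (matching_edge mM yu2)).
by rewrite cv; case: (c y); case: (c u2).
Qed.

(** Berge's argument, one edge at a time: exchanging the first matching edge of the walk keeps the
    cardinality, hence maximality, and frees [u'], from which a shorter walk starts. A walk of one
    edge would enlarge the matching. *)
Lemma no_augmenting M u ws : maximum_matching e M -> c u -> unmatched M u ->
  ~ alternating M u ws.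
Proof.
move: {2}(size ws) (leqnn (size ws)) => d; elim: d M u ws => [|d IH] M u ws.
  by case: ws => // _ _ _ _ [].
case: ws => [_ _ _ _ []|w ws sws [mM maxM] cu uu].
have uA A : A \in M -> u \notin A by apply: unmatched_notin.
have [->|ws0] := eqVneq ws [::].
  move=> /= [euw uw].
  have [|m1 s1] := matching_add mM euw.
    by move=> A AM; split; [exact: uA|exact: unmatched_notin AM].
  by have := maxM _ m1; rewrite s1 ltnn.
move/eqP in ws0; rewrite alternating_cons // => -[euw [u' [wu' alt]]].
have cw : ~~ c w by move: (e_col euw); rewrite cu; case: (c w).
have cu' : c u' by move: (e_col (matching_edge mM wu')) cw; case: (c w); case: (c u').
pose M1 := [set u; w] |: (M :\ [set w; u']).
have [|m1 s1] := matching_add (matching_sub [set w; u'] mM) euw.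
  move=> A /setD1P[AF AM]; split; first exact: uA.
  apply: contra AF => wA; apply/eqP.
  have [hM /trivIsetP tM] := mM; apply/eqP; case: eqP => // /eqP ne.
  by have /disjointFr/(_ wA) := tM _ _ AM wu' ne; rewrite set21.
have max1 : maximum_matching e M1.
  split=> // M2 /maxM; rewrite s1.
  by rewrite (cardsD1 [set w; u'] M) wu' add1n.
have u'1 : unmatched M1 u'.
  move=> z; rewrite !inE negb_or negb_and negbK; apply/andP; split.
    apply/eqP => h; have : u' \in [set u; w] by rewrite -h set21.
    rewrite !inE => /orP[]/eqP eu; last by move: cw; rewrite -eu cu'.
    by move: (uu w); rewrite -eu setUC wu'.
  rewrite orbC; case: (boolP ([set u'; z] \in M)) => //= h.
  by rewrite setUC in wu'; rewrite (matching_uniq mM h wu') setUC.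
have [ws' [sws' nw [[e1 nws]|[lt alt']]]] := alternating_cut mM wu' alt.
  by apply: (IH M1 u' ws) => //; exact: alternating_swap.
apply: (IH M1 u' ws') => //; first by rewrite (leq_trans sws').
exact: alternating_swap.
Qed.

(** [ReachEdge] also follows matching edges, exactly as the relaxation step of the program does;
    this only leads to the partner of a vertex already reached. *)
Inductive reach M : V -> Prop :=
| ReachFree u : c u -> unmatched M u -> reach M u
| ReachEdge u w : reach M u -> c u -> e u w -> reach M w
| ReachBack w u : reach M w -> ~~ c w -> [set w; u] \in M -> reach M u.

(** The induction carries the negative statement that no augmenting walk starts at a reached vertex
    of the free side. Each reaching step prepends an edge to a hypothetical walk, so paths never
    have to be reversed. *)
Lemma reach_matched M w : maximum_matching e M -> reach M w -> ~~ c w ->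
  exists u, [set w; u] \in M.
Proof.
move=> maxM rw cw; have mM := maxM.1.
suff h : if c w then forall ws, ~ alternating M w ws else
    ~ unmatched M w /\ forall u ws, [set w; u] \in M -> ~ alternating M u ws.
  move: h; rewrite (negbTE cw) => -[h _].
  apply: boolp.contrapT => nex; apply: h => y; apply/negP => hy.
  by apply: nex; exists y.
elim: rw {cw} => {w} [u cu uu|u w _ IH cu euw|w u _ IH cw wu].
- by rewrite cu => ws; exact: no_augmenting.
- rewrite cu in IH; have /negbTE -> : ~~ c w by move: (e_col euw); rewrite cu; case: (c w).
  split=> [uw|u' ws wu' alt]; first by apply: (IH [:: w]).
  case: ws alt => // w' ws alt.
  by apply: (IH [:: w, w' & ws]); split=> //; exists u'.
- rewrite (negbTE cw) in IH.
  have -> : c u by move: (e_col (matching_edge mM wu)) cw; case: (c w); case: (c u).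
  by move=> ws; apply: IH.2.
Qed.

Definition independent (I : {set V}) : Prop := {in I &, forall x y, ~~ e x y}.

(** Weak duality: every matching edge has an end outside [I], and disjoint edges give distinct
    ends. *)
Lemma independent_matching M (I : {set V}) : matching e M -> independent I ->
  #|I| + #|M| <= #|V|.
Proof.
move=> mM iI; rewrite -(cardsC I) leq_add2l.
have [hM /trivIsetP tM] := mM.
have [->|[E0 /hM[v _]]] := set_0Vmem M; first by rewrite cards0.
have ex (E : {set V}) : exists x, E \in M -> (x \in E) && (x \notin I).
  case: (boolP (E \in M)) => [/hM[a [b [eab eE]]]|_].
    case: (boolP (a \in I)) => aI; last by exists a; rewrite eE set21 aI.
    exists b; move=> _; rewrite eE set22 /=; apply/negP => bI; have := iI _ _ aI bI; by rewrite eab.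
  by exists v.
have /boolp.choice[g hg] := ex.
rewrite -(card_in_imset (f := g) (D := M)); last first.
  move=> A B AM BM gAB; apply/eqP; case: eqP => // /eqP AB.
  have /andP[gA _] := hg A AM; have /andP[gB _] := hg B BM.
  by have /disjointFr/(_ gA) := tM _ _ AM BM AB; rewrite gAB gB.
apply/subset_leq_card/subsetP => y /imsetP[A AM ->]; rewrite inE.
by have /andP[] := hg A AM.
Qed.

(* Koenig: complementing the vertex cover found by alternating reachability
   gives a maximum independent set. *)
Lemma koenig M (Z : pred V) (S := [set x | c x == Z x]) :
  maximum_matching e M -> (forall x, Z x <-> reach M x) ->
  independent S /\ forall I, independent I -> #|I| <= #|S|.
Proof.
move=> maxM hZ; have mM := maxM.1; split.
  have half x y : c x -> ~~ c y -> x \in S -> y \in S -> ~~ e x y.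
    rewrite !inE => cx /negbTE -> ; rewrite cx => /eqP/esym zx /eqP/esym zy.
    apply/negP => exy; have /hZ : reach M y by apply: ReachEdge exy => //; apply/hZ.
    by rewrite zy.
  move=> x y xS yS; apply/negP => exy; move: (e_col exy).
  case cx: (c x); case cy: (c y) => // _.
    by have := half x y; rewrite cx cy exy => /(_ isT isT xS yS).
  by have := half y x; rewrite cx cy e_sym exy => /(_ isT isT yS xS).
move=> I iI; have := independent_matching mM iI.
(* The complement of [S] is the vertex cover. Its vertices are all matched, and no matching edge has
   both ends in it, since [ReachBack] would reach the end of color [c]. So it injects into [M]. *)
suff : #|~: S| <= #|M| by have := cardsC S; lia.
have ex x : exists y, x \in ~: S -> [set x; y] \in M.
  case: (boolP (x \in ~: S)) => [|_]; last by exists x.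
  rewrite !inE; case cx: (c x) => /=; case zx: (Z x) => // _.
    apply: boolp.contrapT => nex; suff /hZ : reach M x by rewrite zx.
    apply: ReachFree; first by rewrite cx.
    by move=> y; apply/negP => hy; apply: nex; exists y.
  have [|y hy] := reach_matched maxM (proj1 (hZ x) zx); first by rewrite cx.
  by exists y.
have /boolp.choice[g hg] := ex.
rewrite -(card_in_imset (f := fun x => [set x; g x]) (D := ~: S)); last first.
  move=> x y xS yS eq; apply/eqP; case: eqP => // /eqP xy.
  have hx := hg x xS; have hy := hg y yS.
  have : y \in [set x; g x] by rewrite eq set21.
  rewrite !inE eq_sym (negbTE xy) => /eqP yx.
  have : x \in [set y; g y] by rewrite -eq set21.
  rewrite !inE (negbTE xy) => /eqP xy'.
  have exy := matching_edge mM hx; rewrite -yx in exy hx.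
  move: (e_col exy) xS yS; rewrite !inE.
  case cx: (c x); case cy: (c y) => // _; case zx: (Z x); case zy: (Z y) => // _ _.
    suff /hZ : reach M x by rewrite zx.
    by apply: (@ReachBack _ y); [apply/hZ|rewrite cy|rewrite setUC].
  suff /hZ : reach M y by rewrite zy.
  by apply: (@ReachBack _ x); [apply/hZ|rewrite cx|].
by apply/subset_leq_card/subsetP => y /imsetP[A AM ->]; apply: hg.
Qed.

End Koenig.

(** * Computing a common direction *)

Definition rvec := (rexp * rexp * rexp)%type.

Definition edot (u w : rvec) : rexp :=
  RAdd (RAdd (RMul u.1.1 w.1.1) (RMul u.1.2 w.1.2)) (RMul u.2 w.2).
Definition esub (u w : rvec) : rvec :=
  (RSub u.1.1 w.1.1, RSub u.1.2 w.1.2, RSub u.2 w.2).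
Definition ecross (u w : rvec) : rvec :=
  (RSub (RMul u.1.2 w.2) (RMul u.2 w.1.2),
   RSub (RMul u.2 w.1.1) (RMul u.1.1 w.2),
   RSub (RMul u.1.1 w.1.2) (RMul u.1.2 w.1.1)).

Definition entry (a : nat) (e : iexp) : rvec := (RGet a e, RGet a.+1 e, RGet a.+2 e).
Definition vvar (a : nat) : rvec := entry a (IConst 0).
Definition vasg (a : nat) (u : rvec) : com :=
  Seq (RSet a (IConst 0) u.1.1)
  (Seq (RSet a.+1 (IConst 0) u.1.2) (RSet a.+2 (IConst 0) u.2)).
Definition tle0 (e : rexp) : test := TRLe e (RConst 0).

Section Eval.
Variable R : realType.
Implicit Type s : state R.

Definition arr3 s (a : nat) : nat -> vec R :=
  fun i => (rarr s a i, rarr s a.+1 i, rarr s a.+2 i).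

Definition evalv s (u : rvec) : vec R :=
  (reval s u.1.1, reval s u.1.2, reval s u.2).

Lemma reval_edot s u w : reval s (edot u w) = dot (evalv s u) (evalv s w).
Proof. by []. Qed.

Lemma evalv_esub s u w : evalv s (esub u w) = vsub (evalv s u) (evalv s w).
Proof. by []. Qed.

Lemma evalv_ecross s u w : evalv s (ecross u w) = cross (evalv s u) (evalv s w).
Proof. by []. Qed.

Lemma evalv_entry s a e : evalv s (entry a e) = arr3 s a (ieval s e).
Proof. by []. Qed.

Lemma teval_tle0 s e : teval s (tle0 e) = (reval s e <= 0)%R.
Proof. by []. Qed.

Lemma run_if s b p q : run (If b p q) s = if teval s b then run p s else run q s.
Proof. by []. Qed.

Lemma run_seq s p q : run (Seq p q) s = run q (run p s).
Proof. by []. Qed.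

Lemma reval_mul s e1 e2 : reval s (RMul e1 e2) = (reval s e1 * reval s e2)%R.
Proof. by []. Qed.

Lemma arr3_eq s s' a : rarr s' a = rarr s a -> rarr s' a.+1 = rarr s a.+1 ->
  rarr s' a.+2 = rarr s a.+2 -> arr3 s' a = arr3 s a.
Proof. by rewrite /arr3 => -> -> ->. Qed.

End Eval.

Definition evalE := (teval_tle0, reval_edot, evalv_esub, evalv_ecross, evalv_entry).

(* Integer variables: 6 = number m of planes, 7 = found, 14 = pivot, 15 = ok,
   16 = plane index; array 13 = covered points. Real vectors: 0 = centers,
   4 = [gA], 7 = [gW], 10 = current normal, 13 = direction. *)
Definition tupleL : iexp := IGet 10 (IAdd (var 16) (var 16)).
Definition tupleR : iexp := IGet 10 (IAdd (IAdd (var 16) (var 16)) (IConst 1)).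

Definition pivot_body : com :=
  If (TILe (IGet 13 (var 2)) (IConst 0)) (asg 14 (var 2)) Skip.

Definition flat_body : com :=
  let mark := ISet 13 (var 2) (IConst 1) in
  let u := esub (entry 0 (var 2)) (entry 0 (var 14)) in
  let w := esub (entry 0 tupleL) (entry 0 (var 14)) in
  If (tle0 (edot (vvar 10) (vvar 10)))
    (If (tle0 (edot w w))
        (If (tle0 (edot u u)) mark Skip)
        (If (tle0 (edot (ecross u w) (ecross u w))) mark Skip))
    (If (tle0 (RMul (edot (vvar 10) u) (edot (vvar 10) u))) mark Skip).

Definition normal_com : com :=
  vasg 10 (ecross (esub (entry 0 tupleL) (entry 0 (var 14)))
                  (esub (entry 0 tupleR) (entry 0 (var 14)))).

Definition track_com : com :=
  If (tle0 (edot (vvar 4) (vvar 4))) (vasg 4 (vvar 10))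
  (If (tle0 (edot (vvar 7) (vvar 7))) (vasg 7 (ecross (vvar 4) (vvar 10)))
  (If (tle0 (RMul (edot (vvar 7) (vvar 10)) (edot (vvar 7) (vvar 10)))) Skip
      (asg 15 (IConst 0)))).

Definition greedy_com : com :=
  Seq (asg 14 (IConst 0))
  (Seq (For 2 0 pivot_body)
  (Seq normal_com
  (Seq (For 2 0 flat_body) track_com))).

Definition clear_covered : com := For 2 0 (ISet 13 (var 2) (IConst 0)).
Definition zerov : rvec := (RConst 0, RConst 0, RConst 0).
Definition init_greedy : com :=
  Seq (asg 15 (IConst 1)) (Seq (vasg 4 zerov) (vasg 7 zerov)).

Definition all_covered_body : com :=
  If (TILe (IGet 13 (var 2)) (IConst 0)) (asg 15 (IConst 0)) Skip.

Definition direction_com : com :=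
  If (TILe (IConst 1) (var 15))
    (Seq (asg 7 (IConst 1))
      (If (tle0 (edot (vvar 7) (vvar 7)))
        (If (tle0 (RAdd (RMul (RGet 5 (IConst 0)) (RGet 5 (IConst 0)))
                        (RMul (RGet 6 (IConst 0)) (RGet 6 (IConst 0)))))
            (vasg 13 (RConst 0, RConst 0, RConst 1))
            (vasg 13 (RConst 0, RGet 6 (IConst 0), RSub (RConst 0) (RGet 5 (IConst 0)))))
        (vasg 13 (vvar 7))))
    Skip.

Definition try_cover : com :=
  Seq init_greedy (Seq clear_covered (Seq (For 16 6 greedy_com)
  (Seq (For 2 0 all_covered_body) direction_com))).

(** The enumeration for one [m] is not interrupted: of the accepted tuples of the first successful
    [m] the last one determines the stored direction, and any of them would serve. *)
Definition find_direction : com :=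
  Seq (Seq (asg 6 (IConst 0)) (asg 7 (IConst 0)))
  (While (TILe (var 7) (IConst 0))
    (Seq (Seq (asg 6 (IAdd (var 6) (IConst 1))) (asg 12 (IAdd (var 6) (var 6))))
         (enum_tuples try_cover))).

Section FindDirection.
Variables (R : realType) (x : nat -> vec R) (n : nat).
Hypothesis n0 : 0 < n.
Implicit Type s : state R.

Definition greedy_rep (g : greedy R) s : Prop :=
  [/\ forall i, i < n -> iarr s 13 i = covered g i, arr3 s 4 0 = gA g,
      arr3 s 7 0 = gW g & iarr s 15 0 = gok g].

Lemma run_flat_body s i b (C : bool) : iarr s 2 0 = i ->
  iarr s 10 (iarr s 16 0 + iarr s 16 0) = b -> iarr s 13 i = C ->
  arr3 s 0 = x ->
  iarr (run flat_body s) 13 i = C || on_flat x (iarr s 14 0) b (arr3 s 10 0) i /\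
  forall j, j != i -> iarr (run flat_body s) 13 j = iarr s 13 j.
Proof.
move=> si sb sC sx.
rewrite /flat_body; set mark := ISet _ _ _; set u := esub (entry 0 (var 2)) _; set w := esub (entry 0 tupleL) _.
have eu : evalv s u = vsub (x i) (x (iarr s 14 0)) by rewrite /u !evalE sx /= si.
have ew : evalv s w = vsub (x b) (x (iarr s 14 0)) by rewrite /w !evalE sx /= sb.
have -> : run (If (tle0 (edot (vvar 10) (vvar 10)))
    (If (tle0 (edot w w)) (If (tle0 (edot u u)) mark Skip)
        (If (tle0 (edot (ecross u w) (ecross u w))) mark Skip))
    (If (tle0 (RMul (edot (vvar 10) u) (edot (vvar 10) u))) mark Skip)) s =
   if on_flat x (iarr s 14 0) b (arr3 s 10 0) i then run mark s else s.
  rewrite /on_flat -eu -ew.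
  by rewrite !run_if !teval_tle0 !reval_mul !reval_edot !evalE; do 3?case: ifP.
case: ifP => h; rewrite ?orbF ?orbT; last by [].
by rewrite /mark; cells; rewrite si eqxx; split=> // j /negbTE ->.
Qed.

Lemma wp_greedy s g l b c : iarr s 0 0 = n -> arr3 s 0 = x ->
  iarr s 16 0 = l -> iarr s 10 (l + l) = b -> iarr s 10 (l + l).+1 = c ->
  greedy_rep g s ->
  wp greedy_com
    ((forcost pivot_body + forcost flat_body + maxcost greedy_com + 100) * n.+1)
    (greedy_rep (greedy_step x n b c g)) s.
Proof.
move=> sn sx sl sb sc [gC gAE gWE gokE].
apply: (@wp_le _ _ _ (maxcost (asg 14 (IConst 0)) +
  (forcost pivot_body * n.+1 + (maxcost normal_com +
  (forcost flat_body * n.+1 + maxcost track_com).+1).+1).+1).+1).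
  have -> : maxcost greedy_com = (maxcost (asg 14 (IConst 0)) + (maxcost (For 2 0 pivot_body)
    + (maxcost normal_com + (maxcost (For 2 0 flat_body) + maxcost track_com).+1).+1).+1).+1 by [].
  move: (maxcost _) (maxcost _) (maxcost _) (maxcost _) (maxcost _) (forcost _) (forcost _).
  by move=> *; nia.
apply: wp_seq; apply: wp_run => //.
apply: (@wp_bind _ _ _ _ _ (fun s' => iarr s' 14 0 = pivot n g)).
  apply: (@wp_for_run _ _ _ _ _ (fun i s' => iarr s' 14 0 = last_uncovered (covered g) i)) => //.
  move=> i s' iN [u _] si I1; rewrite /pivot_body.
  have et : teval s' (TILe (IGet 13 (var 2)) (IConst 0)) = ~~ covered g i.
    by cells; rewrite si (u 13) //; cells; rewrite gC //; case: (covered g i).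
  by rewrite run_if et /=; case: (covered g i); cells; rewrite ?si.
move=> s1 [u1 v1] a1; set a := pivot n g in a1.
apply: wp_seq; apply: wp_run => //.
set s2 := run normal_com s1.
have x1 : arr3 s1 0 = x by rewrite -sx (arr3_eq (v1 0 _) (v1 1 _) (v1 2 _)).
have e2 : arr3 s2 10 0 = tri_normal x a b c.
  have -> : arr3 s2 10 0 = evalv s1 (ecross (esub (entry 0 tupleL) (entry 0 (var 14)))
                  (esub (entry 0 tupleR) (entry 0 (var 14)))) by [].
  have eL : ieval s1 tupleL = b by rewrite /= (u1 16) // (u1 10) //; cells; rewrite sl.
  have eR : ieval s1 tupleR = c by rewrite /= (u1 16) // (u1 10) //; cells; rewrite addn1 sl.
  by rewrite !evalE eL eR [ieval s1 (var 14)]/= a1 x1.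
have a2 : iarr s2 14 0 = a by [].
have x2 : arr3 s2 0 = x by rewrite -x1.
have i2 d : d \in [:: 0; 10; 13; 15; 16] -> iarr s2 d = iarr s d.
  by rewrite !inE => /orP[|/orP[|/orP[|/orP[]]]] /eqP ->; rewrite /s2 /= u1.
have r2 d : d \in [:: 4; 5; 6; 7; 8; 9] -> rarr s2 d = rarr s d.
  by rewrite !inE => /orP[|/orP[|/orP[|/orP[|/orP[]]]]] /eqP ->; rewrite /s2 -v1.
move: s2 e2 a2 x2 i2 r2 => s2 e2 a2 x2 i2 r2.
apply: (@wp_bind _ _ _ _ _ (fun s' => forall i, i < n ->
    iarr s' 13 i = covered g i || on_flat x a b (tri_normal x a b c) i)).
  pose I i s' := (forall j, j < i ->
      iarr s' 13 j = covered g j || on_flat x a b (tri_normal x a b c) j) /\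
    (forall j, i <= j < n -> iarr s' 13 j = covered g j).
  apply: (@wp_frame _ _ _ _ (I n)); last by move=> s' _ [].
  apply: wp_for_run => //; first by rewrite i2.
    by split=> // j jn; rewrite [iarr _ _ _](congr1 (fun h => h j) (i2 13 isT)) gC.
  move=> i s' iN [u v] si [I1 I2].
  have es' : on_flat x a b (tri_normal x a b c) i = on_flat x (iarr s' 14 0) b (arr3 s' 10 0) i.
    by rewrite (arr3_eq (v 10 _) (v 11 _) (v 12 _)) // e2 (u 14) // a2.
  have [] := @run_flat_body s' i b (covered g i) si.
  - by rewrite (u 16) // (u 10) // !i2 // sl.
  - by apply: I2; rewrite leqnn.
  - by rewrite (arr3_eq (v 0 _) (v 1 _) (v 2 _)).
  rewrite -es' => h1 h2; split=> j.
    rewrite ltnS leq_eqVlt => /orP[/eqP ->|ji]; first by rewrite -h1.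
    rewrite -I1 // -(h2 j) //; by rewrite neq_ltn ji.
  move=> /andP[ij jn]; rewrite -I2 ?jn ?andbT ?(ltnW ij) // -(h2 j) //.
  by rewrite neq_ltn ij orbT.
move=> s3 [u3 v3] C3; apply: wp_run => //.
have eA : arr3 s3 4 0 = gA g.
  by rewrite (arr3_eq (v3 4 _) (v3 5 _) (v3 6 _)) // (arr3_eq (r2 4 _) (r2 5 _) (r2 6 _)).
have eW : arr3 s3 7 0 = gW g.
  by rewrite (arr3_eq (v3 7 _) (v3 8 _) (v3 9 _)) // (arr3_eq (r2 7 _) (r2 8 _) (r2 9 _)).
have eN : arr3 s3 10 0 = tri_normal x a b c.
  by rewrite (arr3_eq (v3 10 _) (v3 11 _) (v3 12 _)).
have eok : iarr s3 15 0 = gok g by rewrite u3 // i2.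
rewrite /greedy_step -/a -eA -eW -eN in C3 *.
rewrite /track_com !run_if !teval_tle0 !reval_mul !reval_edot !evalE.
by do 3?[case: ifP => ?]; split=> //=; rewrite ?andbT ?andbF.
Qed.

Definition accepted (g : greedy R) : bool := gok g && all (covered g) (iota 0 n).

Lemma acceptedP g : reflect (accepting n g) (accepted g).
Proof.
apply: (iffP andP) => -[ok /= h]; split=> //.
  by move=> i ni; apply: (allP h); rewrite mem_iota.
by apply/allP => i; rewrite mem_iota => /h.
Qed.

Definition cover_cost : nat :=
  forcost pivot_body + forcost flat_body + maxcost greedy_com + maxcost init_greedy +
  forcost (ISet 13 (var 2) (IConst 0)) + forcost all_covered_body +
  maxcost direction_com + 1000.

Lemma wp_try_cover s m t : iarr s 0 0 = n -> arr3 s 0 = x -> iarr s 6 0 = m ->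
  (forall j, j < m + m -> iarr s 10 j = t j) ->
  let g := greedy_run x n t m in
  wp try_cover (cover_cost * (n.+1 * m.+1))
    (fun s' => if accepted g then iarr s' 7 0 = 1 /\ arr3 s' 13 0 = direction g
               else iarr s' 7 0 = iarr s 7 0 /\ arr3 s' 13 0 = arr3 s 13 0) s.
Proof.
move=> sn sx sm st g.
set cg := forcost pivot_body + forcost flat_body + maxcost greedy_com + 100.
apply: (@wp_le _ _ _ (maxcost init_greedy +
  (forcost (ISet 13 (var 2) (IConst 0)) * n.+1 + (m * (cg * n.+1 + 20) + 20 +
  (forcost all_covered_body * n.+1 + maxcost direction_com).+1).+1).+1).+1).
  rewrite /cover_cost /cg.
  move: (maxcost _) (maxcost _) (maxcost _) (forcost _) (forcost _) (forcost _) (forcost _).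
  by move=> *; nia.
apply: wp_seq; apply: wp_run => //; set s1 := run _ _.
have [a1 b1 ok1] : [/\ arr3 s1 4 0 = vzero R, arr3 s1 7 0 = vzero R & iarr s1 15 0 = 1] by [].
have i1 d : (d == 15) = false -> iarr s1 d = iarr s d.
  by move=> h; apply: boolp.funext => i; rewrite /s1; cells; rewrite h.
have r1 d : d \in [:: 0; 1; 2; 13; 14; 15] -> rarr s1 d = rarr s d.
  by rewrite !inE => /orP[|/orP[|/orP[|/orP[|/orP[]]]]] /eqP ->.
move: s1 a1 b1 ok1 i1 r1 => s1 a1 b1 ok1 i1 r1.
apply: (@wp_bind _ _ _ _ _ (fun s' => forall i, i < n -> iarr s' 13 i = 0)).
  apply: (@wp_for_run _ _ _ _ _ (fun i s' => forall j, j < i -> iarr s' 13 j = 0)) => //.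
    by rewrite i1.
  move=> i s' iN _ si I1 j; rewrite ltnS leq_eqVlt; cells; rewrite si.
  by case: eqP => //= _ /I1.
move=> s2 [u2 v2] C2.
have r2 d : d \in [:: 0; 1; 2; 13; 14; 15] -> rarr s2 d = rarr s d.
  by move=> h; rewrite v2 // r1.
apply: (@wp_bind _ _ _ _ _ (greedy_rep g)).
  apply: (@wp_for _ _ _ _ _ _ (fun l => greedy_rep (greedy_run x n t l))) => //.
  - by rewrite u2 // i1.
  - split=> //.
    + by rewrite (arr3_eq (s := s1)) // v2.
    + by rewrite (arr3_eq (s := s1)) // v2.
    + by cells; rewrite u2 // ok1.
  move=> l s' lm [u v] sl rep.
  have di d : d \in [:: 0; 10] -> iarr s' d = iarr s d.
    by rewrite !inE => /orP[]/eqP ->; rewrite u // u2 // i1.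
  apply: (@wp_frame _ _ _ _ (greedy_rep (greedy_run x n t l.+1))).
    rewrite /=; apply: (wp_greedy (l := l)) rep => //.
    - by rewrite di.
    - by rewrite -sx (arr3_eq (s := s)) // v // r2.
    - by rewrite di // st //; lia.
    - by rewrite di // st //; lia.
  by move=> s'' _ [].
move=> s3 [u3 v3] rep3.
have r3 d : d \in [:: 0; 1; 2; 13; 14; 15] -> rarr s3 d = rarr s d.
  by move=> h; rewrite -r2 //; move: h; rewrite !inE => /orP[|/orP[|/orP[|/orP[|/orP[]]]]] /eqP ->; rewrite v3.
have [C3 A3 W3 ok3] := rep3.
apply: (@wp_bind _ _ _ _ _ (fun s' => iarr s' 15 0 = accepted g)).
  apply: (@wp_for_run _ _ _ _ _
     (fun i s' => iarr s' 15 0 = gok g && all (covered g) (iota 0 i))) => //.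
  - by rewrite u3 // u2 // i1.
  - by rewrite andbT.
  move=> i s' iN [u _] si I1; rewrite (_ : iota 0 i.+1 = iota 0 i ++ [:: i]); last by rewrite -(addn1 i) iotaD.
  rewrite all_cat [all _ [:: i]]/= andbT andbA.
  have et : teval s' (TILe (IGet 13 (var 2)) (IConst 0)) = ~~ covered g i.
    by cells; rewrite si (u 13) // C3 //; case: (covered g i).
  by rewrite run_if et; case: (covered g i); cells; rewrite ?andbT ?andbF.
move=> s4 [u4 v4] ok4; apply: wp_run => //.
have A4 : arr3 s4 4 0 = gA g by rewrite (arr3_eq (s := s3)) // v4.
have W4 : arr3 s4 7 0 = gW g by rewrite (arr3_eq (s := s3)) // v4.
rewrite /direction_com run_if.
have -> : teval s4 (TILe (IConst 1) (var 15)) = accepted g.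
  by rewrite /= ok4; case: (accepted g).
case: (boolP (accepted g)) => acc; last first.
  split; first by rewrite u4 // u3 // u2 // i1.
  by rewrite (arr3_eq (s := s)) // v4 // r3.
rewrite /direction /perp -A4 -W4.
set s5 := run (asg 7 (IConst 1)) s4.
have -> p q : run (Seq p q) s4 = run q (run p s4) by [].
rewrite -/s5 !run_if !teval_tle0 !reval_edot !evalE.
have -> : arr3 s5 7 = arr3 s4 7 by [].
rewrite [ieval _ _]/=; case: ifP => h; last by [].
set A := arr3 s4 4 0.
have -> : reval s5 (RAdd (RMul (RGet 5 (IConst 0)) (RGet 5 (IConst 0)))
    (RMul (RGet 6 (IConst 0)) (RGet 6 (IConst 0)))) =
  (A.1.2 * A.1.2 + A.2 * A.2)%R by [].
by case: ifP.
Qed.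

Lemma leq_find_cost m r : 0 < m -> m <= r -> r <= n ->
  n ^ (m + m) * (cover_cost * (n.+1 * m.+1) + enum_cost * (m + m).+1)
    + enum_cost * (n.+1 * (m + m).+1) <=
  (4 * cover_cost + 9 * enum_cost) * (n ^ (2 * r) * (n * r)).
Proof.
move=> m0 mr rn; set N := n ^ (2 * r).
have N0 : 0 < N by rewrite expn_gt0 n0.
have le : n ^ (m + m) <= N by rewrite leq_pexp2l //; lia.
(* These bounds come from [n.+1 <= 2 * n], [m.+1 <= 2 * r] and [(m + m).+1 <= 3 * r]; the factor 9
   is the sum 3 + 6 of the next two. *)
have h1 : n.+1 * m.+1 <= 4 * (n * r) by nia.
have h2 : (m + m).+1 <= 3 * (n * r) by nia.
have h3 : n.+1 * (m + m).+1 <= 6 * (n * r) by nia.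
apply: (@leq_trans (N * (cover_cost * (4 * (n * r)) + enum_cost * (3 * (n * r)))
  + N * (enum_cost * (6 * (n * r))))).
  apply: leq_add; first by rewrite leq_mul // leq_add // leq_mul.
  by apply: leq_trans (leq_pmull _ N0); rewrite leq_mul2l h3 orbT.
by apply: eq_leq; ring.
Qed.

Lemma wp_find_direction s r t : iarr s 0 0 = n -> arr3 s 0 = x ->
  0 < r <= n -> (forall j, t j < n) -> accepting n (greedy_run x n t r) ->
  wp find_direction ((4 * cover_cost + 9 * enum_cost + 200) * (n ^ (2 * r) * (n ^ 2 * r)))
    (fun s' => exists m, [/\ m <= r, iarr s' 6 0 = m,
        arr3 s' 13 0 != vzero R & on_lines x n (arr3 s' 13 0) m]) s.
Proof.
move=> sn sx /andP[r0 rn] tn acc; set K := 4 * cover_cost + 9 * enum_cost.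
set N := n ^ (2 * r); have N0 : 0 < N by rewrite expn_gt0 n0.
pose b : test := TILe (var 7) (IConst 0).
pose pre := Seq (asg 6 (IAdd (var 6) (IConst 1))) (asg 12 (IAdd (var 6) (var 6))).
apply: (@wp_le _ _ _ (maxcost (Seq (asg 6 (IConst 0)) (asg 7 (IConst 0))) +
   (r * ((maxcost pre + K * (N * (n * r))).+1 + (tcost b).+1) + (tcost b).+1)).+1).
  rewrite /pre /b /=; apply: (@leq_trans (K * (r * (N * (n * r))) + 100 * r)); first nia.
  rewrite mulnDl leq_add //; first by rewrite leq_mul2l; apply/orP; right; nia.
  by apply: (@leq_trans (200 * (1 * (1 * r)))); rewrite ?leq_mul //; nia.
apply: wp_seq; apply: wp_run => //; set s0 := run _ s.
pose sol (s' : state R) := exists m, [/\ m <= r, iarr s' 6 0 = m,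
        arr3 s' 13 0 != vzero R & on_lines x n (arr3 s' 13 0) m].
pose I i (s' : state R) := [/\ i <= r, iarr s' 6 0 = i &
  (iarr s' 7 0 = 0 /\ i < r) \/ (iarr s' 7 0 = 1 /\ sol s')].
apply: (@wp_while _ _ _ r _ I).
- by split=> //; left.
- by move=> i s' [].
- by move=> i s' _ [ir i6 [[i7 _]|[_ //]]]; rewrite /= i7.
move=> i s' [u v] [ir i6 [[i7 lir] _|[i7 _]]]; last by rewrite /= i7.
apply: wp_seq; apply: wp_run => //; set s1 := run pre s'.
have s1n : iarr s1 0 0 = n by rewrite -sn -[RHS](congr1 (fun h => h 0) (u 0 _)).
have s1x : arr3 s1 0 = x by rewrite (_ : arr3 s1 0 = arr3 s' 0) // (arr3_eq (s := s0)) // v.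
have s16 : iarr s1 6 0 = i.+1 by rewrite /s1; cells; rewrite i6 addn1.
have s112 : iarr s1 12 0 = i.+1 + i.+1 by rewrite /s1; cells; rewrite i6 addn1.
have s17 : iarr s1 7 0 = 0 by [].
move: s1 s1n s1x s16 s112 s17 => s1 s1n s1x s16 s112 s17.
pose J tau (s2 : state R) := 
  (iarr s2 7 0 = 0 /\ forall tau', tau' < tau ->
     ~~ accepted (greedy_run x n (digit n tau') i.+1)) \/
  (iarr s2 7 0 = 1 /\ exists t, accepted (greedy_run x n t i.+1) /\
     arr3 s2 13 0 = direction (greedy_run x n t i.+1)).
apply: (@wp_frame _ _ _ _ (J (n ^ (i.+1 + i.+1)))).
  apply: wp_le (leq_find_cost (m := i.+1) (r := r) isT lir rn) _.
  apply: wp_enum => //.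
  - move=> tau s2 s3 h1 h2; rewrite /J h1 // (arr3_eq (s := s2)) ?h2 //.
  - by left.
  move=> tau s2 tauN [u2 v2] d2 J2.
  apply: wp_frame.
    apply: (wp_try_cover (m := i.+1) (t := digit n tau)) => //.
    + by rewrite u2.
    + by rewrite (arr3_eq (s := s1)) // v2.
    + by rewrite u2.
  move=> s3 _ post; move: post; case: ifP => ac [e7 e13].
    by right; split=> //; exists (digit n tau).
  case: J2 => [[z7 nac]|[z7 [t' [ac' d']]]].
    left; rewrite e7; split=> // tau'; rewrite ltnS leq_eqVlt => /orP[/eqP ->|/nac //].
    by rewrite ac.
  by right; rewrite e7 e13; split=> //; exists t'.
move=> s2 [u2 v2] J2.
split=> //; first by rewrite u2.
case: J2 => [[z7 nac]|[z7 [t' [/acceptedP ac' d']]]]; [left|right]; split=> //.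
  (* Round [r] cannot fail: the first [2 r] entries of the accepted [t] are the digits of some
     enumerated number, and the greedy run depends on no others. *)
  rewrite ltn_neqAle lir andbT; apply/eqP => ei.
  have [tau tauN dt] := @digit_surj n (r + r) t (fun j _ => tn j).
  have := nac tau; rewrite ei => /(_ tauN) /negP; apply; apply/acceptedP.
  by rewrite (_ : greedy_run x n (digit n tau) r = greedy_run x n t r) //; exact: eq_greedy_run.
exists i.+1; split=> //; first by rewrite u2.
  by rewrite d' direction_neq0.
by rewrite d'; apply: accepting_on_lines.
Qed.
End FindDirection.

(** * Solving the cobipartite graph of a tuple *)

(* Integer arrays: 18 = candidates, 19 = upper candidates, 22 = reached, 23 =
   processed, 26 = selected, 42 = partners in the matching. Integer variables:
   12 = length of the tuple, 20 = position in the tuple, 21 = next entry of the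
   adjacency matrix, 27 = number of selected balls, 28 = size of the best clique
   so far, 30 = half the length of the tuple. Real arrays: 3 = radii, 16, 17,
   18 = [cross v x], 19 = [dot v x]. *)
Definition strip_test (i p q : iexp) : test :=
  let u := esub (entry 16 i) (entry 16 p) in
  let cr := ecross u (esub (entry 16 q) (entry 16 p)) in
  TAnd (TRLe (RGet 3 p) (RGet 3 i))
  (TAnd (TRLe (RGet 3 q) (RGet 3 i))
  (TAnd (tle0 (edot cr cr))
        (TRLe (RConst 0) (edot u (esub (entry 16 q) (entry 16 i)))))).

Definition above_test (i p q : iexp) : test :=
  let d := esub (entry 16 q) (entry 16 p) in
  TRLe (RConst 0)
    (RSub (RSub (RGet 19 i) (RGet 19 p))
          (RMul (RDiv (edot (esub (entry 16 i) (entry 16 p)) d) (edot d d))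
                (RSub (RGet 19 q) (RGet 19 p)))).

Definition adj_test (i j : iexp) : test :=
  let d := esub (entry 0 i) (entry 0 j) in
  let r := RAdd (RGet 3 i) (RGet 3 j) in
  TRLe (edot d d) (RMul r r).

Definition strip_body : com :=
  let p := IGet 10 (IAdd (var 20) (var 20)) in
  let q := IGet 10 (IAdd (IAdd (var 20) (var 20)) (IConst 1)) in
  If (strip_test (var 2) p q)
    (Seq (ISet 18 (var 2) (IConst 1))
      (If (above_test (var 2) p q) (ISet 19 (var 2) (IConst 1))
                                   (ISet 19 (var 2) (IConst 0))))
    Skip.
Definition adj_body : com :=
  If (adj_test (var 2) (IGet 10 (var 20))) Skip (ISet 18 (var 2) (IConst 0)).
Definition cand_row : com :=
  Seq (ISet 18 (var 2) (IConst 0)) (Seq (For 20 30 strip_body) (For 20 12 adj_body)).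
Definition cand_com : com := For 2 0 cand_row.

Definition edge_test (u w : iexp) : test :=
  TAnd (TILe (IConst 1) (IGet 18 u))
  (TAnd (TILe (IConst 1) (IGet 18 w)) (TNot (adj_test u w))).

(** A running index replaces the address [i * n + j], as integers cannot be multiplied. Arrays 40
    and 41 are the input arrays of the shifted matching program. *)
Definition fill_body : com :=
  Seq (If (edge_test (var 2) (var 3)) (ISet 41 (var 21) (IConst 1))
                                      (ISet 41 (var 21) (IConst 0)))
      (asg 21 (IAdd (var 21) (IConst 1))).
Definition fill_com : com :=
  Seq (Seq (asg 40 (var 0)) (asg 21 (IConst 0))) (For 2 0 (For 3 0 fill_body)).

Section Candidates.
Variables (R : realType) (n : nat) (x : nat -> vec R) (rho : nat -> R) (v : vec R).
Hypothesis n0 : 0 < n.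
Implicit Type s : state R.

Definition ctx s : Prop :=
  [/\ iarr s 0 0 = n, arr3 s 0 = x, rarr s 3 = rho,
      forall i, i < n -> arr3 s 16 i = cross v (x i) &
      forall i, i < n -> rarr s 19 i = dot v (x i)].

Lemma ctx_unch c s s' : ctx s -> unch c s s' ->
  ~~ [|| wri c 0, wrr c 0, wrr c 1, wrr c 2, wrr c 3, wrr c 16, wrr c 17,
      wrr c 18 | wrr c 19] -> ctx s'.
Proof.
move=> [c1 c2 c3 c4 c5] [u w].
rewrite !negb_or => /and5P[/negbTE h0 /negbTE h1 /negbTE h2 /negbTE h3].
move=> /and5P[/negbTE h4 /negbTE h5 /negbTE h6 /negbTE h7 /negbTE h8].
by split=> [|||i|i]; rewrite ?u ?(arr3_eq (s := s)) ?w //; [exact: c4|exact: c5].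
Qed.

Lemma strip_testE s (i p q : iexp) : ctx s ->
  ieval s i < n -> ieval s p < n -> ieval s q < n ->
  teval s (strip_test i p q) =
  in_strip x rho v (ieval s p) (ieval s q) (ieval s i).
Proof.
move=> [c1 c2 c3 c4 c5] hi hp hq; rewrite /in_strip /on_segment.
have e : teval s (strip_test i p q) =
  [&& (rarr s 3 (ieval s p) <= rarr s 3 (ieval s i))%R,
      (rarr s 3 (ieval s q) <= rarr s 3 (ieval s i))%R &
      on_segment (arr3 s 16 (ieval s p)) (arr3 s 16 (ieval s q)) (arr3 s 16 (ieval s i))].
  by [].
by rewrite e c3 !c4.
Qed.

Lemma above_testE s (i p q : iexp) : ctx s ->
  ieval s i < n -> ieval s p < n -> ieval s q < n ->
  teval s (above_test i p q) =
  above x v (ieval s p) (ieval s q) (ieval s i).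
Proof.
move=> [c1 c2 c3 c4 c5] hi hp hq; rewrite /above /ratio.
rewrite -!c4 // -!c5 //.
Qed.

Lemma adj_testE s (i j : iexp) : ctx s ->
  teval s (adj_test i j) = adj x rho (ieval s i) (ieval s j).
Proof. by move=> [_ <- <- _ _]; rewrite /adj expr2. Qed.

Section Tuple.
Variables (t : nat -> nat) (mk : nat).
Hypothesis tn : forall j, t j < n.

Definition tstrip c i : bool := in_strip x rho v (t (c + c)) (t (c + c).+1) i.
(** Wrong guesses do no harm: for every tuple the non-adjacent pairs of candidates form a bipartite
    graph, so what is selected is a clique. *)
Definition cand i : bool :=
  has (fun c => tstrip c i) (iota 0 mk) &&
  all (fun j => adj x rho i (t j)) (iota 0 (mk + mk)).

Definition cand_cost : nat :=
  forcost strip_body + forcost adj_body + forcost adj_body + 200.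

Lemma iota0S j : iota 0 j.+1 = iota 0 j ++ [:: j].
Proof. by rewrite -(addn1 j) iotaD. Qed.

(** A candidate may lie in several strips. The stored side refers to the last one the program met,
    and [same_side_adj] allows any choice of strip for each ball. *)
Definition upper_ok s i : Prop :=
  cand i -> exists c, [/\ c < mk, tstrip c i &
    iarr s 19 i = above x v (t (c + c)) (t (c + c).+1) i].

Lemma wp_cand_row s i : ctx s -> i < n -> iarr s 2 0 = i ->
  iarr s 30 0 = mk -> iarr s 12 0 = mk + mk ->
  (forall j, j < mk + mk -> iarr s 10 j = t j) ->
  wp cand_row (cand_cost * mk.+1)
    (fun s' => [/\ iarr s' 18 i = cand i, upper_ok s' i &
       forall j, j != i -> iarr s' 18 j = iarr s 18 j /\ iarr s' 19 j = iarr s 19 j]) s.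
Proof.
move=> cs ni si smk sL st.
apply: (@wp_le _ _ _ (maxcost (ISet 18 (var 2) (IConst 0)) +
   (forcost strip_body * mk.+1 + forcost adj_body * (mk + mk).+1).+1).+1).
  by rewrite /cand_cost /=; move: (forcost _) (forcost _) => *; nia.
apply: wp_seq; apply: wp_run => //; set s1 := run _ s.
have z1 : iarr s1 18 i = 0 by rewrite /s1; cells; rewrite si eqxx.
have o1 j : j != i -> iarr s1 18 j = iarr s 18 j.
  by rewrite /s1; cells; rewrite si => /negbTE ->.
have c1 : ctx s1 by [].
have e1 d : (d == 18) = false -> iarr s1 d = iarr s d.
  by move=> h; apply: boolp.funext => j; rewrite /s1; cells; rewrite h.
move: s1 z1 o1 c1 e1 => s1 z1 o1 c1 e1.
pose I1 c (s' : state R) := [/\ iarr s' 18 i = has (fun c => tstrip c i) (iota 0 c),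
  (has (fun c => tstrip c i) (iota 0 c) -> exists c', [/\ c' < c, tstrip c' i &
    iarr s' 19 i = above x v (t (c' + c')) (t (c' + c').+1) i]) &
  forall j, j != i -> iarr s' 18 j = iarr s 18 j /\ iarr s' 19 j = iarr s 19 j].
apply: (@wp_bind _ _ _ _ _ (I1 mk)).
  apply: wp_for_run => //; first by rewrite e1.
    by split=> // j ji; rewrite -o1 // -e1.
  move=> c s' cmk us sc [h1 h2 h3]; have [u w] := us.
  have cs' : ctx s' by apply: ctx_unch c1 us _.
  have d2 : iarr s' 2 0 = i by rewrite u // e1.
  have dp : ieval s' (IGet 10 (IAdd (var 20) (var 20))) = t (c + c).
    by rewrite /= sc u // e1 // st //; lia.
  have dq : ieval s' (IGet 10 (IAdd (IAdd (var 20) (var 20)) (IConst 1))) = t (c + c).+1.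
    by rewrite /= sc u // e1 // addn1 st //; lia.
  rewrite /strip_body run_if strip_testE ?dp ?dq ?[ieval _ (var 2)]/= ?d2 // -/(tstrip c i).
  rewrite /I1 !iota0S has_cat [has _ [:: c]]/= orbF.
  case: (boolP (tstrip c i)) => tc; last first.
    rewrite orbF; cells; split=> // /h2[c' [lt tc' e']].
    by exists c'; split=> //; exact: ltnW.
  rewrite run_seq run_if; set s2 := run (ISet 18 _ _) s'.
  rewrite (above_testE (s := s2)) //; last first.
  - by rewrite [ieval _ _]dq.
  - by rewrite [ieval _ _]dp.
  - by rewrite [ieval _ _]d2.
  have -> : ieval s2 (IGet 10 (IAdd (IAdd (var 20) (var 20)) (IConst 1))) = t (c + c).+1 := dq.
  have -> : ieval s2 (IGet 10 (IAdd (var 20) (var 20))) = t (c + c) := dp.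
  have -> : ieval s2 (var 2) = i := d2.
  have d22 : iarr s2 2 0 = i := d2.
  rewrite orbT; split.
  - by case: ifP => _; rewrite /s2; cells; rewrite d2 eqxx.
  - move=> _; exists c; split=> //.
    by case: ifP => ab; cells; rewrite d2 eqxx.
  - move=> j ji; have [<- <-] := h3 _ ji.
    by case: ifP => ab; rewrite /s2; cells; rewrite d2 (negbTE ji).
move=> s2 us2 [h1 h2 h3]; have [u2 w2] := us2.
have c2 : ctx s2 by apply: ctx_unch c1 us2 _.
pose I2 j (s' : state R) := iarr s' 18 i =
    (has (fun c => tstrip c i) (iota 0 mk) && all (fun j => adj x rho i (t j)) (iota 0 j)) /\
  forall j, j != i -> iarr s' 18 j = iarr s 18 j.
apply: (@wp_frame _ _ _ _ (I2 (mk + mk))).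
  apply: wp_for_run => //; first by rewrite u2 // e1.
    by split=> [|j /h3[]//]; rewrite andbT.
  move=> j s' jm us sj [I3 I4]; have [u w] := us.
  have cs' : ctx s' by apply: ctx_unch c2 us _.
  have d2 : iarr s' 2 0 = i by rewrite u // u2 // e1.
  have dj : ieval s' (IGet 10 (var 20)) = t j by rewrite /= sj u // u2 // e1 // st.
  rewrite /adj_body run_if adj_testE // dj [ieval _ _]/= d2.
  rewrite /I2 iota0S all_cat [all _ [:: j]]/= andbT andbA.
  case: ifP => aj; rewrite ?andbT ?andbF; cells; rewrite ?d2 ?eqxx; split=> //.
  by move=> j' /[dup] ji /negbTE ->; apply: I4.
move=> s3 [u3 w3] [h4 h5]; split=> //.
  move=> /andP[/h2[c [cm tc e]] _]; exists c; split=> //.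
  by rewrite u3.
by move=> j ji; rewrite h5 // u3 //; split=> //; case: (h3 _ ji).
Qed.

Lemma wp_cand s : ctx s ->
  iarr s 30 0 = mk -> iarr s 12 0 = mk + mk ->
  (forall j, j < mk + mk -> iarr s 10 j = t j) ->
  wp cand_com ((cand_cost + 40) * (n.+1 * mk.+1))
    (fun s' => forall i, i < n -> iarr s' 18 i = cand i /\ upper_ok s' i) s.
Proof.
move=> cs smk sL st; have [sn _ _ _ _] := cs.
apply: (@wp_le _ _ _ (n * (cand_cost * mk.+1 + 20) + 20)); first nia.
apply: (@wp_for _ _ _ _ _ _
  (fun i s' => forall j, j < i -> iarr s' 18 j = cand j /\ upper_ok s' j)) => //.
move=> i s' iN us si Ii; have [u w] := us.
apply: wp_frame.
  apply: (wp_cand_row (i := i)) => //.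
  - exact: ctx_unch cs us _.
  - by rewrite u.
  - by rewrite u.
  - by move=> j jm; rewrite u // st.
move=> s2 _ [h1 h2 h3] j; rewrite ltnS leq_eqVlt => /orP[/eqP -> //|ji].
have [|e1 e2] := h3 j; first by rewrite neq_ltn ji.
have [I1 I2] := Ii j ji; split; first by rewrite [LHS]e1.
by move=> /I2[c [? ? e]]; exists c; split=> //; rewrite [LHS]e2.
Qed.

Definition edge i j : bool := [&& cand i, cand j & ~~ adj x rho i j].

Lemma edge_testE s (i j : iexp) : ctx s ->
  (forall i, i < n -> iarr s 18 i = cand i) -> ieval s i < n -> ieval s j < n ->
  teval s (edge_test i j) = edge (ieval s i) (ieval s j).
Proof.
move=> cs hc hi hj; rewrite /edge -(adj_testE _ _ cs) /= !hc //.
by case: (cand (ieval s i)); case: (cand (ieval s j)).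
Qed.

Lemma wp_fill s : ctx s -> (forall i, i < n -> iarr s 18 i = cand i) ->
  wp fill_com ((forcost fill_body + 100) * (n.+1 * n.+1))
    (fun s' => iarr s' 40 0 = n /\
       forall i j, i < n -> j < n -> iarr s' 41 (i * n + j) = edge i j) s.
Proof.
move=> cs hc; have [sn _ _ _ _] := cs; set cf := forcost _.
apply: (@wp_le _ _ _ (maxcost (Seq (asg 40 (var 0)) (asg 21 (IConst 0))) +
   (n * (cf * n.+1 + 20) + 20)).+1); first by rewrite /=; nia.
apply: wp_seq; apply: wp_run => //; set s1 := run _ s.
have c1 : ctx s1 by [].
have hc1 : forall i, i < n -> iarr s1 18 i = cand i by [].
have e40 : iarr s1 40 0 = n by [].
have e21 : iarr s1 21 0 = 0 by [].
move: s1 c1 hc1 e40 e21 => s1 c1 hc1 e40 e21; have [sn1 _ _ _ _] := c1.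
(* One invariant for both loops: the matrix is viewed as a flat array, and entry [k] belongs to the
   pair of quotient and remainder of [k] by [n]. *)
pose I q (s' : state R) := iarr s' 21 0 = q /\
  forall k, k < q -> iarr s' 41 k = edge (k %/ n) (k %% n).
apply: (@wp_frame _ _ _ _ (I (n * n))); last first.
  move=> s2 [u2 w2] [_ h]; split=> [|i j ni nj]; first by rewrite u2.
  rewrite h; first by rewrite divnMDl // divn_small // addn0 modnMDl modn_small.
  apply: (@leq_trans (i.+1 * n)); first by rewrite mulSnr ltn_add2l.
  by rewrite leq_mul2r ni orbT.
apply: (@wp_for _ _ _ _ _ _ (fun i => I (i * n))) => //.
move=> i s2 iN us2 si2 I2; have [u2 w2] := us2.
apply: (@wp_frame _ _ _ _ (I (i * n + n))); last first.
  by move=> s3 _ [h1 h2]; rewrite mulSnr; split.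
apply: (@wp_for_run _ _ _ _ _ (fun j => I (i * n + j))) => //.
- by rewrite u2.
- by rewrite addn0.
move=> j s3 jn us3' sj3 [I31 I32]; have [u3 w3] := us3'.
have us3 := unch_trans us2 (unch_for 2 0 us3').
have c3 : ctx s3 by apply: ctx_unch c1 us3 _.
have hc3 i' : i' < n -> iarr s3 18 i' = cand i' by move=> ni; rewrite us3.1 // hc1.
have si3 : iarr s3 2 0 = i by rewrite u3.
rewrite /fill_body run_seq run_if edge_testE // ?[ieval _ (var 2)]/= ?[ieval _ (var 3)]/=
  ?si3 ?sj3 //.
rewrite /I addnS; split; first by case: ifP => _; cells; rewrite I31 addn1.
move=> k; rewrite ltnS leq_eqVlt => /orP[/eqP ->|lk].
  rewrite divnMDl // divn_small // addn0 modnMDl modn_small //.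
  by case: ifP => ed; cells; rewrite I31 eqxx.
by case: ifP => ed; cells; rewrite I31 (ltn_eqF lk) I32.
Qed.

End Tuple.
End Candidates.

(** * Alternating reachability and selection of a maximum independent set *)

Definition init_reach_body : com :=
  Seq (ISet 23 (var 2) (IConst 0))
  (If (TAnd (TILe (IConst 1) (IGet 19 (var 2))) (TILe (var 0) (IGet 42 (var 2))))
      (ISet 22 (var 2) (IConst 1)) (ISet 22 (var 2) (IConst 0))).
Definition pending_test (a : iexp) : test :=
  TAnd (TILe (IConst 1) (IGet 22 a))
  (TAnd (TILe (IConst 1) (IGet 19 a)) (TILe (IGet 23 a) (IConst 0))).
Definition pick_body : com := If (pending_test (var 2)) (asg 24 (var 2)) Skip.
(** A neighbor is marked together with its matching partner, so the marks stay closed under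
    [ReachBack] and only upper vertices ever wait for processing. *)
Definition relax_body : com :=
  If (edge_test (var 24) (var 3))
    (Seq (ISet 22 (var 3) (IConst 1))
      (If (tlt (IGet 42 (var 3)) (var 0)) (ISet 22 (IGet 42 (var 3)) (IConst 1)) Skip))
    Skip.
(** One round processes at most one waiting vertex; the value [n] in variable 24 encodes that there
    is none. Each productive round processes a new vertex, so [n] rounds of linear cost suffice. *)
Definition round_com : com :=
  Seq (asg 24 (var 0)) (Seq (For 2 0 pick_body)
  (If (tlt (var 24) (var 0))
      (Seq (ISet 23 (var 24) (IConst 1)) (For 3 0 relax_body)) Skip)).
Definition reach_com : com := Seq (For 2 0 init_reach_body) (For 25 0 round_com).

(** The equivalence of [up] and [z], spelled out because tests have no disjunction. *)
Definition sel_test : test :=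
  let up := TILe (IConst 1) (IGet 19 (var 2)) in
  let z := TILe (IConst 1) (IGet 22 (var 2)) in
  TAnd (TILe (IConst 1) (IGet 18 (var 2)))
    (TNot (TAnd (TNot (TAnd up z)) (TNot (TAnd (TNot up) (TNot z))))).
Definition select_body : com :=
  If sel_test (Seq (ISet 26 (var 2) (IConst 1)) (asg 27 (IAdd (var 27) (IConst 1))))
              (ISet 26 (var 2) (IConst 0)).
Definition select_com : com := Seq (asg 27 (IConst 0)) (For 2 0 select_body).

Section Reach.
Variables (R : realType) (n : nat) (x : nat -> vec R) (rho : nat -> R) (v : vec R).
Hypothesis n0 : 0 < n.
Variables (t : nat -> nat) (mk : nat).
Hypothesis tn : forall j, t j < n.
Implicit Type s : state R.
Local Notation ctx := (ctx n x rho v).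
Local Notation cand := (cand x rho v t mk).
Local Notation edge := (edge x rho v t mk).
Local Notation upper_ok := (upper_ok x rho v t mk).

Definition gedge : rel 'I_n := fun i j => edge i j.
Definition nz s a (i : 'I_n) : bool := iarr s a i != 0.
Definition cand_ok s : Prop := forall i, i < n -> iarr s 18 i = cand i.

Lemma gedge_sym : symmetric gedge.
Proof. by move=> i j; rewrite /gedge /edge adj_sym; case: (cand i); case: (cand j). Qed.

Lemma gedge_irr : irreflexive gedge.
Proof. by move=> i; rewrite /gedge /edge adj_refl !andbF. Qed.

Lemma gedge_color s : v != vzero R -> (forall i, i < n -> (0 <= rho i)%R) ->
  (forall i, i < n -> upper_ok s i) ->
  forall i j, gedge i j -> nz s 19 i != nz s 19 j.
Proof.
move=> v0 rho0 up i j /and3P[ci cj nadj]; apply: contra nadj => /eqP.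
have [a [am si ei]] := up i (ltn_ord i) ci.
have [b [bm sj ej]] := up j (ltn_ord j) cj.
have adjt k l : cand k -> l < mk + mk -> adj x rho k (t l).
  by move=> /andP[_ /allP h] lm; apply: h; rewrite mem_iota.
rewrite /nz ei ej => eab.
apply: (same_side_adj v0 _ _ _ _ _ _ si sj) => //; try exact: rho0; try (apply: adjt => //; lia).
by move: eab; do 2!case: above.
Qed.

Section Closure.
Variables (s0 : state R) (M : {set {set 'I_n}}).
Hypotheses (maxM : maximum_matching gedge M)
  (mateM : forall i j : 'I_n, (iarr s0 42 i == j) = ([set i; j] \in M))
  (col : forall i j, gedge i j -> nz s0 19 i != nz s0 19 j)
  (c0 : ctx s0) (cand0 : cand_ok s0).

Let c (i : 'I_n) := nz s0 19 i.
Local Notation rch := (reach gedge c M).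

Lemma unmatchedP i : reflect (unmatched M i) (n <= iarr s0 42 i).
Proof.
apply: (iffP idP) => [le j|un].
  by rewrite -mateM gtn_eqF // (leq_trans (ltn_ord j)).
rewrite leqNgt; apply/negP => lt; have := un (Ordinal lt).
by rewrite -mateM /= eqxx.
Qed.

(** The first clause is soundness; the others are the closure conditions of [reach], the one for
    edges being restricted to processed vertices. When nothing is pending, the marks are exactly the
    reachable vertices. *)
Definition closure_inv s : Prop :=
  [/\ forall a, nz s 22 a -> rch a,
      forall a, c a -> unmatched M a -> nz s 22 a,
      forall w u, nz s 22 w -> ~~ c w -> [set w; u] \in M -> nz s 22 u &
      forall a w, nz s 23 a -> gedge a w -> nz s 22 w].

Definition pending s a : bool := [&& nz s 22 a, c a & ~~ nz s 23 a].

Lemma pending_testE s (e : iexp) (a : 'I_n) : ieval s e = a ->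
  iarr s 19 = iarr s0 19 -> teval s (pending_test e) = pending s a.
Proof.
by move=> ea e19; rewrite /= /pending /nz /c /nz ea e19 leqn0 negbK !lt0n.
Qed.

Lemma run_relax s (u w : 'I_n) : ctx s -> cand_ok s -> iarr s 42 = iarr s0 42 ->
  iarr s 24 0 = u -> iarr s 3 0 = w ->
  forall a : 'I_n, nz (run relax_body s) 22 a =
    nz s 22 a || gedge u w && ((a == w) || ([set w; a] \in M)).
Proof.
move=> cs hc e42 su sw a; have [sn _ _ _ _] := cs.
rewrite /relax_body run_if (edge_testE cs hc) ?[ieval _ (var 24)]/= ?[ieval _ (var 3)]/=
  ?su ?sw ?ltn_ord //.
rewrite -/(gedge u w); case: (gedge u w) => /=; last by rewrite orbF.
rewrite -mateM -val_eqE /= !(eq_sym _ (val a)) /nz; cells; rewrite sn sw e42 -ltnNge.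
case: ltnP => h; cells; rewrite ?sw ?e42.
  by case: (val a == _); case: (val a == val w); rewrite ?orbT ?orbF.
rewrite (@ltn_eqF a (iarr s0 42 w)) ?orbF; last exact: leq_trans (ltn_ord a) h.
by case: (val a == val w); rewrite ?orbT ?orbF.
Qed.

(** The progress measure: either [i] vertices have been processed or the closure is complete. After
    [n] rounds both alternatives exclude pending vertices. *)
Definition round_post i s : Prop :=
  closure_inv s /\ (i <= #|[set a | nz s 23 a]| \/ forall a, ~~ pending s a).

Definition round_cost : nat := forcost pick_body + forcost relax_body + 100.

Lemma wp_round i s : unch reach_com s0 s -> round_post i s ->
  wp round_com (round_cost * n.+1) (round_post i.+1) s.
Proof.
move=> us [[I1 I2 I3 I4] Ip]; have [u w] := us.
have cs : ctx s by apply: ctx_unch c0 us _.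
have [sn _ _ _ _] := cs.
apply: (@wp_le _ _ _ (maxcost (asg 24 (var 0)) + (forcost pick_body * n.+1 +
  (tcost (tlt (var 24) (var 0)) +
   (maxcost (ISet 23 (var 24) (IConst 1)) + forcost relax_body * n.+1).+1).+1).+1).+1).
  by rewrite /round_cost /=; nia.
apply: wp_seq; apply: wp_run => //; set s1 := run _ s.
pose J k (s' : state R) :=
  (iarr s' 24 0 = n /\ forall a : 'I_n, a < k -> ~~ pending s a) \/
  (exists2 a : 'I_n, iarr s' 24 0 = a & pending s a).
apply: (@wp_bind _ _ _ _ _ (J n)).
  apply: wp_for_run => //; first by left.
  move=> k s2 kn [u2 w2] s2k Jk.
  rewrite /pick_body run_if (pending_testE (a := Ordinal kn)) //; last first.
    by rewrite u2 // -u.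
  have -> : pending s2 (Ordinal kn) = pending s (Ordinal kn).
    by rewrite /pending /nz !u2.
  case: ifP => pd; first by right; exists (Ordinal kn) => //; cells.
  case: Jk => [[e24 np]|Jk]; last by right.
  left; split=> // a; rewrite ltnS leq_eqVlt => /orP[/eqP ak|/np //].
  by rewrite -(_ : Ordinal kn = a) ?pd //; apply: val_inj.
move=> s2 us2 J2; have [u2 w2] := us2.
have s2u d : d \in [:: 0; 18; 19; 22; 23; 42] -> iarr s2 d = iarr s d.
  by rewrite !inE => /orP[|/orP[|/orP[|/orP[|/orP[]]]]] /eqP ->; rewrite u2.
have cs2 : ctx s2 by apply: (ctx_unch (s := s1)) us2 _.
have inv2 : closure_inv s2.
  have e22 := s2u 22 isT; have e23 := s2u 23 isT.
  by split; rewrite /nz ?e22 ?e23.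
have pd2 a : pending s2 a = pending s a by rewrite /pending /nz !s2u.
have [sn2 _ _ _ _] := cs2.
apply: wp_if => tb; last first.
  exists 1, s2; split; [constructor|lia|].
  split=> //; case: J2 => [[_ np]|[a ea pa]]; last first.
    by move: tb; rewrite /= ea sn2 -ltnNge ltn_ord.
  by right=> a; rewrite pd2; apply: np.
case: J2 => [[e24 _]|[a ea pa]]; first by move: tb; rewrite /= e24 sn2 leqnn.
apply: wp_seq; apply: wp_run => //; set s3 := run _ s2.
have [za' ca da] := and3P pa.
have za : nz s2 22 a by rewrite /nz s2u.
have e3 d : d != 23 -> iarr s3 d = iarr s2 d.
  by move=> /negbTE h; apply: boolp.funext => k; rewrite /s3; cells; rewrite h.
have d3 b : nz s3 23 b = (b == a) || nz s2 23 b.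
  by rewrite /nz /s3; cells; rewrite ea val_eqE; case: (b == a).
have cs3 : ctx s3 by [].
have z3 b : nz s3 22 b = nz s2 22 b by [].
move: s3 e3 d3 cs3 z3 => s3 e3 d3 cs3 z3.
have [sn3 _ _ _ _] := cs3.
have hc3 : cand_ok s3 by move=> k kn; rewrite e3 // s2u // u // cand0.
have [K1 K2 K3 K4] := inv2.
pose J3 k (s' : state R) := [/\ forall b, nz s' 22 b -> rch b,
   forall b, nz s2 22 b -> nz s' 22 b,
   forall w u, nz s' 22 w -> ~~ c w -> [set w; u] \in M -> nz s' 22 u &
   forall b : 'I_n, b < k -> gedge a b -> nz s' 22 b].
apply: (@wp_frame _ _ _ _ (J3 n)); last first.
  move=> s4 [u4 w4] [L1 L2 L3 L4].
  have d4 b : nz s4 23 b = (b == a) || nz s2 23 b by rewrite -d3 /nz u4.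
  split.
    split=> //; first by move=> b cb ub; apply/L2/K2.
    move=> b b'; rewrite d4 => /orP[/eqP ->|nb] eb; first by apply: L4.
    by apply: L2; apply: K4 nb eb.
  case: Ip => [le|np]; last by move: (np a); rewrite pa.
  left; have -> : [set b | nz s4 23 b] = a |: [set b | nz s 23 b].
    by apply/setP => b; rewrite !inE d4 /nz s2u.
  by rewrite cardsU1 inE (negbTE da).
apply: wp_for_run => //.
  have zz b : nz (iset s3 3 0 0) 22 b = nz s2 22 b := z3 b.
  by split=> [b|b|b b'|//]; rewrite !zz; [exact: K1| |exact: K3].
move=> k s4 kn us4 sk [L1 L2 L3 L4]; have [u4 w4] := us4.
have cs4 : ctx s4 by apply: ctx_unch cs3 us4 _.
have hc4 : cand_ok s4 by move=> j jn; rewrite u4 // hc3.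
have rr := @run_relax s4 a (Ordinal kn) cs4 hc4.
have {}rr := rr ltac:(by rewrite u4 // e3 // s2u // u).
have {}rr := rr ltac:(by rewrite u4 // e3) sk.
have zS b : nz (iset (run relax_body s4) 3 0 k.+1) 22 b = _ := rr b.
have colE b b' : c b -> gedge b b' -> ~~ c b'.
  by move=> cb /col; rewrite -/(c b) -/(c b') cb; case: (c b').
have mE b b' : [set b; b'] \in M -> gedge b b'.
  exact: (matching_edge (c := c) gedge_sym col maxM.1).
split=> [b|b zb|b b'|b].
- rewrite zS => /orP[/L1 //|/andP[eaw /orP[/eqP ->|wb]]].
    by apply: ReachEdge ca eaw; exact: L1 (L2 _ za).
  apply: (@ReachBack _ _ _ _ (Ordinal kn)) wb; last exact: colE ca eaw.
  by apply: ReachEdge ca eaw; exact: L1 (L2 _ za).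
- by rewrite zS L2.
- rewrite !zS => /orP[zb cb bb'|/andP[eaw /orP[/eqP ->|wb]] cb bb'].
  + by rewrite (L3 _ _ zb cb bb').
  + by rewrite eaw bb' !orbT.
  (* The partner of the lower vertex just marked is an upper vertex, so it cannot be the lower
     vertex assumed here. *)
  + have /negP[] := cb; have := colE _ _ ca eaw; have := col (mE _ _ wb).
    by rewrite -/(c b) -/(c (Ordinal kn)); case: (c b) => //; case: (c _).
- rewrite ltnS leq_eqVlt zS => /orP[/eqP bk|bk] eb.
    have -> : b = Ordinal kn by apply: val_inj.
    by rewrite -(_ : b = Ordinal kn) ?eb ?eqxx ?orbT //; apply: val_inj.
  by rewrite (L4 b).
Qed.

Lemma wp_reach : wp reach_com
  ((round_cost + forcost init_reach_body + 100) * (n.+1 * n.+1))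
  (fun s => forall a, nz s 22 a <-> rch a) s0.
Proof.
have [sn _ _ _ _] := c0.
apply: (@wp_le _ _ _ (forcost init_reach_body * n.+1 +
  (n * (round_cost * n.+1 + 20) + 20)).+1); first nia.
pose J k s := forall a : 'I_n, a < k ->
  nz s 22 a = c a && (n <= iarr s0 42 a) /\ nz s 23 a = false.
apply: (@wp_bind _ _ _ _ _ (J n)).
  apply: wp_for_run => // k s kn [u w] sk Jk a.
  rewrite ltnS leq_eqVlt => /orP[/eqP ak|ak].
    have et : teval (run (ISet 23 (var 2) (IConst 0)) s)
        (TAnd (TILe (IConst 1) (IGet 19 (var 2))) (TILe (var 0) (IGet 42 (var 2)))) =
        c a && (n <= iarr s0 42 a).
      by cells; rewrite sk -ak !u // sn /c /nz lt0n.
    rewrite /init_reach_body run_seq run_if et; split.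
      by rewrite /nz; case: ifP => _; cells; rewrite sk ak eqxx.
    by rewrite /nz; case: ifP => _; cells; rewrite sk ak eqxx.
  have [<- <-] := Jk a ak.
  by rewrite /init_reach_body run_seq run_if /nz; case: ifP => _; cells;
    rewrite sk (ltn_eqF ak).
move=> s1 us1 J1; have [u1 w1] := us1.
apply: (@wp_frame _ _ _ _ (round_post n)); last first.
  move=> s2 _ [[I1 I2 I3 I4] Ip].
  have np a : ~~ pending s2 a.
    case: Ip => [le|//]; rewrite /pending.
    suff -> : nz s2 23 a by rewrite !andbF.
    have : [set b | nz s2 23 b] = [set: 'I_n].
      by apply/eqP; rewrite eqEcard subsetT cardsT card_ord le.
    by move/setP/(_ a); rewrite !inE.
  move=> a; split; first exact: I1.
  elim=> {a} [a ca ua|a b _ za ca eab|a b _ za ca ab]; first exact: I2.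
    apply: I4 eab; move: (np a); rewrite /pending za ca /=.
    by rewrite negbK.
  exact: I3 ab.
apply: wp_for => //; first by rewrite u1.
  split; last by left.
  have z1 b : nz (iset s1 25 0 0) 22 b = c b && (n <= iarr s0 42 b) := (J1 b (ltn_ord b)).1.
  have d1 b : nz (iset s1 25 0 0) 23 b = false := (J1 b (ltn_ord b)).2.
  split=> [a|a|a b|a b].
  - by rewrite z1 => /andP[ca /unmatchedP ua]; exact: ReachFree.
  - by move=> ca /unmatchedP ua; rewrite z1 ca.
  - by rewrite z1 => /andP[-> _].
  - by rewrite d1.
move=> k s kn us sk rk.
apply: (@wp_frame _ _ _ _ (round_post k.+1)).
  apply: wp_round rk.
  exact: unch_trans (unch_seql _ us1) (unch_seqr _ us).
by move=> s2 _ [[I1 I2 I3 I4] Ip]; split.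
Qed.

(** Non-candidates are isolated in [gedge]. Adding all of them to a clique of candidates keeps it
    independent, and in the comparison with the independent set given by [koenig] their number
    cancels. *)
Lemma closure_optimal (Z : pred 'I_n)
    (S := [set i : 'I_n | cand i && (c i == Z i)]) :
  (forall a, Z a <-> rch a) ->
  {in S &, forall i j : 'I_n, adj x rho i j} /\
  forall K : {set 'I_n}, {in K &, forall i j : 'I_n, adj x rho i j} ->
    (forall i : 'I_n, i \in K -> cand i) -> #|K| <= #|S|.
Proof.
move=> hZ; have [ind opt] := koenig gedge_sym col maxM hZ.
set S' := [set _ | _] in ind opt; pose N := [set i : 'I_n | ~~ cand i]; split.
  move=> i j; rewrite !inE => /andP[ci Si] /andP[cj Sj].
  have := ind i j; rewrite !inE Si Sj => /(_ isT isT).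
  by rewrite /gedge /edge ci cj negbK.
move=> K cK candK.
have indKN : independent gedge (K :|: N).
  move=> i j; rewrite !inE /gedge /edge => /orP[iK|/negbTE -> //] /orP[jK|/negbTE ->];
    last by rewrite andbF.
  by rewrite !candK // cK.
have dKN : [disjoint K & N].
  by apply/pred0P => i /=; apply/andP => -[/candK ci]; rewrite inE ci.
have := opt _ indKN; rewrite cardsU (disjoint_setI0 dKN) cards0 subn0 => le.
have : #|S'| <= #|S| + #|N|.
  apply: leq_trans (leq_card_setU S N); apply: subset_leq_card.
  by apply/subsetP => i; rewrite !inE => ->; rewrite andbT orbN.
by move=> le2; have := leq_trans le le2; rewrite leq_add2r.
Qed.

End Closure.

Definition selb s (i : 'I_n) : bool := cand i && (nz s 19 i == nz s 22 i).

Lemma sum_nat_card (P : pred 'I_n) (g : nat -> nat) :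
  (forall i : 'I_n, g i = P i) -> \sum_(0 <= j < n) g j = #|[set i | P i]|.
Proof.
move=> h; rewrite big_mkord -sum1_card (eq_bigr (fun i => nat_of_bool (P i))) //.
by rewrite -big_mkcond; apply: eq_bigl => i; rewrite inE.
Qed.

Lemma wp_select s : iarr s 0 0 = n -> cand_ok s ->
  wp select_com ((forcost select_body + 100) * n.+1)
    (fun s' => (forall i, nz s' 26 i = selb s i) /\
       iarr s' 27 0 = #|[set i | selb s i]|) s.
Proof.
move=> sn hc.
apply: (@wp_le _ _ _ (maxcost (asg 27 (IConst 0)) + forcost select_body * n.+1).+1).
  by rewrite /=; nia.
apply: wp_seq; apply: wp_run => //; set s1 := run _ s.
pose b j := cand j && ((iarr s 19 j != 0) == (iarr s 22 j != 0)).
pose J k (s' : state R) := (forall i, i < k -> (iarr s' 26 i != 0) = b i) /\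
   iarr s' 27 0 = \sum_(0 <= j < k) b j.
apply: (@wp_frame _ _ _ _ (J n)); last first.
  move=> s2 _ [h1 h2]; split; first by move=> i; rewrite /nz h1.
  by rewrite h2; apply: sum_nat_card.
apply: wp_for_run => //; first by split=> //; rewrite big_geq.
move=> k s2 kn [u w] sk [I1 I2].
have e d : d \in [:: 18; 19; 22] -> iarr s2 d = iarr s d.
  by rewrite !inE => /orP[|/orP[]] /eqP ->; rewrite u.
have et : teval s2 sel_test = b k.
  rewrite /= sk !e // hc // /b !lt0n.
  by case: (cand k); case: (iarr s 19 k == 0); case: (iarr s 22 k == 0).
rewrite /select_body run_if et /J big_nat_recr //= -I2; split.
  move=> i; rewrite ltnS leq_eqVlt => /orP[/eqP ->|ik].
    by case bk: (b k); cells; rewrite sk eqxx.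
  by case bk: (b k); cells; rewrite sk (ltn_eqF ik) I1.
by case bk: (b k); cells; rewrite ?addn0.
Qed.

End Reach.

(** * Processing one tuple and keeping the best clique *)

Definition update_com : com :=
  If (tlt (var 28) (var 27))
    (Seq (asg 28 (var 27)) (For 2 0 (ISet 1 (var 2) (IGet 26 (var 2))))) Skip.

Definition tuple_com (p : com) : com :=
  Seq cand_com (Seq fill_com (Seq (shift p) (Seq reach_com
  (Seq select_com update_com)))).

Section TryTuple.
Variables (R : realType) (f : nat -> nat) (p : com).
Hypothesis hp : forall (n : nat) (e : rel 'I_n), bipartite_graph e ->
  computes_within (R := R) p (graph_input e) (matching_output e) (f n).
Variables (n : nat) (x : nat -> vec R) (rho : nat -> R) (v : vec R).
Hypotheses (n0 : 0 < n) (v0 : v != vzero R)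
  (rho0 : forall i, i < n -> (0 <= rho i)%R).
Implicit Type s : state R.
Local Notation ctx := (ctx n x rho v).

Lemma wp_call s (e : rel 'I_n) : bipartite_graph e -> iarr s 40 0 = n ->
  (forall i j : 'I_n, iarr s 41 (i * n + j) = e i j) ->
  wp (shift p) (f n) (fun s' => exists M, maximum_matching e M /\
     forall i j : 'I_n, (iarr s' 42 i == j) = ([set i; j] \in M)) s.
Proof.
move=> be s0 se; have [|t [u [ex le [M [maxM hM]]]]] := hp be (s := unshift s).
  by split.
have [s' ex' eu] := exec_shift ex; exists t, s'; split=> //.
by exists M; split=> // i j; rewrite -hM -eu.
Qed.

Definition pairwise_adj (K : {set 'I_n}) : Prop := {in K &, forall i j : 'I_n, adj x rho i j}.

Definition best (A : {set 'I_n}) s : Prop :=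
  [/\ forall i, (i \in A) = nz s 1 i, iarr s 28 0 = #|A| & pairwise_adj A].

Lemma wp_update s A (S : {set 'I_n}) : iarr s 0 0 = n -> best A s -> pairwise_adj S ->
  (forall i, (i \in S) = nz s 26 i) -> iarr s 27 0 = #|S| ->
  wp update_com ((forcost (ISet 1 (var 2) (IGet 26 (var 2))) + 100) * n.+1)
    (fun s' => exists A', [/\ best A' s', #|A| <= #|A'| & #|S| <= #|A'|]) s.
Proof.
move=> sn [hA cA aA] aS hS cS; set c := forcost _.
apply: (@wp_le _ _ _ (tcost (tlt (var 28) (var 27)) +
  (maxcost (asg 28 (var 27)) + c * n.+1).+1).+1); first by rewrite /=; nia.
apply: wp_if => tb; last first.
  exists 1, s; split; [constructor|lia|].
  by exists A; split=> //; move: tb; rewrite /= cA cS negbK.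
apply: wp_seq; apply: wp_run => //; set s1 := run _ s.
apply: (@wp_frame _ _ _ _ (fun s' => forall i : nat, i < n -> iarr s' 1 i = iarr s 26 i)).
  apply: (@wp_for_run _ _ _ _ _
    (fun k s' => forall i : nat, i < k -> iarr s' 1 i = iarr s 26 i)) => //.
  move=> k s2 kn [u w] sk I i; rewrite ltnS leq_eqVlt => /orP[/eqP ->|ik].
    by cells; rewrite sk eqxx u.
  by cells; rewrite sk (ltn_eqF ik) I.
move=> s2 [u w] h; exists S; split=> //; last first.
  by move: tb; rewrite /= cA cS -ltnNge; exact: ltnW.
split=> // [i|]; first by rewrite hS /nz h.
by rewrite u.
Qed.

Section Tuple.
Variables (t : nat -> nat) (mk : nat).
Hypothesis tn : forall j, t j < n.

Definition tuple_cost : nat :=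
  cand_cost + forcost fill_body + round_cost + forcost init_reach_body +
  forcost select_body + forcost (ISet 1 (var 2) (IGet 26 (var 2))) + 1000.

Lemma wp_tuple s A : ctx s -> best A s ->
  iarr s 30 0 = mk -> iarr s 12 0 = mk + mk ->
  (forall j, j < mk + mk -> iarr s 10 j = t j) ->
  wp (tuple_com p) (tuple_cost * (n.+1 * (mk + n).+1) + f n)
    (fun s' => exists A', [/\ best A' s', #|A| <= #|A'| &
       forall K, pairwise_adj K ->
         (forall i : 'I_n, i \in K -> cand x rho v t mk i) -> #|K| <= #|A'|]) s.
Proof.
move=> cs bA smk sL st; have [hA cA aA] := bA.
pose E : rel 'I_n := gedge x rho v t mk.
set K1 := (cand_cost + 40) * (n.+1 * mk.+1).
set K2 := (forcost fill_body + 100) * (n.+1 * n.+1).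
set K3 := (round_cost + forcost init_reach_body + 100) * (n.+1 * n.+1).
set K4 := (forcost select_body + 100) * n.+1.
set K5 := (forcost (ISet 1 (var 2) (IGet 26 (var 2))) + 100) * n.+1.
apply: (@wp_le _ _ _ (K1 + (K2 + (f n + (K3 + (K4 + K5).+1).+1).+1).+1).+1).
  set P := n.+1 * (mk + n).+1.
  have [b1 b2 b3] : [/\ n.+1 * mk.+1 <= P, n.+1 * n.+1 <= P & n.+1 <= P].
    by rewrite /P leq_pmulr // !leq_mul2l; split=> //=; lia.
  have {b1}b1 : K1 <= (cand_cost + 40) * P by rewrite leq_mul2l b1 orbT.
  have b2' : K2 <= (forcost fill_body + 100) * P by rewrite leq_mul2l b2 orbT.
  have {b2}b2 : K3 <= (round_cost + forcost init_reach_body + 100) * P.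
    by rewrite leq_mul2l b2 orbT.
  have b4 : K4 <= (forcost select_body + 100) * P by rewrite leq_mul2l b3 orbT.
  have b5 : K5 <= (forcost (ISet 1 (var 2) (IGet 26 (var 2))) + 100) * P.
    by rewrite leq_mul2l b3 orbT.
  have P0 : 0 < P by [].
  clearbody P; rewrite /tuple_cost; move: K1 K2 K3 K4 K5 b1 b2' b2 b4 b5.
  move: cand_cost round_cost (forcost _) (forcost _) (forcost _) (forcost _).
  by move=> *; lia.
apply: (wp_bind (wp_cand n0 tn cs smk sL st)) => s1 us1 h1.
have cs1 := ctx_unch cs us1 isT.
have hc1 : cand_ok n x rho v t mk s1 by move=> i /h1[].
apply: (wp_bind (wp_fill n0 cs1 hc1)) => s2 us2 [e40 e41].
have cs2 := ctx_unch cs1 us2 isT.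
have col2 : forall i j, E i j -> nz s2 19 i != nz s2 19 j.
  apply: gedge_color => // i ni; rewrite /upper_ok (us2.1 19) //.
  by have [_] := h1 i ni.
have bip : bipartite_graph E.
  by split; [exact: gedge_sym|exact: gedge_irr|exists (nz s2 19)].
have se (i j : 'I_n) : iarr s2 41 (i * n + j) = E i j by rewrite e41.
apply: (wp_bind (wp_call bip e40 se)) => s3 us3 [M [maxM mateM]].
have iS d : d < 40 -> iarr s3 d = iarr s2 d by move=> h; rewrite us3.1 // wri_shift.
have rS d : d < 40 -> rarr s3 d = rarr s2 d by move=> h; rewrite us3.2 // wrr_shift.
have cs3 : ctx s3.
  have [q1 q2 q3 q4 q5] := cs2.
  by split=> [|||i ni|i ni]; rewrite ?iS ?(arr3_eq (s := s2)) ?rS //; [exact: q4|exact: q5].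
have hc3 : cand_ok n x rho v t mk s3.
  by move=> i ni; rewrite iS // us2.1 // hc1.
have col3 : forall i j, E i j -> nz s3 19 i != nz s3 19 j.
  by move=> i j /col2; rewrite /nz iS.
apply: (wp_bind (wp_reach n0 maxM mateM col3 cs3 hc3)) => s4 us4 h4.
have hc4 : cand_ok n x rho v t mk s4 by move=> i ni; rewrite us4.1 // hc3.
have sn4 : iarr s4 0 0 = n by rewrite us4.1 //; case: cs3.
have [cS oS] := closure_optimal maxM col3 h4.
apply: (wp_bind (wp_select n0 sn4 hc4)) => s5 us5 [h26 h27].
set S := [set i : 'I_n | _] in cS oS.
have eS : [set i | selb x rho v t mk s4 i] = S.
  by apply/setP => i; rewrite !inE /selb /nz (us4.1 19).
have e5 d : d \in [:: 1; 28] -> iarr s5 d = iarr s d.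
  by rewrite !inE => /orP[] /eqP ->; rewrite us5.1 // us4.1 // iS // us2.1 // us1.1.
have bA5 : best A s5 by split=> // [i|]; rewrite ?/nz e5.
apply: (@wp_frame _ _ _ _
  (fun s' => exists A', [/\ best A' s', #|A| <= #|A'| & #|S| <= #|A'|])).
  apply: wp_update => //.
  - by rewrite us5.1.
  - by move=> i; rewrite h26 -eS inE.
  - by rewrite h27 eS.
move=> s6 _ [A' [bA' leA leS]]; exists A'; split=> // K aK cK.
by apply: leq_trans leS; exact: oS.
Qed.

End Tuple.
End TryTuple.

(** * The complete algorithm *)

Definition same_radius_body : com :=
  If (TAnd (TRLe (RGet 3 (var 2)) (RGet 3 (var 3))) (TRLe (RGet 3 (var 3)) (RGet 3 (var 2))))
    (asg 5 (IConst 0)) Skip.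
(** A radius contributes to the count at its first occurrence only, so variable 4 ends up holding
    the number of distinct radii. *)
Definition count_row : com :=
  Seq (asg 5 (IConst 1)) (Seq (For 3 2 same_radius_body) (asg 4 (IAdd (var 4) (var 5)))).
Definition count_radii : com := Seq (asg 4 (IConst 0)) (For 2 0 count_row).

Definition tuple_length_com : com :=
  Seq (asg 30 (IConst 0)) (Seq (For 2 6 (asg 30 (IAdd (var 30) (var 4))))
    (asg 12 (IAdd (var 30) (var 30)))).
Definition project_body : com :=
  let u := ecross (vvar 13) (entry 0 (var 2)) in
  Seq (RSet 16 (var 2) u.1.1) (Seq (RSet 17 (var 2) u.1.2)
  (Seq (RSet 18 (var 2) u.2) (RSet 19 (var 2) (edot (vvar 13) (entry 0 (var 2)))))).
Definition clear_best : com :=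
  Seq (asg 28 (IConst 0)) (For 2 0 (ISet 1 (var 2) (IConst 0))).
Definition search_com (p : com) : com :=
  Seq tuple_length_com (Seq (For 2 0 project_body)
  (Seq clear_best (enum_tuples (tuple_com p)))).

(** [undup] keeps last occurrences while the program counts first ones, so the induction appends at
    the end: the new value either removes its old copy or adds one. *)
Lemma size_undup_count (T : eqType) (g : nat -> T) n :
  size (undup (map g (iota 0 n))) =
  \sum_(0 <= i < n) all (fun j => g j != g i) (iota 0 i).
Proof.
elim: n => [|n IH]; first by rewrite big_geq.
rewrite iota0S map_cat cats1 undup_rcons size_rcons big_nat_recr //= -IH.
set s := map g _; set l := undup s.
have -> : all (fun j => g j != g n) (iota 0 n) = (g n \notin s).
  rewrite /s; elim: (iota 0 n) => //= i r ->.
  by rewrite inE negb_or eq_sym.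
rewrite -mem_undup -/l size_filter.
have ul : uniq l by exact: undup_uniq.
have := count_predC (pred1 (g n)) l; rewrite (count_uniq_mem _ ul).
rewrite (eq_count (a2 := fun y => y != g n)) //.
by case: (g n \in l) => /= <-; rewrite ?addn0 ?add0n ?addn1 ?add1n.
Qed.

Section Search.
Variables (R : realType) (n : nat).
Hypothesis n0 : 0 < n.
Implicit Type s : state R.

Lemma wp_count_radii s : iarr s 0 0 = n ->
  wp count_radii ((forcost same_radius_body + 100) * (n.+1 * n.+1))
    (fun s' => iarr s' 4 0 = size (undup (map (rarr s 3) (iota 0 n)))) s.
Proof.
move=> sn; set c := forcost _; pose b i := all (fun j => rarr s 3 j != rarr s 3 i) (iota 0 i).
apply: (@wp_le _ _ _ (maxcost (asg 4 (IConst 0)) + (n * ((maxcost (asg 5 (IConst 1)) +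
   (c * n.+1 + maxcost (asg 4 (IAdd (var 4) (var 5)))).+1).+1 + 20) + 20)).+1).
  by rewrite /=; nia.
apply: wp_seq; apply: wp_run => //; set s1 := run _ s.
rewrite size_undup_count.
apply: (@wp_for _ _ _ _ _ _ (fun i s' => iarr s' 4 0 = \sum_(0 <= j < i) b j)) => //.
  by rewrite big_geq.
move=> i s2 iN [u w] si I.
apply: wp_seq; apply: wp_run => //; set s3 := run _ s2.
apply: (@wp_le _ _ _ (c * i.+1 + maxcost (asg 4 (IAdd (var 4) (var 5)))).+1); first nia.
apply: (@wp_bind _ _ _ _ _ (fun s' => iarr s' 5 0 = b i)).
  apply: (@wp_for_run _ _ _ _ _
    (fun k s' => iarr s' 5 0 = all (fun j => rarr s 3 j != rarr s 3 i) (iota 0 k))) => //.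
  move=> k s4 ki [u4 w4] sk Ik.
  have s4i : iarr s4 2 0 = i by rewrite u4.
  have e3 : rarr s4 3 = rarr s 3 by rewrite w4 // w.
  rewrite iota0S all_cat /= andbT; cells; rewrite sk s4i e3 eq_sym eq_le.
  by case: ifP => h; rewrite ?andbF ?andbT; cells.
move=> s4 [u4 w4] e5; apply: wp_run => //; cells.
by rewrite e5 u4 // [iarr s3 4 0]I big_nat_recr.
Qed.

Variables (f : nat -> nat) (p : com).
Hypothesis hp : forall (n : nat) (e : rel 'I_n), bipartite_graph e ->
  computes_within (R := R) p (graph_input e) (matching_output e) (f n).

Definition search_cost : nat :=
  forcost (asg 30 (IAdd (var 30) (var 4))) + forcost project_body +
  forcost (ISet 1 (var 2) (IConst 0)) + 1000.

Lemma wp_search s m k (x := arr3 s 0) (rho := rarr s 3) (v := arr3 s 13 0) :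
  iarr s 0 0 = n -> iarr s 6 0 = m -> iarr s 4 0 = k -> v != vzero R ->
  (forall i, i < n -> (0 <= rho i)%R) ->
  wp (search_com p) (search_cost * (m.+1 * n.+1) +
     (n ^ (m * k + m * k) * ((tuple_cost * (n.+1 * (m * k + n).+1) + f n) +
        enum_cost * (m * k + m * k).+1) + enum_cost * (n.+1 * (m * k + m * k).+1)))
   (fun s' => exists A : {set 'I_n}, best x rho A s' /\ forall tau, tau < n ^ (m * k + m * k) ->
      forall K : {set 'I_n}, pairwise_adj x rho K ->
        (forall i : 'I_n, i \in K -> cand x rho v (digit n tau) (m * k) i) ->
        #|K| <= #|A|) s.
Proof.
move=> sn sm sk v0 rho0.
set T := (X in _ + X).
apply: (@wp_le _ _ _ ((maxcost (asg 30 (IConst 0)) +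
    (forcost (asg 30 (IAdd (var 30) (var 4))) * m.+1 +
      maxcost (asg 12 (IAdd (var 30) (var 30)))).+1).+1 +
  (forcost project_body * n.+1 + ((maxcost (asg 28 (IConst 0)) +
    forcost (ISet 1 (var 2) (IConst 0)) * n.+1).+1 + T).+1).+1).+1).
  rewrite /search_cost /=; move: T (forcost _) (forcost _) (forcost _) => *; nia.
apply: (@wp_bind _ _ _ _ _ (fun s' => iarr s' 30 0 = m * k /\ iarr s' 12 0 = m * k + m * k)).
  apply: wp_seq; apply: wp_run => //.
  apply: (@wp_bind _ _ _ _ _ (fun s' => iarr s' 30 0 = m * k)).
    apply: (@wp_for_run _ _ _ _ _ (fun i s' => iarr s' 30 0 = i * k)) => //.
    by move=> i s' im [u w] si I; cells; rewrite I u // [iarr _ 4 0]sk mulSnr.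
  by move=> s' _ e30; apply: wp_run => //; cells; rewrite e30.
move=> s1 [u1 w1] [e30 e12].
have sn1 : iarr s1 0 0 = n by rewrite u1.
apply: (@wp_bind _ _ _ _ _ (fun s' => forall i, i < n ->
   arr3 s' 16 i = cross v (x i) /\ rarr s' 19 i = dot v (x i))).
  apply: (@wp_for_run _ _ _ _ _ (fun k s' => forall i, i < k ->
   arr3 s' 16 i = cross v (x i) /\ rarr s' 19 i = dot v (x i))) => //.
  move=> i s2 iN [u w] si I.
  have ex : arr3 s2 0 = x by rewrite (arr3_eq (s := s1)) ?w // (arr3_eq (s := s)) ?w1.
  have ev : arr3 s2 13 0 = v by rewrite (arr3_eq (s := s1)) ?w // (arr3_eq (s := s)) ?w1.
  move=> j; rewrite ltnS leq_eqVlt => /orP[/eqP ->|ji]; last first.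
    have [<- <-] := I j ji; rewrite /arr3; cells.
    by rewrite si (ltn_eqF ji).
  by rewrite -ev -ex /arr3; cells; rewrite si eqxx.
move=> s2 [u2 w2] h16.
apply: (@wp_bind _ _ _ _ _ (fun s' => iarr s' 28 0 = 0 /\
    forall i, i < n -> iarr s' 1 i = 0)).
  apply: wp_seq; apply: wp_run => //.
  apply: (@wp_frame _ _ _ _ (fun s' => forall i, i < n -> iarr s' 1 i = 0)).
    apply: (@wp_for_run _ _ _ _ _ (fun k s' => forall i, i < k -> iarr s' 1 i = 0)) => //.
      by cells; rewrite u2.
    move=> i s' iN [u w] si I j; rewrite ltnS leq_eqVlt; cells; rewrite si.
    by case: eqP => //= _ /I.
  by move=> s' [u w] h; split=> //; rewrite u.
move=> s3 [u3 w3] [e28 e1].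
have c3 : ctx n x rho v s3.
  split=> [|||i ni|i ni].
  - by rewrite u3 // u2.
  - by rewrite (arr3_eq (s := s2)) ?w3 // (arr3_eq (s := s1)) ?w2 // (arr3_eq (s := s)) ?w1.
  - by rewrite w3 // w2 // w1.
  - by rewrite (arr3_eq (s := s2)) ?w3 //; case: (h16 i ni).
  - by rewrite w3 //; case: (h16 i ni).
pose J tau (s' : state R) := exists A : {set 'I_n}, best x rho A s' /\ forall tau', tau' < tau ->
      forall K : {set 'I_n}, pairwise_adj x rho K ->
        (forall i : 'I_n, i \in K -> cand x rho v (digit n tau') (m * k) i) ->
        #|K| <= #|A|.
apply: (@wp_enum _ _ _ _ _ J) => //.
- by rewrite u3 // u2.
- by rewrite u3 // u2.
- by rewrite /= !wri_shift.
- move=> tau s4 s5 h1 h2 [A [[hA cA aA] opt]]; exists A; split=> //.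
  by split=> // [i|]; rewrite ?/nz h1.
- exists set0; split=> //; split=> [i||i j].
  + by rewrite inE /nz e1.
  + by rewrite cards0.
  + by rewrite inE.
move=> tau s4 tauN us4 d4 [A [bA opt]]; have [u4 w4] := us4.
have c4 : ctx n x rho v s4.
  by apply: ctx_unch c3 us4 _; rewrite /= wri_shift // !wrr_shift.
apply: wp_frame.
  apply: (wp_tuple hp n0 v0 rho0 (t := digit n tau) (mk := m * k) _ c4 bA _ _ d4).
  - by move=> j; apply: ltn_digit.
  - by rewrite u4 ?u3 ?u2 //= wri_shift.
  - by rewrite u4 ?u3 ?u2 //= wri_shift.
move=> s5 _ [A' [bA' leA opt']]; exists A'; split=> // tau'.
rewrite ltnS leq_eqVlt => /orP[/eqP -> K aK cK|lt K aK cK]; first exact: opt'.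
by apply: leq_trans leA; exact: opt cK.
Qed.

End Search.

Lemma eq_cand (R : realType) x rho (v : vec R) t t' mk i :
  (forall j, j < mk + mk -> t j = t' j) -> cand x rho v t mk i = cand x rho v t' mk i.
Proof.
move=> h; rewrite /cand; congr (_ && _).
  by apply: eq_in_has => c; rewrite mem_iota /= add0n => cm; rewrite /tstrip !h //; lia.
by apply: eq_in_all => j; rewrite mem_iota /= add0n => jm; rewrite h.
Qed.

(** * Every clique is covered by some guess *)

Section CliqueTuple.
Variables (R : realType) (n : nat) (x : nat -> vec R) (rho : nat -> R) (v : vec R).

(* For each line and each radius, the tuple contains the two extreme points of
   the clique among the balls of that radius projected onto that line. *)
Lemma clique_tuple m (rs : seq R) (K : {set 'I_n}) :
  on_lines x n v m -> (forall i, i < n -> rho i \in rs) -> pairwise_adj x rho K ->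
  K != set0 ->
  exists t, (forall j, t j < n) /\
    forall i : 'I_n, i \in K -> cand x rho v t (m * size rs) i.
Proof.
move=> [lab [labm hlab]] hrs aK /set0Pn[i0 i0K].
pose C c : pred 'I_n := fun i =>
  [&& i \in K, lab i == c %/ size rs & rho i == nth 0%R rs (c %% size rs)].
have ex c : exists pq : 'I_n * 'I_n, [/\ pq.1 \in K, pq.2 \in K &
    forall i, C c i -> in_strip x rho v pq.1 pq.2 i].
  (* An empty class still needs two entries in the tuple. A member of [K] is used, so that all of
     [K] remains adjacent to every guessed ball. *)
  have [a Ca|C0] := pickP (C c); last by exists (i0, i0); split=> // i; rewrite C0.
  have /and3P[aKa /eqP la /eqP ra] := Ca.
  have [B [d [s hs]]] := hlab _ (labm a (ltn_ord a)).
  have Cs (i : 'I_n) : C c i -> cross v (x i) = vadd B (vscale (s i) d).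
    by move=> /and3P[_ /eqP li _]; apply: hs => //; rewrite li la.
  case: (arg_minP (fun i : 'I_n => s i) Ca) => p Cp minp.
  case: (arg_maxP (fun i : 'I_n => s i) Ca) => q Cq maxq.
  exists (p, q); split=> /=; [by case/and3P: Cp|by case/and3P: Cq|].
  move=> i Ci; have [_ _ /eqP ri] := and3P Ci.
  have [_ _ /eqP rp] := and3P Cp; have [_ _ /eqP rq] := and3P Cq.
  apply: (in_strip_of_param (B := B) (d := d) (s := s)).
  - by move=> j; rewrite !inE => /or3P[]/eqP ->; apply: Cs.
  - by rewrite rp ri.
  - by rewrite rq ri.
  - by apply/andP; split; [exact: minp|exact: maxq].
have [g hg] := boolp.choice ex.
pose t j : nat := if odd j then (g j./2).2 else (g j./2).1.
have te c : t (c + c) = (g c).1 by rewrite /t addnn odd_double doubleK.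
have to c : t (c + c).+1 = (g c).2 by rewrite /t addnn /= odd_double /= uphalf_double.
exists t; split=> [j|i iK]; first by rewrite /t; case: ifP.
apply/andP; split; last first.
  apply/allP => j _; rewrite /t; have [h1 h2 _] := hg j./2.
  by case: ifP => _; apply: aK.
have irs := hrs i (ltn_ord i); have ilt : index (rho i) rs < size rs by rewrite index_mem.
have lm := labm i (ltn_ord i).
pose c := lab i * size rs + index (rho i) rs.
apply/hasP; exists c.
  rewrite mem_iota /= add0n /c; apply: (@leq_trans ((lab i).+1 * size rs)).
    by rewrite mulSnr ltn_add2l.
  by rewrite leq_mul2r lm orbT.
have [_ _ h] := hg c; rewrite /tstrip te to; apply: h.
rewrite /C iK /c divnMDl; last exact: leq_ltn_trans ilt.
by rewrite divn_small // addn0 modnMDl modn_small // nth_index // !eqxx.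
Qed.

End CliqueTuple.

(** * From the geometric input to the abstract data *)

Section Geometry.
Local Open Scope ring_scope.
Variable R : realType.

Definition coords (u : 'rV[R]_3) : vec R :=
  (u 0 ord0, u 0 (lift ord0 ord0), u 0 (lift ord0 (lift ord0 ord0))).

Lemma dotv_coords u w : dotv u w = dot (coords u) (coords w).
Proof. by rewrite /dotv !big_ord_recl big_ord0 addr0 addrA. Qed.

Lemma coords_sub u w : coords (u - w) = vsub (coords u) (coords w).
Proof. by rewrite /coords !mxE. Qed.

Lemma coords_eq0 u : coords u = vzero R -> u = 0.
Proof.
move=> [h1 h2 h3]; apply/rowP => j; rewrite mxE.
case: (unliftP ord0 j) => [j1 ->|-> //]; case: (unliftP ord0 j1) => [j2 ->|-> //].
by rewrite (ord1 j2).
Qed.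

Variables (n : nat) (B : 'I_n -> ball R) (s : state R).
Hypothesis inp : balls_input B s.

Lemma input_coords (i : 'I_n) : coords (center (B i)) = arr3 s 0 i.
Proof. by case: inp => _ h _; rewrite /coords /arr3 -!h. Qed.

Lemma ball_graph_adj (i j : 'I_n) :
  ball_graph B i j = (i != j) && adj (arr3 s 0) (rarr s 3) i j.
Proof.
have [_ _ hr] := inp; rewrite /ball_graph /adj /edist dotv_coords coords_sub !input_coords !hr.
set r := (_ + _)%R; have r0 : 0 <= r by rewrite addr_ge0 ?radius_ge0.
by rewrite -{1}(ger0_norm r0) -sqrtr_sqr ler_sqrt // sqr_ge0.
Qed.

Lemma pairwise_adj_clique (K : {set 'I_n}) :
  pairwise_adj (arr3 s 0) (rarr s 3) K <-> clique (ball_graph B) K.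
Proof.
split=> h i j iK jK; first by move=> ij; rewrite ball_graph_adj ij h.
have [->|ij] := eqVneq i j; first exact: adj_refl.
by have := h i j iK jK ij; rewrite ball_graph_adj ij.
Qed.

Lemma nb_radii_input :
  nb_radii B = size (undup (map (rarr s 3) (iota 0 n))).
Proof.
have [_ _ hr] := inp; rewrite /nb_radii -val_enum_ord -map_comp; congr (size (undup _)).
by apply: eq_map => i; rewrite /= hr.
Qed.

(** The normal of [P0] is the common direction. If [r] exceeds [n], each ball becomes its own class
    with the plane it lies on, which caps the number of planes at [n]. *)
Lemma planes_tuple r : (0 < n)%N -> centers_on_perpendicular_planes B r ->
  let r' := minn r n in (0 < r')%N /\ exists t, (forall j, (t j < n)%N) /\
    accepting n (greedy_run (arr3 s 0) n t r').
Proof.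
move=> n0 [P0 [P [perp onP]]] r'.
have [lb hlb] := boolp.choice onP.
have r0 : (0 < r)%N by apply: leq_ltn_trans (ltn_ord (lb (Ordinal n0))).
have r'0 : (0 < r')%N by rewrite leq_min r0 n0.
split=> //.
suff [lab [nr [ofs [h1 h2 h3 h4]]]] : exists (lab : nat -> nat) (nr : nat -> vec R) (ofs : nat -> R),
   [/\ forall i, (i < n)%N -> (lab i < r')%N,
       forall l, (l < r')%N -> nr l != vzero R,
       forall l, (l < r')%N -> dot (nr l) (coords (normal P0)) = 0 &
       forall i, (i < n)%N -> dot (nr (lab i)) (arr3 s 0 i) = ofs (lab i)].
  have [|t tn acc] := accepting_exists n0 _ h1 h2 h3 h4; last by exists t.
  by apply/eqP => /coords_eq0 h; have := normal_neq0 P0; rewrite h eqxx.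
have nz l : coords (normal (P l)) != vzero R.
  by apply/eqP => /coords_eq0 h; have := normal_neq0 (P l); rewrite h eqxx.
have pp l : dot (coords (normal (P l))) (coords (normal P0)) = 0.
  by rewrite -dotv_coords; apply: perp.
have on i : dot (coords (normal (P (lb i)))) (arr3 s 0 i) = offset (P (lb i)).
  by rewrite -input_coords -dotv_coords; apply: hlb.
pose ir (k : nat) : 'I_r := insubd (Ordinal r0) k.
pose ib (k : nat) : 'I_n := insubd (Ordinal n0) k.
have ibE (i : 'I_n) : ib i = i by apply: val_inj; rewrite val_insubd ltn_ord.
have ibn i (ni : (i < n)%N) : ib i = Ordinal ni := ibE (Ordinal ni).
have irE (i : 'I_r) : ir i = i by apply: val_inj; rewrite val_insubd ltn_ord.
case: (leqP r n) => rn.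
  exists (fun i => lb (ib i)), (fun l => coords (normal (P (ir l)))),
    (fun l => offset (P (ir l))); split=> //.
    by move=> i ni; rewrite /r' (minn_idPl rn).
  by move=> i ni; rewrite irE (ibn i ni) (on (Ordinal ni)).
exists id, (fun i => coords (normal (P (lb (ib i))))), (fun i => offset (P (lb (ib i)))).
split=> //.
  by move=> i ni; rewrite /r' (minn_idPr (ltnW rn)).
by move=> i ni; rewrite (ibn i ni) (on (Ordinal ni)).
Qed.

End Geometry.

(** * Adding up the running times *)

Definition search_time (n F m k : nat) : nat :=
  search_cost * (m.+1 * n.+1) +
  (n ^ (m * k + m * k) * ((tuple_cost * (n.+1 * (m * k + n).+1) + F) +
     enum_cost * (m * k + m * k).+1) + enum_cost * (n.+1 * (m * k + m * k).+1)).

Lemma leq_search_time n F m m' k : 0 < n -> m <= m' ->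
  search_time n F m k <= search_time n F m' k.
Proof.
move=> n0 mm; have mk : m * k <= m' * k by rewrite leq_mul2r mm orbT.
have mk2 : m * k + m * k <= m' * k + m' * k by rewrite leq_add.
rewrite /search_time; move: search_cost tuple_cost enum_cost => c3 c4 c5.
have hk : (m * k + n).+1 <= (m' * k + n).+1 by rewrite ltnS leq_add2r.
have mkS : (m * k + m * k).+1 <= (m' * k + m' * k).+1 by rewrite ltnS.
apply: leq_add; first by rewrite leq_mul2l leq_mul2r ltnS mm !orbT.
apply: leq_add; last by rewrite !leq_mul2l mkS !orbT.
apply: leq_mul; first by rewrite leq_pexp2l.
apply: leq_add; last by rewrite leq_mul2l mkS orbT.
by rewrite leq_add2r !leq_mul2l hk !orbT.
Qed.

(** From [0 < k] the direction search stays below [n ^ (2 * r * k)], and from [k <= n] the tuple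
    length times [n] stays below [n ^ 2 * r]. The factors 4, 6 and 3 count terms, each at most
    [n ^ 2 * r], after expanding the products; 9 is 6 + 3. *)
Lemma leq_total_time (c1 c2 F n r r' k : nat) :
  0 < n -> 0 < k -> k <= n -> 0 < r' -> r' <= n -> r' <= r ->
  c1 * (n.+1 * n.+1) +
    (c2 * (n ^ (2 * r') * (n ^ 2 * r')) + search_time n F r' k).+2 <=
  (4 * c1 + c2 + 4 * search_cost + 6 * tuple_cost + 9 * enum_cost + 3) *
    (n ^ (2 * r * k) * (F + n ^ 2 * r)).
Proof.
move=> n0 k0 kn r0 rn rr; rewrite /search_time.
move: search_cost tuple_cost enum_cost => c3 c4 c5.
set N := n ^ (2 * r * k); set X := n ^ 2 * r.
have N0 : 0 < N by rewrite expn_gt0 n0.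
have X0 : 0 < X by rewrite muln_gt0 expn_gt0 n0 /=; lia.
have e1 : n ^ (2 * r') <= N by rewrite leq_pexp2l //; nia.
have e2 : n ^ (r' * k + r' * k) <= N by rewrite leq_pexp2l //; nia.
have nn : n * n <= X by rewrite /X -mulnn leq_pmulr //; lia.
have mk : r' * k <= r * n by rewrite leq_mul.
have mkX : r' * k * n <= X by rewrite /X -mulnn mulnC -mulnA leq_mul2l [n * r]mulnC mk orbT.
have nX : n <= X by apply: leq_trans nn; rewrite leq_pmulr.
have mX : r' * k <= X by apply: leq_trans mkX; rewrite leq_pmulr.
have h1 : c1 * (n.+1 * n.+1) <= N * (c1 * (4 * X)).
  by apply: leq_trans (leq_pmull _ N0); rewrite leq_mul2l; apply/orP; right; lia.
have h2 : c2 * (n ^ (2 * r') * (n ^ 2 * r')) <= N * (c2 * X).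
  by rewrite mulnCA; apply: leq_mul => //; rewrite leq_mul2l leq_mul2l rr !orbT.
have h3 : c3 * (r'.+1 * n.+1) <= N * (c3 * (4 * X)).
  apply: leq_trans (leq_pmull _ N0); rewrite leq_mul2l; apply/orP; right.
  by apply: (@leq_trans (n.+1 * n.+1)); [rewrite leq_mul|lia].
have h4 : n.+1 * (r' * k + n).+1 <= 6 * X by rewrite mulSn mulnS mulnDr; lia.
have h5 : (r' * k + r' * k).+1 <= 3 * X by lia.
have h6 : c5 * (n.+1 * (r' * k + r' * k).+1) <= N * (c5 * (6 * X)).
  apply: leq_trans (leq_pmull _ N0); rewrite leq_mul2l; apply/orP; right.
  by rewrite mulSn mulnS mulnDr; lia.
have h7 : n ^ (r' * k + r' * k) * (c4 * (n.+1 * (r' * k + n).+1) + F +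
    c5 * (r' * k + r' * k).+1) <= N * (c4 * (6 * X) + F + c5 * (3 * X)).
  by rewrite leq_mul // !leq_add // leq_mul.
have h8 : 2 <= N * (2 * X).
  by apply: (@leq_trans (1 * (2 * 1))) => //; rewrite !leq_mul.
apply: (@leq_trans (N * (c1 * (4 * X)) + (N * (c2 * X) + (N * (c3 * (4 * X)) +
  (N * (c4 * (6 * X) + F + c5 * (3 * X)) + N * (c5 * (6 * X))))) + N * (2 * X))).
  by rewrite -addn2 addnA leq_add // leq_add // leq_add // leq_add // leq_add.
have -> : N * (c1 * (4 * X)) + (N * (c2 * X) + (N * (c3 * (4 * X)) +
  (N * (c4 * (6 * X) + F + c5 * (3 * X)) + N * (c5 * (6 * X))))) + N * (2 * X) =
  N * F + (4 * c1 + c2 + 4 * c3 + 6 * c4 + 9 * c5 + 2) * (N * X) by ring.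
rewrite [N * (F + X)]mulnDr mulnDr; apply: leq_add.
  by rewrite leq_pmull // addnS.
by rewrite leq_mul2r; apply/orP; right; lia.
Qed.

Theorem theorem5p6 (R : realType) (f : nat -> nat)
    (hf : bipartite_matching_time R f) :
  exists (p : com) (C : nat),
    forall (n r k : nat) (B : 'I_n -> ball R),
      0 < n ->
      nb_radii B = k ->
      centers_on_perpendicular_planes B r ->
      computes_within p (balls_input B) (clique_output B)
        (C * (n ^ (2 * r * k) * (f n + n ^ 2 * r))).
Proof.
have [p hp] := hf.
exists (Seq count_radii (Seq find_direction (search_com p))).
pose c1 := forcost same_radius_body + 100.
pose c2 := 4 * cover_cost + 9 * enum_cost + 200.
exists (4 * c1 + c2 + 4 * search_cost + 6 * tuple_cost + 9 * enum_cost + 3).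
move=> n r k B n0 hk hB s inp.
have [r'0 [t [tn acc]]] := planes_tuple inp n0 hB; set r' := minn r n in r'0 acc.
have [sn _ hr] := inp.
pose rs := undup (map (rarr s 3) (iota 0 n)).
have rsk : size rs = k by rewrite -hk (nb_radii_input inp).
have rsP i : i < n -> rarr s 3 i \in rs.
  by move=> ni; rewrite mem_undup map_f // mem_iota.
have k0 : 0 < k by rewrite -rsk -has_predT; apply/hasP; exists (rarr s 3 0) => //; apply: rsP.
have kn : k <= n by rewrite -rsk (leq_trans (size_undup _)) // size_map size_iota.
have rho0 i : i < n -> (0 <= rarr s 3 i)%R.
  by move=> ni; rewrite -[i]/(val (Ordinal ni)) hr radius_ge0.
have r'n : 0 < r' <= n by rewrite r'0 geq_minr.
apply: wp_le (leq_total_time (r' := r') c1 c2 (f n) n0 k0 kn r'0 (geq_minr _ _) (geq_minl _ _)) _.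
rewrite addnS; apply: (wp_bind (wp_count_radii n0 sn)) => s1 us1 e4.
have [u1 w1] := us1.
have x1 : arr3 s1 0 = arr3 s 0 by rewrite (arr3_eq (s := s)) ?w1.
have sn1 : iarr s1 0 0 = n by rewrite u1.
apply: (wp_bind (wp_find_direction n0 sn1 x1 r'n tn acc)) => s2 us2 [m [mr e6 v0 lines]].
have [u2 w2] := us2.
(* The search runs with the number [m] actually found, which may be smaller than [r']. *)
apply: wp_le (leq_search_time (f n) k n0 mr) _.
have x2 : arr3 s2 0 = arr3 s 0 by rewrite (arr3_eq (s := s1)) ?w2.
have rho2 : rarr s2 3 = rarr s 3 by rewrite w2 // w1.
have sn2 : iarr s2 0 0 = n by rewrite u2.
have e42 : iarr s2 4 0 = k by rewrite u2 // e4.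
apply: wp_frame.
  by apply: (wp_search n0 hp sn2 e6 e42 v0); rewrite rho2.
rewrite x2 rho2 => s3 _ [A [[hA _ aA] opt]].
rewrite /clique_output; have -> : [set i : 'I_n | iarr s3 1 i != 0] = A.
  by apply/setP => i; rewrite inE hA.
split; first exact/(pairwise_adj_clique inp).
move=> K /(pairwise_adj_clique inp) aK.
have [->|K0] := eqVneq K set0; first by rewrite cards0.
have [t' [tn' ct']] := clique_tuple lines rsP aK K0.
rewrite rsk in ct'.
(* The tuple suited to [K] occurs in the enumeration, at least on the [2 m k] positions on which
   [cand] depends. *)
have [tau tauN dt] := @digit_surj n (m * k + m * k) t' (fun j _ => tn' j).
apply: (opt tau) => // i /ct' ci; have <- : cand (arr3 s 0) (rarr s 3) (arr3 s2 13 0) t' (m * k) i =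
  cand (arr3 s 0) (rarr s 3) (arr3 s2 13 0) (digit n tau) (m * k) i; last by [].
by apply: eq_cand => j jm; rewrite dt.
Qed.
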